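(* Let $\Omega\subset\mathbb{R}^N$ be a bounded domain whose boundary $\partial\Omega$ is of class $C^{2,\alpha}$ for some $\alpha\in(0,1)$. Let $a,c\in C^{0,\alpha}(\overline{\Omega})$ satisfy $a(x)>0$ and $c(x)>0$ for every $x\in\overline{\Omega}$. Then the problem $$-\Delta u+c(x)\,u^{-1}|\nabla u|^{2}=a(x)\ \text{ in }\Omega,\qquad u=0\ \text{ on }\partial\Omega,$$ has at least one solution $u\in C(\overline{\Omega})\cap C^{2,\alpha}(\Omega)$ with $u>0$ in $\Omega$. *)

(* Defs.v *)
From Stdlib Require Import Reals.
From mathcomp Require Import ssreflect ssrbool eqtype ssrnat fintype bigop.
Set Implicit Arguments. Unset Strict Implicit.

Open Scope R_scope.

Definition RN (N : nat) := 'I_N -> R.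

Definition norm2 {N : nat} (x : RN N) : R := \big[Rplus/0]_(i < N) (x i * x i).
Definition dist {N : nat} (x y : RN N) : R := sqrt (norm2 (fun i => x i - y i)).

Definition ball {N : nat} (x0 : RN N) (r : R) : RN N -> Prop :=
  fun y => dist x0 y < r.

Definition is_open {N : nat} (U : RN N -> Prop) : Prop :=
  forall x, U x -> exists r, 0 < r /\ forall y, dist x y < r -> U y.

Definition is_connected {N : nat} (U : RN N -> Prop) : Prop :=
  forall A B : RN N -> Prop, is_open A -> is_open B ->
    (forall x, U x <-> A x \/ B x) -> (forall x, ~ (A x /\ B x)) ->
    (forall x, ~ A x) \/ (forall x, ~ B x).

Definition is_domain {N : nat} (U : RN N -> Prop) : Prop :=
  (exists x, U x) /\ is_open U /\ is_connected U.

Definition is_bounded {N : nat} (U : RN N -> Prop) : Prop :=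
  exists M, forall x, U x -> dist x (fun _ => 0) <= M.

Definition closure {N : nat} (U : RN N -> Prop) : RN N -> Prop :=
  fun x => forall eps, 0 < eps -> exists y, U y /\ dist x y < eps.

Definition boundary {N : nat} (U : RN N -> Prop) : RN N -> Prop :=
  fun x => closure U x /\ ~ U x.

Definition cont_on {N : nat} (S : RN N -> Prop) (f : RN N -> R) : Prop :=
  forall x, S x -> forall eps, 0 < eps ->
    exists d, 0 < d /\ forall y, S y -> dist x y < d -> Rabs (f y - f x) < eps.

Definition holder_on {N : nat} (S : RN N -> Prop) (alpha : R) (f : RN N -> R) : Prop :=
  exists K, forall x y, S x -> S y -> x <> y ->
    Rabs (f x - f y) <= K * Rpower (dist x y) alpha.

Definition C0a_closure {N : nat} (U : RN N -> Prop) (alpha : R) (f : RN N -> R) : Prop :=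
  holder_on (closure U) alpha f.

Definition upd {N : nat} (x : RN N) (i : 'I_N) (t : R) : RN N :=
  fun j => if j == i then t else x j.

Definition has_partial {N : nat} (i : 'I_N) (f : RN N -> R) (x : RN N) (l : R) : Prop :=
  derivable_pt_lim (fun t => f (upd x i t)) (x i) l.

(* f belongs to C^{2,alpha}(U) (U open; local Hoelder space as in
   Gilbarg-Trudinger), with first partials Df i = d_i f and second partials
   D2f i j = d_j d_i f on U. *)
Definition C2a_with {N : nat} (U : RN N -> Prop) (alpha : R) (f : RN N -> R)
  (Df : 'I_N -> RN N -> R) (D2f : 'I_N -> 'I_N -> RN N -> R) : Prop :=
  (forall x, U x -> forall i, has_partial i f x (Df i x)) /\
  (forall x, U x -> forall i j, has_partial j (Df i) x (D2f i j x)) /\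
  cont_on U f /\ (forall i, cont_on U (Df i)) /\
  (forall i j, cont_on U (D2f i j)) /\
  (forall x, U x -> exists r, 0 < r /\ (forall y, dist x y < r -> U y) /\
      forall i j, holder_on (ball x r) alpha (D2f i j)).

Definition C2a {N : nat} (U : RN N -> Prop) (alpha : R) (f : RN N -> R) : Prop :=
  exists Df D2f, C2a_with U alpha f Df D2f.

Definition C2a_vec {N : nat} (U : RN N -> Prop) (alpha : R) (psi : RN N -> RN N) : Prop :=
  forall k : 'I_N, C2a U alpha (fun x => psi x k).

Definition half_space {N : nat} (y : RN N) : Prop :=
  forall i : 'I_N, nat_of_ord i = 0%nat -> 0 < y i.
Definition half_space_bd {N : nat} (y : RN N) : Prop :=
  forall i : 'I_N, nat_of_ord i = 0%nat -> y i = 0.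

(* Boundary of class C^{2,alpha} (Gilbarg-Trudinger, Sect. 6.2): every
   boundary point x0 has a ball B and a one-to-one map psi of B onto an
   (open) set D with psi(B /\ U) in R^N_+, psi(B /\ dU) in dR^N_+,
   psi in C^{2,alpha}(B), psi^{-1} in C^{2,alpha}(D). *)
Definition C2a_boundary {N : nat} (U : RN N -> Prop) (alpha : R) : Prop :=
  forall x0, boundary U x0 ->
    exists r (psi phi : RN N -> RN N),
      0 < r /\
      let B := ball x0 r in
      let D := fun y => exists x, B x /\ psi x = y in
      is_open D /\
      (forall x, B x -> phi (psi x) = x) /\
      (forall x, B x -> U x -> half_space (psi x)) /\
      (forall x, B x -> boundary U x -> half_space_bd (psi x)) /\
      C2a_vec B alpha psi /\ C2a_vec D alpha phi.

Definition laplacian {N : nat} (D2u : 'I_N -> 'I_N -> RN N -> R) (x : RN N) : R :=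
  \big[Rplus/0]_(i < N) D2u i i x.
Definition grad_sq {N : nat} (Du : 'I_N -> RN N -> R) (x : RN N) : R :=
  \big[Rplus/0]_(i < N) (Du i x * Du i x).

(* Main.v *)
(* The problem is discretised on the lattice h Z^N by the upwind scheme
     lap u - (c / u) sum_y (u - u(y))_+^2 = - h^2 a   (y ranging over the 2N neighbours),
   with u = 0 at lattice points outside Omega; the solution is the limit of the
   discrete solutions as h -> 0.  The scheme is monotone and homogeneous of degree
   one, so it is solvable by Knaster-Tarski below a quadratic supersolution, and
   e (r^2 - |x - x0|^2)_+^2 is a local subsolution which keeps u away from 0 inside
   Omega.  All estimates come from the maximum principle.  The scheme gives
   - A h^2 <= lap u <= C sum (u - u(y))_+^2, whence an interior Lipschitz bound by
   doubling the variables (Ishii-Lions) with the l^1 distance.  Reflecting in a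
   coordinate hyperplane bounds differences by |u| and |lap u| (Brandt); combined
   with the Marchaud identity 8 d_s^3 = d_(2s)^3 + O(d_s^4) for differences of step
   s, this yields Schauder estimates for second differences.  At the boundary,
   g - K g^2 + |x - x0|^2, with g the first coordinate of a chart, is a barrier. *)

From HB Require Import structures.
From Stdlib Require Import ClassicalEpsilon.
From Stdlib Require Import Reals Lra Lia ZArith List FunctionalExtensionality Classical.
From mathcomp Require Import ssreflect ssrfun ssrbool eqtype ssrnat seq fintype finfun bigop perm.
From mathcomp.classical Require filter.
Require Import Defs.
Open Scope R_scope.

(** * Finite sums and finite sets *)

(** The obstacle is the singular quadratic term [c u^{-1} |grad u|^2]: [u] vanishes on the boundary,
    so the coefficient [c / u] is not bounded up to it. Two features make the term harmless. Inside,
    the lower bound of [scheme_lower] gives [c / u <= C], and [C |grad u|^2] is beaten by the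
    concavity of a logarithmic modulus [lmod] with [lmod'' = - K lmod'^2], as soon as [K] exceeds a
    multiple of [C]. On the lattice every maximum is taken over a finite set and differences of all
    orders exist, so the maximum principle needs no regularity; the price is that all constants must
    be free of [h]. For this the interior estimates are stated in lattice units, on balls whose
    radius [rad] is a fixed length divided by [h], and they only ask that [rad] exceed a fixed
    number. *)

HB.instance Definition _ := Monoid.isComLaw.Build R 0 Rplus
  (fun x y z => Logic.eq_sym (Rplus_assoc x y z)) Rplus_comm Rplus_0_l.

Notation "\sum_ ( i < n ) F" := (\big[Rplus/0]_(i < n) F) : R_scope.

Section Sums.
Context {N : nat}.
Implicit Types F G : 'I_N -> R.

Lemma sum_ext F G : (forall i, F i = G i) -> \sum_(i < N) F i = \sum_(i < N) G i.
Proof. by move=> H; apply: eq_bigr => i _; apply: H. Qed.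

Lemma sum_le F G : (forall i, F i <= G i) -> \sum_(i < N) F i <= \sum_(i < N) G i.
Proof.
move=> H; apply: (big_ind2 (fun x y => x <= y)) => [|x1 x2 y1 y2 h1 h2|i _]; [lra|lra|exact: H].
Qed.

Lemma sum_add F G : \sum_(i < N) (F i + G i) = \sum_(i < N) F i + \sum_(i < N) G i.
Proof. exact: big_split. Qed.

Lemma sum_scal k F : \sum_(i < N) (k * F i) = k * \sum_(i < N) F i.
Proof.
apply: (big_ind2 (fun x y => x = k * y)) => [|x1 x2 y1 y2 -> ->|i _]; [ring|ring|by []].
Qed.

Lemma sum_sub F G : \sum_(i < N) (F i - G i) = \sum_(i < N) F i - \sum_(i < N) G i.
Proof.
rewrite (sum_ext (fun i => F i - G i) (fun i => F i + (-1) * G i)); last by move=> i; ring.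
by rewrite sum_add sum_scal; ring.
Qed.

Lemma sum_const k : \sum_(i < N) k = INR N * k.
Proof.
rewrite big_const_ord; elim: N => [|n IH]; first by rewrite /=; ring.
by rewrite iterS IH S_INR; ring.
Qed.

Lemma sum_ge0 F : (forall i, 0 <= F i) -> 0 <= \sum_(i < N) F i.
Proof. by move=> H; move: (sum_le (fun=> 0) F H); rewrite sum_const; lra. Qed.

Lemma sum_abs F : Rabs (\sum_(i < N) F i) <= \sum_(i < N) Rabs (F i).
Proof.
apply: (big_ind2 (fun x y => Rabs x <= y)) => [|x1 x2 y1 y2 h1 h2|i _].
- by rewrite Rabs_R0; lra.
- by apply: Rle_trans (Rabs_triang _ _) _; lra.
- lra.
Qed.

Lemma sum_le_const F k : (forall i, F i <= k) -> \sum_(i < N) F i <= INR N * k.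
Proof. by move=> H; rewrite -sum_const; apply: sum_le. Qed.

Lemma sum_term F i : (forall j, 0 <= F j) -> F i <= \sum_(j < N) F j.
Proof.
move=> H; rewrite (bigD1 i) //=; set s := (X in _ <= _ + X).
suff : 0 <= s by lra.
by apply: (big_ind (fun x => 0 <= x)) => [|x y ? ?|j _]; [lra|apply: Rplus_le_le_0_compat|exact: H].
Qed.

Lemma sum_diff1 F G i : (forall j, j != i -> F j = G j) ->
  \sum_(j < N) F j - \sum_(j < N) G j = F i - G i.
Proof.
move=> H; rewrite (bigD1 i) //= (bigD1 i (F := G)) //=.
rewrite (eq_bigr G) //; ring.
Qed.

Lemma sum_abs_le_const F k : (forall i, Rabs (F i) <= k) -> Rabs (\sum_(i < N) F i) <= INR N * k.
Proof. by move=> H; apply: Rle_trans (sum_abs _) _; apply: sum_le_const. Qed.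

End Sums.

Definition pos (t : R) : R := Rmax t 0.

Lemma pos_ge0 t : 0 <= pos t. Proof. exact: Rmax_r. Qed.
Lemma pos_ge t : t <= pos t. Proof. exact: Rmax_l. Qed.
Lemma pos_id t : 0 <= t -> pos t = t. Proof. exact: Rmax_left. Qed.
Lemma pos_0 t : t <= 0 -> pos t = 0. Proof. exact: Rmax_right. Qed.
Lemma pos_le s t : s <= t -> pos s <= pos t.
Proof. by move=> H; apply: Rmax_lub; [exact: Rle_trans (pos_ge t)|exact: pos_ge0]. Qed.
Lemma pos_lip s t : Rabs (pos s - pos t) <= Rabs (s - t).
Proof.
rewrite /pos /Rmax /Rabs; repeat (case: Rle_dec => ?); repeat (case: Rcase_abs => ?); lra.
Qed.
Lemma pos_abs t : pos t <= Rabs t.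
Proof. by rewrite /pos; apply: Rmax_lub; [exact: Rle_abs|exact: Rabs_pos]. Qed.
Lemma pos_sq_lip s t P : Rabs s <= P -> Rabs t <= P ->
  Rabs (pos s * pos s - pos t * pos t) <= 2 * P * Rabs (s - t).
Proof.
move=> Hs Ht.
have -> : pos s * pos s - pos t * pos t = (pos s + pos t) * (pos s - pos t) by ring.
rewrite Rabs_mult; apply: Rmult_le_compat; [exact: Rabs_pos|exact: Rabs_pos| |exact: pos_lip].
rewrite Rabs_pos_eq; first by move: (pos_abs s) (pos_abs t); lra.
by move: (pos_ge0 s) (pos_ge0 t); lra.
Qed.
Lemma pos_sq_le s P : s <= P -> 0 <= P -> pos s * pos s <= P * P.
Proof.
move=> h1 h2; have h : pos s <= P by rewrite -(pos_id _ h2); apply: pos_le.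
by move: (pos_ge0 s) => ?; nra.
Qed.

(** Inclusion in a list is enough: finiteness then passes to subsets with no decidability, and
    [argmax] sorts out membership classically. *)
Definition fin {A : Type} (P : A -> Prop) := exists l : list A, forall x, P x -> In x l.

Lemma fin_sub {A} (P Q : A -> Prop) : (forall x, P x -> Q x) -> fin Q -> fin P.
Proof. by move=> H [l Hl]; exists l => x /H; apply: Hl. Qed.

Lemma fin_prod {A B} (P : A -> Prop) (Q : B -> Prop) :
  fin P -> fin Q -> fin (fun p : A * B => P p.1 /\ Q p.2).
Proof.
move=> [l Hl] [m Hm]; exists (list_prod l m) => -[x y] /= [/Hl Hx /Hm Hy].
exact: in_prod.
Qed.

Lemma argmax {A} (P : A -> Prop) (f : A -> R) : fin P -> (exists x, P x) ->
  exists x, P x /\ forall y, P y -> f y <= f x.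
Proof.
move=> [l Hl] [x0 Px0].
suff H : forall m : list A, (forall y, In y m -> P y -> f y <= f x0) \/
    exists x, P x /\ forall y, In y m -> P y -> f y <= f x.
  case: (H l) => [h|[x [Px h]]]; first by exists x0; split=> // y Py; apply: h => //; apply: Hl.
  by exists x; split=> // y Py; apply: h => //; apply: Hl.
elim=> [|a m IH]; first by left.
have [x [Px Hx]] : exists x, P x /\ forall y, In y m -> P y -> f y <= f x.
  by case: IH => // h; exists x0.
right; case: (classic (P a)) => Pa; last first.
  by exists x; split=> // y [<-|]; [|apply: Hx].
case: (Rle_dec (f a) (f x)) => h; first by exists x; split=> // y [<-|]; [|apply: Hx].
by exists a; split=> // y [<-|hy] Py; [lra|move: (Hx y hy Py); lra].
Qed.

Lemma fin_finType (T : finType) : fin (fun _ : T => True).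
Proof.
exists (enum T) => x _.
have : x \in enum T by rewrite mem_enum.
elim: (enum T) => //= a l IH; rewrite inE => /orP[/eqP ->|/IH]; by [left|right].
Qed.

Lemma fin_image {A B} (f : A -> B) (P : A -> Prop) (Q : B -> Prop) :
  (forall y, Q y -> exists x, P x /\ f x = y) -> fin P -> fin Q.
Proof.
move=> H [l Hl]; exists (List.map f l) => y /H [x [/Hl Px <-]].
exact: in_map.
Qed.

Lemma fin_Zrange (m : Z) : fin (fun x : Z => (Z.abs x <= m)%Z).
Proof.
set M := Z.to_nat m.
exists (List.map (fun k : nat => (Z.of_nat k - Z.of_nat M)%Z) (List.seq 0 (S (Nat.add M M)))).
move=> x Hx; apply/in_map_iff; exists (Z.to_nat (x + Z.of_nat M)).
split; first lia.
rewrite /M; apply/in_seq; lia.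
Qed.

Ltac positivity :=
  first [ lra
  | lazymatch goal with
    | |- 0 < _ * _ => apply: Rmult_lt_0_compat; positivity
    | |- 0 < _ / _ => apply: Rdiv_lt_0_compat; positivity
    | |- 0 < / _ => apply: Rinv_0_lt_compat; positivity
    | |- 0 < Rpower _ _ => exact: exp_pos
    | |- 0 <= Rabs _ => exact: Rabs_pos
    | |- 0 <= INR _ => exact: pos_INR
    | |- 0 <= _ * _ => first [exact: Rle_0_sqr | apply: Rmult_le_pos; positivity]
    | |- 0 <= _ / _ => apply: Rmult_le_pos; positivity
    | |- 0 <= / _ => apply: Rlt_le; positivity
    | |- 0 <= Rpower _ _ => apply: Rlt_le; positivity
    end ].

(** * Functions on the integer lattice *)

Definition lat (N : nat) := 'I_N -> Z.

Definition sh {N} (i : 'I_N) (s : Z) (x : lat N) : lat N :=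
  fun j => if j == i then (x j + s)%Z else x j.

Definition n1 {N} (z x : lat N) : R := \sum_(i < N) Rabs (IZR (x i - z i)).

Definition lap {N} (w : lat N -> R) (x : lat N) : R :=
  \sum_(i < N) (w (sh i 1 x) + w (sh i (-1) x) - 2 * w x).

Definition upg {N} (w : lat N -> R) (x : lat N) : R :=
  \sum_(i < N) (pos (w x - w (sh i 1 x)) * pos (w x - w (sh i 1 x)) +
                pos (w x - w (sh i (-1) x)) * pos (w x - w (sh i (-1) x))).

Definition df {N} (i : 'I_N) (s : Z) (w : lat N -> R) : lat N -> R :=
  fun x => w (sh i s x) - w x.

Section Lattice.
Context {N : nat}.
Implicit Types (x y z : lat N) (w : lat N -> R) (i j : 'I_N).

Lemma sh_i i s x : sh i s x i = (x i + s)%Z.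
Proof. by rewrite /sh eqxx. Qed.
Lemma sh_j i s x j : j != i -> sh i s x j = x j.
Proof. by rewrite /sh => /negbTE ->. Qed.
Lemma sh_0 i x : sh i 0 x = x.
Proof. by apply: functional_extensionality => j; rewrite /sh; case: (j == i) => //; lia. Qed.
Lemma sh_add i s t x : sh i s (sh i t x) = sh i (s + t) x.
Proof. by apply: functional_extensionality => j; rewrite /sh; case: (j == i) => //; lia. Qed.
Lemma sh_comm i j s t x : sh i s (sh j t x) = sh j t (sh i s x).
Proof. by apply: functional_extensionality => k; rewrite /sh; case: (k == i); case: (k == j) => //; lia. Qed.

(** One coordinate moves, so one term of a separable sum changes. The [l^1] distance, the quadratic
    penalty and the quadratic barriers are all such sums, and their differences are computed through
    this. *)
Lemma sep_sh (g : 'I_N -> Z -> R) i s x :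
  \sum_(j < N) g j (sh i s x j) = \sum_(j < N) g j (x j) + (g i (x i + s)%Z - g i (x i)).
Proof.
have := sum_diff1 (fun j => g j (sh i s x j)) (fun j => g j (x j)) i.
rewrite sh_i => H; rewrite -H; first ring.
by move=> j /(sh_j _ s x) ->.
Qed.

Lemma n1_sh z x i s :
  n1 z (sh i s x) = n1 z x + (Rabs (IZR (x i + s - z i)) - Rabs (IZR (x i - z i))).
Proof. exact: (sep_sh (fun j t => Rabs (IZR (t - z j)))). Qed.

Lemma n1_shl z x i s :
  n1 (sh i s z) x = n1 z x + (Rabs (IZR (x i - (z i + s))) - Rabs (IZR (x i - z i))).
Proof. exact: (sep_sh (fun j t => Rabs (IZR (x j - t)))). Qed.

Lemma n1_sh_le z x i s : Rabs (n1 z (sh i s x) - n1 z x) <= Rabs (IZR s).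
Proof.
rewrite n1_sh !minus_IZR plus_IZR.
by split_Rabs; lra.
Qed.

Lemma n1_ge0 z x : 0 <= n1 z x.
Proof. by apply: sum_ge0 => i; apply: Rabs_pos. Qed.
Lemma n1_xx x : n1 x x = 0.
Proof.
rewrite /n1 (sum_ext _ (fun=> 0)) ?sum_const; first ring.
by move=> i; rewrite Z.sub_diag Rabs_R0.
Qed.
Lemma n1_sym x y : n1 x y = n1 y x.
Proof. by apply: sum_ext => i; rewrite !minus_IZR Rabs_minus_sym. Qed.
Lemma n1_tri z y x : n1 z x <= n1 z y + n1 y x.
Proof.
rewrite -sum_add; apply: sum_le => i.
by rewrite !minus_IZR; split_Rabs; lra.
Qed.
Lemma coord_n1 z x i : Rabs (IZR (x i - z i)) <= n1 z x.
Proof. by apply: (sum_term (fun i => Rabs (IZR (x i - z i)))) => j; apply: Rabs_pos. Qed.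
Lemma n1_box z x d : (forall i, Rabs (IZR (x i - z i)) <= d) -> n1 z x <= INR N * d.
Proof. by move=> H; apply: sum_le_const. Qed.

Lemma fin_box (z : lat N) (m : Z) : fin (fun x : lat N => forall i, (Z.abs (x i - z i) <= m)%Z).
Proof.
set M := Z.to_nat m.
pose K := (S (Nat.add M M)).
apply: (fin_image (fun (f : {ffun 'I_N -> 'I_K}) => (fun i => (z i - Z.of_nat M + Z.of_nat (f i))%Z) : lat N));
  last exact: fin_finType.
move=> x Hx.
have B i : (Z.to_nat (x i - z i + Z.of_nat M) < K)%nat.
  by apply/ltP; rewrite /K /M; move: (Hx i); lia.
exists [ffun i => Ordinal (B i)]; split=> //.
apply: functional_extensionality => i; rewrite ffunE /= /M; move: (Hx i); lia.
Qed.

Lemma fin_n1 (z : lat N) (r : R) : fin (fun x => n1 z x <= r).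
Proof.
apply: fin_sub (fin_box z (up r)) => x Hx i; apply: le_IZR.
rewrite abs_IZR; move: (coord_n1 z x i) (archimed r); lra.
Qed.

Lemma lap_sub w v x : lap (fun y => w y - v y) x = lap w x - lap v x.
Proof. by rewrite /lap -sum_sub; apply: sum_ext => i; ring. Qed.
Lemma lap_scal k w x : lap (fun y => k * w y) x = k * lap w x.
Proof. by rewrite /lap -sum_scal; apply: sum_ext => i; ring. Qed.
Lemma lap_opp w x : lap (fun y => - w y) x = - lap w x.
Proof.
have -> : - lap w x = (-1) * lap w x by ring.
by rewrite -lap_scal; apply: sum_ext => i; ring.
Qed.
Lemma lap_sh w i s x : lap (fun y => w (sh i s y)) x = lap w (sh i s x).
Proof. by apply: sum_ext => j; rewrite !(sh_comm i j). Qed.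
Lemma lap_df w i s x : lap (df i s w) x = df i s (lap w) x.
Proof. by rewrite /df -(lap_sh w) -lap_sub. Qed.

Lemma lap_sep (g : 'I_N -> Z -> R) x : lap (fun y => \sum_(j < N) g j (y j)) x =
  \sum_(j < N) (g j (x j + 1)%Z + g j (x j + -1)%Z - 2 * g j (x j)).
Proof. by apply: sum_ext => i; rewrite !sep_sh; ring. Qed.

Lemma lap_max_le0 w x : (forall i, w (sh i 1 x) <= w x /\ w (sh i (-1) x) <= w x) -> lap w x <= 0.
Proof.
move=> H; have := sum_le_const (fun i => w (sh i 1 x) + w (sh i (-1) x) - 2 * w x) 0.
rewrite /lap; move=> h; have : forall i, w (sh i 1 x) + w (sh i (-1) x) - 2 * w x <= 0.
  by move=> i; move: (H i); lra.
by move/h; lra.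
Qed.

Lemma df_comm i j s t w x : df i s (df j t w) x = df j t (df i s w) x.
Proof. by rewrite /df (sh_comm i j); ring. Qed.

End Lattice.

(** * Interior gradient bound by reflection *)

Section Reflection.
Context {N : nat} (z : lat N) (i : 'I_N).

(** The mirror sits at the half-integer [z i + 1/2]: it contains no lattice point and exchanges [z]
    with its neighbour [sh i 1 z], so [w x - w (rfl x)] at that neighbour is exactly the difference
    to be estimated. *)
Definition rfl (x : lat N) : lat N := fun j => if j == i then (2 * z i + 1 - x j)%Z else x j.

Lemma rfl_sh_i s x : rfl (sh i s x) = sh i (- s) (rfl x).
Proof.
by apply: functional_extensionality => j; rewrite /rfl /sh; case: (j == i) => //; lia.
Qed.

Lemma rfl_sh_j j s x : j != i -> rfl (sh j s x) = sh j s (rfl x).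
Proof.
move=> ji; apply: functional_extensionality => k; rewrite /rfl /sh.
by case: (altP (k =P i)) => [->|//]; rewrite eq_sym (negbTE ji).
Qed.

Lemma lap_rfl w x : lap (fun y => w (rfl y)) x = lap w (rfl x).
Proof.
apply: sum_ext => j; case: (altP (j =P i)) => [->|ji].
  rewrite !rfl_sh_i /=; ring.
by rewrite !rfl_sh_j.
Qed.
End Reflection.

Lemma sum_delta {N} (i : 'I_N) (k : R) : \sum_(j < N) (if j == i then k else 0) = k.
Proof.
have := sum_diff1 (fun j => if j == i then k else 0) (fun=> 0) i.
rewrite sum_const eqxx => H; rewrite -[X in X = _]Rminus_0_r -[X in _ - X](Rmult_0_r (INR N)) H; first ring.
by move=> j /negbTE ->.
Qed.

Section GradEst.
Context {N : nat} (w : lat N -> R) (z : lat N) (i : 'I_N) (d : Z) (M F : R).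
Hypothesis (Hd : (1 <= d)%Z) (HM : 0 < M) (HF : 0 <= F).
Hypothesis Hw : forall x, (forall j, (Z.abs (x j - z j) <= d)%Z) -> Rabs (w x) <= M.
Hypothesis Hl : forall x, (forall j, (Z.abs (x j - z j) <= d)%Z) -> Rabs (lap w x) <= F.

(** [g] is quadratic across the direction [i] and concave along it, in the variable
    [tau = t - z i - 1/2]. The linear part makes [psi >= 2 M] on the far face, the quadratic part on
    the side faces. In [A], [F] pays for the Laplacian of [phi], [2 N M / D^2] for the side
    quadratics, and one more [M / D^2] makes the inequality strict. The [+ 1] compensates the
    concavity across the mirror: the values of [g i] at [tau = 1/2] and [tau = - 1/2] add up to
    [3 A / 2]. *)
Let D := IZR d.
Let A := F + (2 * INR N + 1) * (M / (D * D)).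
Let g (j : 'I_N) (t : Z) : R :=
  if j == i then 4 * M / D * (IZR (t - z i) - /2) +
                 A * ((IZR (t - z i) - /2) * (D - (IZR (t - z i) - /2)) + 1)
  else 2 * (M / (D * D)) * (IZR (t - z j) * IZR (t - z j)).
Let psi (x : lat N) := \sum_(j < N) g j (x j).
Let phi (x : lat N) := w x - w (rfl z i x).

(* The odd part [phi] of [w] under the reflection in [x_i = z_i + 1/2] is compared
   with the barrier [psi]. *)
Lemma grad_one_sided : w (sh i 1 z) - w z <= (4 + 3 * INR N) * (M / D + F * D).
Proof.
have HD : 1 <= D by apply: IZR_le.
have HN : 0 <= INR N by apply: pos_INR.
have HMD : 0 < M / (D * D) by positivity.
have HMD1 : 0 < M / D by positivity.
have EMD : M / D = M / (D * D) * D by field; lra.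
have HA : 0 < A by rewrite /A; nra.
pose P x := (forall j, (Z.abs (x j - z j) <= d)%Z) /\ (z i + 1 <= x i)%Z.
have z1P : P (sh i 1 z).
  split; last by rewrite sh_i; lia.
  by move=> j; rewrite /sh; case: ifP => _; lia.
have finP : fin P by apply: fin_sub (fin_box z d) => x [].
have rflP x : P x -> forall j, (Z.abs (rfl z i x j - z j) <= d)%Z.
  move=> [h1 h2] j; rewrite /rfl; case: eqP => [->|_]; last exact: h1.
  by move: (h1 i); lia.
have tau x : P x -> /2 <= IZR (x i - z i) - /2 <= D - /2.
  move=> [h1 h2].
  have h3 : 1 <= IZR (x i - z i) by apply: IZR_le; lia.
  have h4 : IZR (x i - z i) <= D by apply: IZR_le; move: (h1 i); lia.
  lra.
have g0 x : P x -> forall j, 0 <= g j (x j).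
  move=> Px j; rewrite /g; case: eqP => [->|_]; last by nra.
  move: (tau x Px); set t := _ - /2 => ht.
  have h1 : 0 <= 4 * M / D * t by positivity.
  have h2 : 0 <= t * (D - t) by positivity.
  by nra.
have [x [Px Hx]] := argmax P (fun x => phi x - psi x) finP (ex_intro _ _ z1P).
have key : phi x - psi x <= 0.
  apply: Rnot_lt_le => pos0.
  have phiM : phi x <= 2 * M.
    have h1 := Hw x Px.1; have h2 := Hw _ (rflP x Px).
    by rewrite /phi; move: h1 h2; split_Rabs; lra.
  have psi2 j : g j (x j) <= psi x by apply: (sum_term (fun j => g j (x j))); apply: g0.
  (* The maximum is not on a face: there [psi >= 2 M >= phi]. *)
  have int_j j : j != i -> (Z.abs (x j - z j) < d)%Z.
    move=> ji; case: (Z_lt_le_dec (Z.abs (x j - z j)) d) => // h.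
    have E : Z.abs (x j - z j) = d by move: (Px.1 j); lia.
    have : g j (x j) = 2 * M.
      rewrite /g (negbTE ji).
      have -> : IZR (x j - z j) * IZR (x j - z j) = D * D.
        by rewrite -!mult_IZR -Z.abs_square E mult_IZR.
      by field; lra.
    by move: (psi2 j); lra.
  have int_i : (x i - z i < d)%Z.
    case: (Z_lt_le_dec (x i - z i) d) => // h.
    have E : (x i - z i = d)%Z by move: (Px.1 i); lia.
    have : 2 * M <= g i (x i).
      rewrite /g eqxx E -/D.
      have h1 : 2 * M <= 4 * M / D * (D - /2).
        have -> : 4 * M / D * (D - /2) = 4 * M - 2 * (M / D) by field; lra.
        have : M / D <= M by rewrite -[X in _ <= X]Rmult_1_r; apply: Rmult_le_compat_l; [lra|rewrite -[X in _ <= X]Rinv_1; apply: Rinv_le_contravar; lra].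
        lra.
      have h2 : 0 <= (D - /2) * (D - (D - /2)) by nra.
      by nra.
    by move: (psi2 i); lra.
  have nb j s : (Z.abs s = 1)%Z -> phi (sh j s x) - psi (sh j s x) <= phi x - psi x.
    move=> hs; case: (altP (j =P i)) => [->|ji]; last first.
      apply: Hx; split; last by rewrite sh_j ?(eq_sym i) //; exact: Px.2.
      move=> k; rewrite /sh; case: eqP => [->|_]; last exact: Px.1.
      by move: (int_j j ji); lia.
    case: (Z_lt_le_dec (z i) (x i + s)) => h.
      apply: Hx; split; last by rewrite sh_i; lia.
      move=> k; rewrite /sh; case: eqP => [->|_]; last exact: Px.1.
      by move: (Px.1 i) Px.2; lia.
    (* Only a step across the mirror leaves the half box. It lands on the reflection of [x], where
       [phi] equals [- phi x]; the comparison then follows from [phi x > psi x] and from the sign of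
       the two values of [g i] next to the mirror. *)
    have sE : s = (-1)%Z by move: Px.2; lia.
    have xE : x i = (z i + 1)%Z by move: Px.2; lia.
    have r1 : rfl z i x = sh i s x.
      by apply: functional_extensionality => k; rewrite /rfl /sh; case: eqP => // ->; lia.
    have r2 : rfl z i (sh i s x) = x.
      by apply: functional_extensionality => k; rewrite /rfl /sh; case: eqP => // ->; lia.
    have -> : psi (sh i s x) = psi x + (g i (x i + s)%Z - g i (x i)) by exact: sep_sh.
    rewrite {1}/phi r2.
    have -> : w (sh i s x) - w x = - phi x by rewrite /phi r1; ring.
    have : 0 <= g i (x i) + g i (x i + s)%Z.
      rewrite /g eqxx xE sE.
      have -> : (z i + 1 - z i = 1)%Z by lia.
      have -> : (z i + 1 + -1 - z i = 0)%Z by lia.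
      have -> : 4 * M / D * (1 - / 2) + A * ((1 - / 2) * (D - (1 - / 2)) + 1) +
         (4 * M / D * (0 - / 2) + A * ((0 - / 2) * (D - (0 - / 2)) + 1)) = 3 / 2 * A by field; lra.
      lra.
    by move: (psi2 i); lra.
  have L0 : lap (fun y => phi y - psi y) x <= 0.
    by apply: lap_max_le0 => j; split; apply: nb.
  have Lphi : - 2 * F <= lap phi x.
    rewrite /phi lap_sub lap_rfl.
    have h1 := Hl x Px.1; have h2 := Hl _ (rflP x Px).
    by move: h1 h2; split_Rabs; lra.
  have Lpsi : lap psi x <= INR N * (4 * (M / (D * D))) - 2 * A.
    rewrite /psi lap_sep.
    have <- : \sum_(j < N) (4 * (M / (D * D)) + (if j == i then - 2 * A else 0)) =
        INR N * (4 * (M / (D * D))) - 2 * A.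
      by rewrite sum_add sum_const sum_delta; ring.
    apply: sum_le => j; rewrite /g; case: eqP => [->|_].
      rewrite !minus_IZR !plus_IZR; set t := IZR (x i); set t' := IZR (z i).
      by apply: (Rle_trans _ (- 2 * A)); [apply: Req_le; field; lra|lra].
    rewrite !minus_IZR !plus_IZR; by apply: Req_le; ring.
  by move: L0; rewrite lap_sub /A in Lpsi *; nra.
have := Hx _ z1P => {Hx} Hx.
have : phi (sh i 1 z) <= psi (sh i 1 z) by lra.
have -> : phi (sh i 1 z) = w (sh i 1 z) - w z.
  congr (_ - w _); apply: functional_extensionality => k.
  by rewrite /rfl /sh; case: eqP => // ->; lia.
have psiz : psi z = g i (z i).
  rewrite /psi -[RHS](sum_delta i); apply: sum_ext => j; case: eqP => [->//|ji].
  by rewrite /g; case: eqP => // _; rewrite Z.sub_diag; ring.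
have -> : psi (sh i 1 z) = psi z + (g i (z i + 1)%Z - g i (z i)) by exact: sep_sh.
rewrite psiz => h; apply: Rle_trans h _.
have -> : g i (z i) + (g i (z i + 1)%Z - g i (z i)) = g i (z i + 1)%Z by ring.
rewrite /g eqxx.
have -> : (z i + 1 - z i = 1)%Z by lia.
have -> : 4 * M / D * (1 - /2) = 2 * (M / D) by field; lra.
have -> : (4 + 3 * INR N) * (M / D + F * D) = (4 + 3 * INR N) * (M / D) + (4 + 3 * INR N) * (F * D) by ring.
have h3 : A * (5 / 4 * D) = 5 / 4 * (F * D) + 5 / 4 * (2 * INR N + 1) * (M / D).
  by rewrite /A EMD; field; lra.
have FD : 0 <= F * D by nra.
have : 0 <= INR N * (F * D) by positivity.
have : 0 <= INR N * (M / D) by positivity.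
by nra.
Qed.
End GradEst.

(** The one-sided bound for [w] and for [- w]. Its barrier needs [M > 0], so [M] is enlarged by an
    amount that costs at most [e] in the conclusion. *)
Lemma grad_est {N} (w : lat N -> R) z i d M F : (1 <= d)%Z -> 0 <= M -> 0 <= F ->
  (forall x, (forall j, (Z.abs (x j - z j) <= d)%Z) -> Rabs (w x) <= M) ->
  (forall x, (forall j, (Z.abs (x j - z j) <= d)%Z) -> Rabs (lap w x) <= F) ->
  Rabs (w (sh i 1 z) - w z) <= (4 + 3 * INR N) * (M / IZR d + F * IZR d).
Proof.
move=> Hd HM HF Hw Hl.
have HD : 1 <= IZR d by apply: IZR_le.
have HN := pos_INR N.
apply: le_epsilon => e He.
pose M' := M + e / (4 + 3 * INR N).
have He' : 0 < e / (4 + 3 * INR N) by positivity.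
have bnd : (4 + 3 * INR N) * (M' / IZR d + F * IZR d) <= (4 + 3 * INR N) * (M / IZR d + F * IZR d) + e.
  have -> : (4 + 3 * INR N) * (M' / IZR d + F * IZR d) =
    (4 + 3 * INR N) * (M / IZR d + F * IZR d) + e / IZR d by rewrite /M'; field; lra.
  have : e / IZR d <= e / 1.
    by apply: Rmult_le_compat_l; [lra|apply: Rinv_le_contravar; lra].
  by rewrite Rdiv_1_r; lra.
apply: Rle_trans bnd.
have HM' : 0 < M' by rewrite /M'; lra.
apply: Rabs_le; split; last first.
  by apply: grad_one_sided => // x Hx; apply: Rle_trans (Hw x Hx) _; rewrite /M'; lra.
have := grad_one_sided (fun x => - w x) z i d M' F Hd HM' HF.
have -> : - w (sh i 1 z) - - w z = - (w (sh i 1 z) - w z) by ring.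
move=> h; suff : - (w (sh i 1 z) - w z) <= (4 + 3 * INR N) * (M' / IZR d + F * IZR d) by lra.
apply: h => x Hx; rewrite ?lap_opp Rabs_Ropp; last exact: Hl.
by apply: Rle_trans (Hw x Hx) _; rewrite /M'; lra.
Qed.

(** * Lipschitz bounds by doubling the variables *)

Lemma ln_le_sub1 y : 0 < y -> ln y <= y - 1.
Proof.
move=> Hy; have := exp_ineq1_le (ln y); rewrite exp_ln //; lra.
Qed.

Lemma ln_div a b : 0 < a -> 0 < b -> ln (a / b) = ln a - ln b.
Proof. by move=> ha hb; rewrite /Rdiv ln_mult ?ln_Rinv //; apply: Rinv_0_lt_compat. Qed.

Section Modulus.
Variables (K L : R).
Hypotheses (HK : 0 < K) (HL : 0 < L).

(* A concave modulus with [lmod'' = - K lmod'^2]. *)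
Definition lmod (r : R) : R := ln (1 + L * K * r) / K.
(** [ell] is the derivative of [lmod]. *)
Definition ell (r : R) : R := L / (1 + L * K * r).

Let lK : 0 < L * K. Proof. by apply: Rmult_lt_0_compat. Qed.

Lemma lmod_0 : lmod 0 = 0.
Proof. by rewrite /lmod Rmult_0_r Rplus_0_r ln_1 /Rdiv Rmult_0_l. Qed.

Lemma lmod_mono r s : 0 <= r -> r <= s -> lmod r <= lmod s.
Proof.
move=> h1 h2; apply: Rmult_le_compat_r; first by move: (Rinv_0_lt_compat _ HK); lra.
have h3 : L * K * r <= L * K * s by apply: Rmult_le_compat_l; lra.
have h4 : 0 <= L * K * r by positivity.
case: (Req_dec (L * K * r) (L * K * s)) => [->|ne]; first lra.
by apply: Rlt_le; apply: ln_increasing; lra.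
Qed.

Lemma ell_pos r : 0 <= r -> 0 < ell r.
Proof. by move=> h; apply: Rdiv_lt_0_compat => //; nra. Qed.

Lemma lmod_step r : 0 <= r -> lmod (r + 1) - lmod r <= ell r.
Proof.
move=> hr; have h0 : 0 <= L * K * r by positivity.
have -> : lmod (r + 1) - lmod r = (ln ((1 + L * K * (r + 1)) / (1 + L * K * r))) / K.
  by rewrite ln_div; [rewrite /lmod; field; lra|nra|lra].
have -> : ell r = (L * K / (1 + L * K * r)) / K by rewrite /ell; field; lra.
apply: Rmult_le_compat_r; first by move: (Rinv_0_lt_compat _ HK); lra.
apply: Rle_trans (ln_le_sub1 _ _) _; first by positivity.
by apply: Req_le; field; lra.
Qed.

(** The step is 2 because moving both points towards or away from each other changes their distance
    by 2. The two outer arguments of [ln] multiply to [c^2 - 4 L^2 K^2], and [ln y <= y - 1] does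
    the rest. *)
Lemma lmod_second r : 2 <= r -> lmod (r + 2) + lmod (r - 2) - 2 * lmod r <= - K * (ell r * ell r).
Proof.
move=> hr; have h0 : 0 <= L * K * r by positivity.
have h1 : 0 <= L * K * (r - 2) by positivity.
set c := 1 + L * K * r.
have hc : 0 < c by rewrite /c; lra.
have -> : lmod (r + 2) + lmod (r - 2) - 2 * lmod r =
   ln ((1 + L * K * (r + 2)) * (1 + L * K * (r - 2)) / (c * c)) / K.
  rewrite ln_div ?ln_mult //; try nra.
  by rewrite /lmod /c; field; lra.
have e1 : (1 + L * K * (r + 2)) * (1 + L * K * (r - 2)) / (c * c) - 1 = - 4 * (L * K) * (L * K) / (c * c).
  by rewrite /c; field; rewrite -/c; lra.
have hb : 0 < / (c * c) by positivity.
apply: (Rle_trans _ (- 4 * (L * K) * (L * K) / (c * c) / K)).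
  apply: Rmult_le_compat_r; first by move: (Rinv_0_lt_compat _ HK); lra.
  rewrite -e1; apply: ln_le_sub1; apply: Rmult_lt_0_compat => //; nra.
have -> : - 4 * (L * K) * (L * K) / (c * c) / K = - 4 * K * (ell r * ell r).
  by rewrite /ell -/c; field; lra.
have : 0 < ell r by apply: ell_pos; lra.
by move=> ?; nra.
Qed.

(** The second difference of [lmod] at 1 with step 2, for the odd extension [lmod (-1) = - lmod 1].
    It serves two points at distance 1, which would pass through each other when both move
    inwards. *)
Lemma lmod_third : lmod 3 - 3 * lmod 1 <= - K * (ell 1 * ell 1).
Proof.
set c := 1 + L * K * 1.
have hc : 0 < c by rewrite /c; lra.
have hc2 : 0 < c * c by nra.
have hc3 : 0 < c * c * c by nra.
have -> : lmod 3 - 3 * lmod 1 = ln ((1 + L * K * 3) / (c * c * c)) / K.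
  rewrite ln_div ?ln_mult //; try nra.
  by rewrite /lmod /c; field; lra.
have hb : 0 < / (c * c * c) by positivity.
have e1 : (1 + L * K * 3) / (c * c * c) - 1 <= - (L * K) * (L * K) / (c * c).
  have -> : (1 + L * K * 3) / (c * c * c) - 1 =
     - (3 * (L * K) * (L * K) + (L * K) * (L * K) * (L * K)) * / (c * c * c).
    by rewrite /c; field; rewrite -/c; lra.
  have -> : - (L * K) * (L * K) / (c * c) = - ((L * K) * (L * K) * c) * / (c * c * c).
    by field; lra.
  apply: Rmult_le_compat_r; first lra.
  by rewrite /c; nra.
apply: (Rle_trans _ (- (L * K) * (L * K) / (c * c) / K)).
  apply: Rmult_le_compat_r; first by move: (Rinv_0_lt_compat _ HK); lra.
  apply: Rle_trans e1; apply: ln_le_sub1; apply: Rmult_lt_0_compat => //; nra.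
by apply: Req_le; rewrite /ell -/c; field; lra.
Qed.

Lemma lmod_lin r : 0 <= r -> lmod r <= L * r.
Proof.
move=> hr; have h0 : 0 <= L * K * r by positivity.
have -> : L * r = (L * K * r) / K by field; lra.
apply: Rmult_le_compat_r; first by move: (Rinv_0_lt_compat _ HK); lra.
have := ln_le_sub1 (1 + L * K * r); lra.
Qed.
End Modulus.

Section Doubling.
Context {N : nat} (w : lat N -> R) (z : lat N) (A C M K L kap r1 r2 : R).
Hypotheses (HA : 0 <= A) (HC : 0 <= C) (HK : 0 < K) (HL : 0 < L) (Hkap : 0 <= kap).
Hypothesis Hw : forall x, n1 z x <= r1 + r2 + 1 -> 0 <= w x <= M.
Hypothesis Hl : forall x, n1 z x <= r1 + r2 + 1 -> - A <= lap w x <= C * upg w x.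

Definition quad (x : lat N) : R := \sum_(i < N) (IZR (x i - z i) * IZR (x i - z i)).

Hypothesis Hq : forall x, r1 - 2 <= n1 z x -> M <= kap * quad x.
Hypothesis Hp : forall r, 0 <= r -> r2 - 2 <= r -> M <= lmod K L r.
Hypothesis Hgain : forall r, 0 <= r -> r <= r2 ->
  2 * INR N * C * (ell K L r * ell K L r) + A + 2 * INR N * kap < K * (ell K L r * ell K L r).

Lemma quad_sh i s x : quad (sh i s x) = quad x + (2 * IZR s * IZR (x i - z i) + IZR s * IZR s).
Proof.
rewrite /quad (sep_sh (fun j t => IZR (t - z j) * IZR (t - z j))).
by rewrite !minus_IZR plus_IZR; ring.
Qed.

Lemma quad_ge0 x : 0 <= quad x.
Proof. by apply: sum_ge0 => i; apply: Rle_0_sqr. Qed.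

Let Psi (p : lat N * lat N) := w p.1 - w p.2 - lmod K L (n1 p.2 p.1) - kap * quad p.1.

(** At a positive maximum of [Psi] the neighbours of [X] are paired with those of [Y]. Parallel
    pairs keep the distance and cost [2 kap] per direction; a crossed pair gains [K ell^2]. Hence
    [lap w X - lap w Y <= 2 N kap - K ell^2]. The penalty depends on the first point only, so moving
    [Y] alone bounds the descent of [w] at [Y] by [ell]; the upper bound on [lap w] is used only at
    [Y] and costs [2 N C ell^2]. [Hgain] excludes this. [Hq] and [Hp] keep the maximum 2 away from
    the limits [r1] and [r2], so that all these moves are admissible. *)
Lemma doubling x y : n1 z x <= r1 -> n1 y x <= r2 -> w x - w y <= lmod K L (n1 y x) + kap * quad x.
Proof.
move=> Hx0 Hy0.
pose P (p : lat N * lat N) := n1 z p.1 <= r1 /\ n1 p.2 p.1 <= r2.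
have finP : fin P.
  apply: fin_sub (fin_prod _ _ (fin_n1 z r1) (fin_n1 z (r1 + r2))) => -[a b] [/= h1 h2]; split=> //.
  by have := n1_tri z a b; rewrite (n1_sym a b); lra.
have [[X Y] [[/= PX PY] Hmax]] := argmax P Psi finP (ex_intro _ (x, y) (conj Hx0 Hy0)).
suff : Psi (X, Y) <= 0.
  by move: (Hmax (x, y) (conj Hx0 Hy0)); rewrite /Psi /=; lra.
apply: Rnot_lt_le => pos0.
set r := n1 Y X in PY pos0.
have r0 : 0 <= r by apply: n1_ge0.
have wX : 0 <= w X <= M by apply: Hw; lra.
have wY : 0 <= w Y <= M.
  by apply: Hw; have := n1_tri z X Y; rewrite (n1_sym X Y) -/r; lra.
have phi0 : 0 <= lmod K L r by rewrite -(lmod_0 K L); apply: lmod_mono => //; lra.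
have F1 : n1 z X < r1 - 2.
  apply: Rnot_le_lt => h; move: (Hq X h) pos0; rewrite /Psi /= -/r; lra.
have F2 : r < r2 - 2.
  apply: Rnot_le_lt => h; move: (Hp r r0 h) pos0 (quad_ge0 X); rewrite /Psi /= -/r => *.
  by have := Rmult_le_pos _ _ Hkap (quad_ge0 X); lra.
have NB X' Y' : n1 z X' <= n1 z X + 1 -> n1 Y' X' <= r + 2 -> Psi (X', Y') <= Psi (X, Y).
  by move=> h1 h2; apply: Hmax; split=> /=; lra.
have n1Xs i s : (Z.abs s = 1)%Z -> n1 z (sh i s X) <= n1 z X + 1.
  move=> hs; have := n1_sh_le z X i s.
  by rewrite -abs_IZR hs; split_Rabs; lra.
have unit_case (s : Z) : (Z.abs s = 1)%Z -> IZR s * IZR s = 1.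
  by move=> hs; rewrite -mult_IZR -Z.abs_square hs.
have pair (i j : 'I_N) (s t : Z) rr : (Z.abs s = 1)%Z -> n1 (sh j t Y) (sh i s X) = rr -> rr <= r + 2 ->
   w (sh i s X) - w X - (w (sh j t Y) - w Y) <=
   lmod K L rr - lmod K L r + kap * (2 * IZR s * IZR (X i - z i) + 1).
  move=> hs e h; have := NB (sh i s X) (sh j t Y) (n1Xs i s hs).
  rewrite e => /(_ h); rewrite /Psi /= e -/r quad_sh (unit_case s hs); lra.
pose Pk (i : 'I_N) := w (sh i 1 X) + w (sh i (-1) X) - 2 * w X.
pose Qk (i : 'I_N) := w (sh i 1 Y) + w (sh i (-1) Y) - 2 * w Y.
have both (i j : 'I_N) a b ra rb : (Z.abs a = 1)%Z -> (Z.abs b = 1)%Z ->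
   n1 (sh j b Y) (sh i (- a) X) = ra -> n1 (sh j (- b) Y) (sh i a X) = rb ->
   ra <= r + 2 -> rb <= r + 2 ->
   Pk i - Qk j <= lmod K L ra + lmod K L rb - 2 * lmod K L r + 2 * kap.
  move=> ha hb e1 e2 h1 h2.
  have ha' : (Z.abs (- a) = 1)%Z by lia.
  have I1 := pair i j _ _ _ ha' e1 h1; have I2 := pair i j _ _ _ ha e2 h2.
  have EP : Pk i = w (sh i a X) + w (sh i (- a) X) - 2 * w X.
    have [->|->] : a = 1%Z \/ a = (-1)%Z by lia.
      by [].
    by rewrite /Pk /=; ring.
  have EQ : Qk j = w (sh j b Y) + w (sh j (- b) Y) - 2 * w Y.
    have [->|->] : b = 1%Z \/ b = (-1)%Z by lia.
      by [].
    by rewrite /Qk /=; ring.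
  rewrite EP EQ; move: I1 I2; rewrite opp_IZR; lra.
have sync i : Pk i - Qk i <= 2 * kap.
  have e s : n1 (sh i s Y) (sh i s X) = r.
    rewrite n1_shl n1_sh sh_i -/r.
    have -> : (X i + s - (Y i + s) = X i - Y i)%Z by lia.
    ring.
  have := pair i i 1%Z 1%Z r erefl (e _); have := pair i i (-1)%Z (-1)%Z r erefl (e _).
  rewrite /Pk /Qk => h1 h2; have {}h1 := h1 ltac:(lra); have {}h2 := h2 ltac:(lra); lra.
set G := K * (ell K L r * ell K L r).
have G0 : 0 <= G by apply: Rmult_le_pos; [lra|apply: Rle_0_sqr].
have second a : 2 <= r -> a = lmod K L (r - 2) + lmod K L (r + 2) - 2 * lmod K L r -> a <= - G.
  by move=> h ->; have := lmod_second K L HK HL r h; rewrite /G; lra.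
(* If [a e_i] and [b e_j] are two different units of [x - y], the moves
   [(x - a e_i, y + b e_j)] and [(x + a e_i, y - b e_j)] change the l^1 distance
   by -2 and +2.  When the distance is 1 there is only one unit, but then [x] and
   [y] are neighbours and occur in each other's stencils. *)
have cross i j : i != j \/ (2 <= Z.abs (X i - Y i))%Z -> X i <> Y i -> X j <> Y j ->
  Pk i - Qk j <= 2 * kap - G.
  move=> hij hi hj.
  set a := Z.sgn (X i - Y i); set b := Z.sgn (X j - Y j).
  have ha : (Z.abs a = 1)%Z by rewrite /a; lia.
  have hb : (Z.abs b = 1)%Z by rewrite /b; lia.
  have e1 : n1 (sh j b Y) (sh i (- a) X) = r - 2.
    rewrite n1_shl n1_sh -/r -!abs_IZR.
    case: (altP (i =P j)) => [E|ij].
      case: hij => [/eqP //|h2]; rewrite /b -E -/a sh_i.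
      have -> : Z.abs (X i + - a - (Y i + a)) = (Z.abs (X i + - a - Y i) - 1)%Z by rewrite /a; lia.
      have -> : Z.abs (X i + - a - Y i) = (Z.abs (X i - Y i) - 1)%Z by rewrite /a; lia.
      by rewrite !minus_IZR; ring.
    rewrite sh_j 1?eq_sym //.
    have -> : Z.abs (X i + - a - Y i) = (Z.abs (X i - Y i) - 1)%Z by rewrite /a; lia.
    have -> : Z.abs (X j - (Y j + b)) = (Z.abs (X j - Y j) - 1)%Z by rewrite /b; lia.
    by rewrite !minus_IZR; ring.
  have e2 : n1 (sh j (- b) Y) (sh i a X) = r + 2.
    rewrite n1_shl n1_sh -/r -!abs_IZR.
    case: (altP (i =P j)) => [E|ij].
      case: hij => [/eqP //|h2]; rewrite /b -E -/a sh_i.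
      have -> : Z.abs (X i + a - (Y i + - a)) = (Z.abs (X i + a - Y i) + 1)%Z by rewrite /a; lia.
      have -> : Z.abs (X i + a - Y i) = (Z.abs (X i - Y i) + 1)%Z by rewrite /a; lia.
      by rewrite !plus_IZR; ring.
    rewrite sh_j 1?eq_sym //.
    have -> : Z.abs (X i + a - Y i) = (Z.abs (X i - Y i) + 1)%Z by rewrite /a; lia.
    have -> : Z.abs (X j - (Y j + - b)) = (Z.abs (X j - Y j) + 1)%Z by rewrite /b; lia.
    by rewrite !plus_IZR; ring.
  have hr : 2 <= r by move: (n1_ge0 (sh j b Y) (sh i (- a) X)); rewrite e1; lra.
  have := both i j a b _ _ ha hb e1 e2.
  move=> h; have {}h := h ltac:(lra) ltac:(lra).
  by have := second _ hr erefl; lra.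
have gain : lap w X - lap w Y <= 2 * INR N * kap - G.
  have sum1 (f : 'I_N -> R) i : f i <= 2 * kap - G -> (forall k, k != i -> f k <= 2 * kap) ->
      \sum_(k < N) f k <= 2 * INR N * kap - G.
    move=> h1 h2; apply: (Rle_trans _ (\sum_(k < N) (2 * kap + (if k == i then - G else 0)))).
      apply: sum_le => k; case: (altP (k =P i)) => [->|ki]; first lra.
      by move: (h2 k ki); lra.
    by rewrite sum_add sum_const sum_delta; lra.
  case: (classic (exists i, (2 <= Z.abs (X i - Y i))%Z)) => [[i hi]|noA].
    rewrite /lap -sum_sub; apply: (sum1 _ i) => [|k _]; last exact: sync.
    by apply: cross; [right|lia|lia].
  case: (classic (exists i j : 'I_N, i != j /\ X i <> Y i /\ X j <> Y j)) => [[i [j [ij [hi hj]]]]|noB].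
    (* Reindexing by a transposition pairs direction [i] at [X] with [j] at [Y] and conversely. Both
       of these pairs are crossed, the remaining ones parallel. *)
    have -> : lap w Y = \sum_(k < N) Qk (tperm i j k).
      by rewrite /lap -/Qk (reindex_inj (@perm_inj _ (tperm i j))).
    rewrite /lap -sum_sub; apply: (sum1 _ i) => [|k ki].
      by rewrite tpermL; apply: cross => //; left.
    case: tpermP => [E|->|_ _]; last exact: sync.
      by move: ki; rewrite E eqxx.
    suff : Pk j - Qk i <= 2 * kap - G by move: G0; rewrite -/(Pk j); lra.
    by apply: cross => //; left; rewrite eq_sym.
  (* What remains is distance 1, as distance 0 would make [Psi] nonpositive. *)
  have [i hi] : exists i, X i <> Y i.
    apply: NNPP => h; have E : X = Y.
      by apply: functional_extensionality => i; apply: NNPP => h'; apply: h; exists i.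
    move: pos0; rewrite /Psi /= -/r E.
    have := Rmult_le_pos _ _ Hkap (quad_ge0 Y); lra.
  set a := (X i - Y i)%Z.
  have ha : (Z.abs a = 1)%Z.
    by apply: NNPP => h; apply: noA; exists i; rewrite -/a; rewrite /a in h *; lia.
  have EX : X = sh i a Y.
    apply: functional_extensionality => k; case: (altP (k =P i)) => [->|ki].
      by rewrite sh_i /a; lia.
    rewrite sh_j //; apply: NNPP => h; apply: noB; exists i, k; split=> //.
    by rewrite eq_sym.
  have r1E : r = 1.
    rewrite /r EX n1_sh n1_xx Z.sub_diag.
    have -> : (Y i + a - Y i = a)%Z by lia.
    by rewrite -!abs_IZR ha /=; ring.
  have EY : Y = sh i (- a) X by rewrite EX sh_add Z.add_opp_diag_l sh_0.
  have e3 : n1 (sh i (- a) Y) (sh i a X) = 3.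
    rewrite n1_shl n1_sh sh_i -/r r1E.
    have -> : (X i + a - (Y i + - a) = 3 * a)%Z by rewrite /a; lia.
    have -> : (X i + a - Y i = 2 * a)%Z by rewrite /a; lia.
    have -> : (X i - Y i = a)%Z by [].
    rewrite -!abs_IZR !Z.abs_mul ha /=; ring.
  have I3 := pair i i a (- a)%Z 3 ha e3 ltac:(lra).
  rewrite /lap -sum_sub; apply: (sum1 _ i) => [|k _]; last exact: sync.
  have EP : Pk i = w (sh i a X) + w Y - 2 * w X.
    rewrite EY /Pk; have [->|->] : a = 1%Z \/ a = (-1)%Z by lia.
      by [].
    by rewrite /=; ring.
  have EQ : Qk i = w X + w (sh i (- a) Y) - 2 * w Y.
    rewrite EX /Qk; have [->|->] : a = 1%Z \/ a = (-1)%Z by lia.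
      by [].
    by rewrite /=; ring.
  rewrite -/(Pk i) -/(Qk i) EP EQ.
  have T := lmod_third K L HK HL.
  (* [w Y] occurs in the stencil of [X] and [w X] in that of [Y]; the positivity of [Psi] bounds
     their difference from below and supplies the missing [lmod] terms. *)
  have W : w X - w Y > lmod K L 1 + kap * (IZR (X i - z i) * IZR (X i - z i)).
    have : IZR (X i - z i) * IZR (X i - z i) <= quad X.
      by apply: (sum_term (fun i => IZR (X i - z i) * IZR (X i - z i))) => k; apply: Rle_0_sqr.
    move=> /(Rmult_le_compat_l _ _ _ Hkap); move: pos0; rewrite /Psi /= -/r r1E; lra.
  (* The penalty in [W], counted twice, absorbs the cross term of the shifted penalty, by
     [2 a t <= 1 + t^2]. *)
  have Sq : 2 * IZR a * IZR (X i - z i) + 1 - 2 * (IZR (X i - z i) * IZR (X i - z i)) <= 2.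
    have aa := unit_case a ha.
    have := Rle_0_sqr (IZR a - IZR (X i - z i)); rewrite /Rsqr.
    by have := Rle_0_sqr (IZR (X i - z i)); rewrite /Rsqr; lra.
  move: (Rmult_le_compat_l _ _ _ Hkap Sq) I3 T W; rewrite /G r1E; lra.
have nY i s : (Z.abs s = 1)%Z -> w Y - w (sh i s Y) <= ell K L r.
  move=> hs.
  have hn : n1 (sh i s Y) X <= r + 1.
    by rewrite n1_sym; have := n1_sh_le X Y i s; rewrite -abs_IZR hs (n1_sym X Y) -/r; split_Rabs; lra.
  have := NB X (sh i s Y) ltac:(lra) ltac:(lra); rewrite /Psi /= -/r.
  have := lmod_mono K L HK HL _ _ (n1_ge0 (sh i s Y) X) hn.
  by have := lmod_step K L HK HL r r0; lra.
have l0 := ell_pos K L HK HL r r0.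
have uY : upg w Y <= INR N * (2 * (ell K L r * ell K L r)).
  apply: sum_le_const => i.
  have h1 := pos_sq_le _ _ (nY i 1%Z erefl) (Rlt_le _ _ l0).
  have h2 := pos_sq_le _ _ (nY i (-1)%Z erefl) (Rlt_le _ _ l0).
  lra.
have lX := Hl X ltac:(lra).
have lY : lap w Y <= C * upg w Y.
  by apply: (Hl Y _).2; have := n1_tri z X Y; rewrite (n1_sym X Y) -/r; lra.
have := Rmult_le_compat_l _ _ _ HC uY.
by have := Hgain r r0 PY; rewrite /G in gain; lra.
Qed.
End Doubling.

(** Cauchy-Schwarz, obtained by summing [|t| <= t^2 / (2 c) + c / 2] with the optimal weight
    [c = r / (4 N)]. *)
Lemma quad_n1 {N} (z x : lat N) r : 0 < r -> (0 < N)%nat -> r / 4 <= n1 z x -> r * r / (16 * INR N) <= quad z x.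
Proof.
move=> hr hN h.
have hn : 1 <= INR N by apply: (le_INR 1); apply/leP.
set c := r / (4 * INR N).
have hc : 0 < c by apply: Rdiv_lt_0_compat; lra.
have : n1 z x <= / (2 * c) * quad z x + INR N * (c / 2).
  rewrite /quad -sum_scal -sum_const -sum_add; apply: sum_le => i.
  set t := IZR _; have := Rle_0_sqr (Rabs t - c); rewrite /Rsqr.
  have -> : t * t = Rabs t * Rabs t by rewrite -Rabs_mult Rabs_pos_eq //; apply: Rle_0_sqr.
  set u := Rabs t => h1.
  have -> : / (2 * c) * (u * u) + c / 2 = u + (u - c) * (u - c) * / (2 * c) by field; lra.
  have : 0 < / (2 * c) by positivity.
  by move=> h2; have := Rmult_le_pos _ _ h1 (Rlt_le _ _ h2); lra.
have -> : INR N * (c / 2) = r / 8 by rewrite /c; field; lra.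
have -> : / (2 * c) = 2 * INR N / r by rewrite /c; field; lra.
move=> h1; have h2 : r / 8 <= 2 * INR N / r * quad z x by lra.
have h3 : 0 < r / (2 * INR N) by positivity.
have := Rmult_le_compat_l _ _ _ (Rlt_le _ _ h3) h2.
have -> : r / (2 * INR N) * (2 * INR N / r * quad z x) = quad z x by field; lra.
have -> // : r / (2 * INR N) * (r / 8) = r * r / (16 * INR N) by field; lra.
Qed.

(** Choice of constants for [doubling] on the ball of radius [rho], with [r1 = rho / 2],
    [r2 = e rho] and a slope of order [1 / rho]. The threshold [R0] makes the margins of 2 lattice
    steps harmless: [rho / 2 - 2 >= rho / 4] and [e rho - 2 >= e rho / 2]. *)
Lemma lipschitz_est (N : nat) (A C M : R) : 0 <= A -> 0 <= C -> 0 < M ->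
  exists L R0, 0 < L /\ 0 < R0 /\ forall (rho : R) (w : lat N -> R) z, R0 <= rho ->
    (forall x, n1 z x <= rho -> 0 <= w x <= M) ->
    (forall x, n1 z x <= rho -> - (A / (rho * rho)) <= lap w x <= C * upg w x) ->
    forall i s, Z.abs s = 1%Z -> Rabs (w (sh i s z) - w z) <= L / rho.
Proof.
move=> HA HC HM.
have HN := pos_INR N.
(* [2 N C] beats the gradient term, [1] leaves a gain of [ell^2], and [/ M] ensures [K M >= 1],
   hence [Lam >= 2]. *)
set K := 2 * INR N * C + 1 + / M.
have iM : 0 < / M by positivity.
have HNC : 0 <= INR N * C by positivity.
have HK : 1 < K by rewrite /K; lra.
set Lam := exp (K * M).
have HLam : 2 <= Lam.
  have : 1 <= K * M by rewrite -(Rinv_l M); [apply: Rmult_le_compat_r; rewrite /K; lra|lra].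
  by have := exp_ineq1_le (K * M); rewrite /Lam; lra.
(* [32 N^2 M / rho^2] is [2 N kap]. The size of [e] below gives [ell >= B / rho] up to distance
   [e rho], hence [ell^2 > (A + 32 N^2 M) / rho^2]. *)
set B := A + 32 * (INR N * INR N) * M + 1.
have HNN : 0 <= INR N * INR N * M by positivity.
have HB : 1 <= B by rewrite /B; lra.
set e := / (4 + 2 * K * B).
have KB : 0 < K * B by positivity.
have He : 0 < e by apply: Rinv_0_lt_compat; lra.
have He4 : e <= / 4 by apply: Rinv_le_contravar; lra.
have HKe : 0 < K * e by positivity.
(* Chosen so that [lmod] takes the value [M] at distance [e rho / 2]. *)
set L1 := 2 * (Lam - 1) / (K * e).
have HL1 : 0 < L1 by apply: Rdiv_lt_0_compat; lra.
exists (L1 + 16 * INR N * M), (8 + 4 / e).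
have H4e : 0 < 4 / e by positivity.
have HNM : 0 <= INR N * M by positivity.
split; first lra; split; first lra.
move=> rho w z HR Hw Hl i s Hs.
have NN : (0 < N)%nat by apply: leq_ltn_trans (ltn_ord i).
have HN1 : 1 <= INR N by apply: (le_INR 1); apply/leP.
have R0 : 0 < rho by lra.
have RR : 0 < rho * rho by nra.
set L := L1 / rho; set kap := 16 * INR N * M / (rho * rho).
have HL : 0 < L by apply: Rdiv_lt_0_compat.
have Hkap : 0 <= kap by apply: Rmult_le_pos; [nra|apply: Rlt_le; apply: Rinv_0_lt_compat].
have HeR : 4 <= e * rho.
  have -> : 4 = e * (4 / e) by field; lra.
  by apply: Rmult_le_compat_l; lra.
have LKe : L * K * (e * rho) = 2 * (Lam - 1) by rewrite /L /L1; field; lra.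
have inR : rho / 2 + e * rho + 1 <= rho by nra.
have dbl := doubling w z (A / (rho * rho)) C M K L kap (rho / 2) (e * rho) HC ltac:(lra) HL Hkap.
have {}dbl : forall x y : lat N, n1 z x <= rho / 2 -> n1 y x <= e * rho -> w x - w y <= lmod K L (n1 y x) + kap * quad z x.
  apply: dbl.
  - by move=> x hx; apply: Hw; lra.
  - by move=> x hx; apply: Hl; lra.
  - move=> x hx; have := quad_n1 z x rho R0 NN ltac:(lra).
    move=> /(Rmult_le_compat_l _ _ _ Hkap).
    have -> : kap * (rho * rho / (16 * INR N)) = M by rewrite /kap; field; lra.
    by [].
  - move=> r hr hr2; apply: (Rle_trans _ (lmod K L (e * rho / 2))).
      rewrite /lmod; have -> : L * K * (e * rho / 2) = Lam - 1 by lra.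
      have -> : 1 + (Lam - 1) = Lam by ring.
      by rewrite /Lam ln_exp; apply: Req_le; field; lra.
    by apply: lmod_mono; [lra|lra|lra|lra].
  - move=> r hr hr2.
    have h1 : L * K * r <= 2 * (Lam - 1).
      by rewrite -LKe; apply: Rmult_le_compat_l => //; apply: Rmult_le_pos; lra.
    have h0 : 0 <= L * K * r by positivity.
    have h2 : B / rho <= ell K L r.
      set X := 1 + L * K * r.
      have hX : 0 < X by rewrite /X; lra.
      have -> : ell K L r = (2 * (Lam - 1) / X) * (/ (K * e)) / rho.
        by rewrite /ell -/X /L /L1; field; lra.
      apply: Rmult_le_compat_r; first by positivity.
      have -> : B = / 2 * (2 * B) by field.
      apply: Rmult_le_compat; [lra|lra| |].
        apply: (Rmult_le_reg_r X); first lra.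
        have -> : 2 * (Lam - 1) / X * X = 2 * (Lam - 1) by field; lra.
        by rewrite /X; lra.
      rewrite -[2 * B]Rinv_inv; apply: Rinv_le_contravar; first by [].
      rewrite /e; apply: (Rmult_le_reg_r (4 + 2 * K * B)); first lra.
      have -> : K * / (4 + 2 * K * B) * (4 + 2 * K * B) = K by field; lra.
      have -> : / (2 * B) * (4 + 2 * K * B) = K + 2 / B by field; lra.
      have : 0 < 2 / B by positivity.
      lra.
    have h3 : (A + 32 * (INR N * INR N) * M) / (rho * rho) < ell K L r * ell K L r.
      apply: (Rlt_le_trans _ (B / rho * (B / rho))); last first.
        have hBR : 0 <= B / rho by positivity.
        by apply: Rmult_le_compat.
      have -> : B / rho * (B / rho) = (B * B) / (rho * rho) by field; lra.
      apply: Rmult_lt_compat_r; first by positivity.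
      by rewrite /B in HB *; nra.
    have -> : A / (rho * rho) = (A + 32 * (INR N * INR N) * M) / (rho * rho) - 2 * INR N * kap.
      by rewrite /kap; field; lra.
    set l2 := ell K L r * ell K L r in h3 *.
    have l2p : 0 <= l2 by apply: Rle_0_sqr.
    have : 0 <= / M * l2 by positivity.
    by rewrite /K; lra.
have n1s : n1 z (sh i s z) = 1.
  rewrite n1_sh n1_xx Z.sub_diag.
  have -> : (z i + s - z i = s)%Z by lia.
  by rewrite -!abs_IZR Hs /=; ring.
have p1 := lmod_lin K L ltac:(lra) HL 1 ltac:(lra).
have q0 : quad z z = 0.
  rewrite /quad (sum_ext _ (fun=> 0)) ?sum_const; first ring.
  by move=> k; rewrite Z.sub_diag; ring.
have q1 : quad z (sh i s z) = 1.
  rewrite quad_sh q0 Z.sub_diag.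
  have : IZR s * IZR s = 1 by rewrite -mult_IZR -Z.abs_square Hs.
  by move=> ->; ring.
have d1 := dbl (sh i s z) z ltac:(lra) ltac:(lra).
have d2 := dbl z (sh i s z) ltac:(rewrite n1_xx; lra) ltac:(rewrite n1_sym; lra).
rewrite q0 n1_sym n1s in d2; rewrite q1 n1s in d1.
have kR : kap <= 16 * INR N * M / rho.
  apply: Rmult_le_compat_l; first nra.
  by apply: Rinv_le_contravar; nra.
rewrite Rdiv_plus_distr -/L; apply: Rabs_le; lra.
Qed.

(** * Schauder estimates on the lattice *)

Lemma Rpower_pos x y : 0 < Rpower x y.
Proof. exact: exp_pos. Qed.

Section Differences.
Context {N : nat}.
Implicit Types (w : lat N -> R) (x y : lat N) (i j k : 'I_N).

Lemma df_sh i j s t w x : df i s (fun y => w (sh j t y)) x = df i s w (sh j t x).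
Proof. by rewrite /df (sh_comm i j). Qed.

Lemma df_plus i s v w x : df i s (fun y => v y + w y) x = df i s v x + df i s w x.
Proof. by rewrite /df; ring. Qed.

Lemma df_ext i s v w x : (forall y, v y = w y) -> df i s v x = df i s w x.
Proof. by move=> H; rewrite /df !H. Qed.

Lemma df_double i s w x : df i (s + s) w x = df i s w x + df i s w (sh i s x).
Proof. by rewrite /df sh_add; ring. Qed.

Lemma df_bound i s w x b : Rabs (w (sh i s x)) <= b -> Rabs (w x) <= b -> Rabs (df i s w x) <= 2 * b.
Proof. by rewrite /df => h1 h2; split_Rabs; lra. Qed.

Lemma df_steps i s w x b : (0 <= s)%Z ->
  (forall t, (0 <= t < s)%Z -> Rabs (df i 1 w (sh i t x)) <= b) -> Rabs (df i s w x) <= IZR s * b.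
Proof.
move: s; apply: natlike_ind => [_|s hs IH H].
  by rewrite /df sh_0 Rminus_diag_eq // Rabs_R0; lra.
have h1 := IH (fun t ht => H t ltac:(lia)).
have h2 := H s ltac:(lia).
have -> : df i (Z.succ s) w x = df i s w x + df i 1 w (sh i s x).
  by rewrite /df sh_add Z.add_1_l; ring.
apply: Rle_trans (Rabs_triang _ _) _; rewrite succ_IZR; lra.
Qed.

Definition df2 i j s w := df i s (df j s w).
Definition df3 i j k s w := df i s (df j s (df k s w)).

Lemma df2_double i j s w x : df2 i j (s + s) w x =
  df2 i j s w x + df2 i j s w (sh i s x) + df2 i j s w (sh j s x) + df2 i j s w (sh i s (sh j s x)).
Proof.
rewrite /df2 (df_ext i (s + s) _ _ x (fun y => df_double j s w y)) df_plus !df_double.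
by rewrite !df_sh (sh_comm j i); ring.
Qed.

Lemma df3_double i j k s w x : let g := df3 i j k s w in df3 i j k (s + s) w x =
  g x + g (sh i s x) + g (sh j s x) + g (sh i s (sh j s x)) +
  g (sh k s x) + g (sh i s (sh k s x)) + g (sh j s (sh k s x)) + g (sh i s (sh j s (sh k s x))).
Proof.
move=> g; set u := df2 j k s w.
have E y : df j (s + s) (df k (s + s) w) y = u y + u (sh j s y) + (u (sh k s y) + u (sh j s (sh k s y))).
  by rewrite -/(df2 j k (s + s) w y) df2_double -/u; ring.
have dfE y : df i s (df j (s + s) (df k (s + s) w)) y = g y + g (sh j s y) + g (sh k s y) + g (sh j s (sh k s y)).
  rewrite (df_ext i s _ _ _ E) /g /df3 -/(df2 j k s w) -/u /df.
  by rewrite !(sh_comm i j s s) !(sh_comm i k s s); ring.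
rewrite /df3 df_double !dfE !(sh_comm k i s s) !(sh_comm j i s s); ring.
Qed.

Lemma lap_df3 i j k s w x : lap (df3 i j k s w) x = df3 i j k s (lap w) x.
Proof.
rewrite /df3 lap_df; apply: df_ext => y; rewrite lap_df; apply: df_ext => y'.
by rewrite lap_df.
Qed.

(** The difference with step [2 s] is the sum of those with step [s] over the 8 corners of a cell.
    The corners are 0 to 3 edges away from [x], and these numbers add up to 12. *)
Lemma marchaud3 i j k s w x b :
  (forall l a a', In a [:: i; j; k] -> In a' [:: i; j; k] -> In l [:: i; j; k] -> 
     let g := df3 i j k s w in
     [/\ Rabs (df l s g x) <= b, Rabs (df l s g (sh a s x)) <= b & Rabs (df l s g (sh a s (sh a' s x))) <= b]) ->
  8 * Rabs (df3 i j k s w x) <= Rabs (df3 i j k (s + s) w x) + 12 * b.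
Proof.
move=> H; have := df3_double i j k s w x; set g := df3 i j k s w in H * => /= E.
have I : In i [:: i; j; k] by left.
have J : In j [:: i; j; k] by right; left.
have K : In k [:: i; j; k] by right; right; left.
have B l y : Rabs (df l s g y) <= b -> - b <= g (sh l s y) - g y <= b.
  by rewrite /df; split_Rabs; lra.
have i1 := H i j k J K I; have i2 := H i k i K I I; have j1 := H j k i K I J; have k1 := H k i i I I K.
case: i1 i2 j1 k1 => /B i1 /B i2 /B i3 [_ /B i4 _] [/B j1 /B j2 _] [/B k1 _ _].
have S : Rabs (8 * g x - df3 i j k (s + s) w x) <= 12 * b by rewrite E; apply: Rabs_le; lra.
by clear -S; split_Rabs; lra.
Qed.

Lemma df3_bound i j k s w x b :
  (forall y, n1 x y <= 3 * Rabs (IZR s) -> Rabs (w y) <= b) -> Rabs (df3 i j k s w x) <= 8 * b.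
Proof.
move=> H.
have sh1 l y : n1 x (sh l s y) <= n1 x y + Rabs (IZR s).
  by have := n1_sh_le x y l s; split_Rabs; lra.
have p := Rabs_pos (IZR s).
have D0 y : n1 x y <= 2 * Rabs (IZR s) -> Rabs (df k s w y) <= 2 * b.
  by move=> h; apply: df_bound; apply: H; [have := sh1 k y; lra|lra].
have D1 y : n1 x y <= Rabs (IZR s) -> Rabs (df j s (df k s w) y) <= 2 * (2 * b).
  by move=> h; apply: df_bound; apply: D0; [have := sh1 j y; lra|lra].
have : Rabs (df3 i j k s w x) <= 2 * (2 * (2 * b)).
  by apply: df_bound; apply: D1; rewrite ?n1_xx; [have := sh1 i x; rewrite n1_xx; lra|lra].
lra.
Qed.

Lemma df3_bound_df i j k s w x b :
  (forall y, n1 x y <= 2 * Rabs (IZR s) -> Rabs (df k s w y) <= b) -> Rabs (df3 i j k s w x) <= 4 * b.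
Proof.
move=> H.
have sh1 l y : n1 x (sh l s y) <= n1 x y + Rabs (IZR s).
  by have := n1_sh_le x y l s; split_Rabs; lra.
have p := Rabs_pos (IZR s).
have D1 y : n1 x y <= Rabs (IZR s) -> Rabs (df j s (df k s w) y) <= 2 * b.
  by move=> h; apply: df_bound; apply: H; [have := sh1 j y; lra|lra].
have : Rabs (df3 i j k s w x) <= 2 * (2 * b).
  by apply: df_bound; apply: D1; rewrite ?n1_xx; [have := sh1 i x; rewrite n1_xx; lra|lra].
lra.
Qed.
End Differences.

Section ThirdDiff.
Context {N : nat} (al : R) (Hal : 0 <= al < 1).

(* Weighting by powers of the distance to the boundary of the ball lets the
   Marchaud remainder be absorbed at a maximum point. *)
Lemma third_diff : exists lam C : R, 4 <= lam /\ 0 < C /\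
  forall (rad : R) (w : lat N -> R) z M Phi, 0 < rad -> 0 <= M -> 0 <= Phi ->
  (forall x, n1 z x <= rad -> Rabs (w x) <= M) ->
  (forall x i s, (1 <= s)%Z -> lam * IZR s <= rad - n1 z x ->
     Rabs (df i s (lap w) x) <= Phi * Rpower (IZR s / rad) al / (rad * rad)) ->
  forall x i j k s, (1 <= s)%Z -> lam * IZR s <= rad - n1 z x ->
     Rabs (df3 i j k s w x) <= C * (M + Phi) * Rpower (IZR s / (rad - n1 z x)) (2 + al).
Proof.
have HN := pos_INR N.
set be := 2 + al.
set C0 := 4 + 3 * INR N.
have HC0 : 4 <= C0 by rewrite /C0; lra.
set tb := Rpower 2 be.
(* [2^(2 + al) < 8] because [al < 1]: this gap in the Marchaud inequality is what absorbs the
   maximum [Th]. With second differences the factor would be 4, below [2^(2 + al)] once [al > 0],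
   and there would be no gap. *)
have Htb : tb < 8.
  have -> : 8 = Rpower 2 3.
    have -> : 3 = INR 3 by rewrite /=; ring.
    by rewrite Rpower_pow; [ring|lra].
  by apply: Rpower_lt; rewrite /be; lra.
(* The gradient bound on cubes of half-side [lp s] contributes a multiple of [Th / lp]; with this
   [lp] it uses at most half of the gap. *)
set l' := up (48 * C0 / (8 - tb) + 1).
have Hl' : 48 * C0 / (8 - tb) + 1 < IZR l' by case: (archimed (48 * C0 / (8 - tb) + 1)).
have Hq0 : 0 < 48 * C0 / (8 - tb) by positivity.
have Hl'1 : (1 <= l')%Z by apply: le_IZR; lra.
have Hl'C : 48 * C0 <= (8 - tb) * IZR l'.
  have -> : 48 * C0 = (8 - tb) * (48 * C0 / (8 - tb)) by field; lra.
  by apply: Rmult_le_compat_l; lra.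
set lp := IZR l' in Hl' Hl'C.
(* A quarter of [lam s] covers 3 steps of length [s] plus the [l^1] radius [N lp s] of a cube. *)
set lam := 4 * (3 + INR N * lp).
have HNlp : 0 <= INR N * lp by positivity.
have Hlam : 12 <= lam by rewrite /lam; lra.
set C := 8 * Rpower (2 * lam) be + 96 * C0 * lp / (8 - tb).
have HC1 : 0 < Rpower (2 * lam) be by positivity.
have HC2 : 0 < 96 * C0 * lp / (8 - tb) by positivity.
have HC : 0 < C by rewrite /C; lra.
exists lam, C; split; first lra; split=> //.
move=> rad w z M Phi Hrad HM HPhi Hw Hf x0 i0 j0 k0 s0 Hs0 Hx0.
pose E (p : lat N * (Z * ('I_N * 'I_N * 'I_N))) := (1 <= p.2.1)%Z /\ lam * IZR p.2.1 <= rad - n1 z p.1.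
pose rho (p : lat N * (Z * ('I_N * 'I_N * 'I_N))) := Rpower (IZR p.2.1 / (rad - n1 z p.1)) be.
pose T (p : lat N * (Z * ('I_N * 'I_N * 'I_N))) := Rabs (df3 p.2.2.1.1 p.2.2.1.2 p.2.2.2 p.2.1 w p.1).
have finE : fin E.
  apply: fin_sub (fin_prod _ _ (fin_n1 z rad) (fin_prod _ _ (fin_Zrange (up rad)) (fin_finType _))).
  move=> [x [s q]] [/= h1 h2]; have s1 : 1 <= IZR s by apply: IZR_le.
  have n0 := n1_ge0 z x.
  split; first nra; split=> //.
  apply: le_IZR; rewrite abs_IZR Rabs_pos_eq; last lra.
  by case: (archimed rad) => h3 _; nra.
pose p0 := (x0, (s0, (i0, j0, k0))).
have Ep0 : E p0 by [].
have [[x [s [[i j] k]]] [[/= Hs Hx] Hmax]] := argmax E (fun p => T p / rho p) finE (ex_intro _ p0 Ep0).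
set Th := T (x, (s, (i, j, k))) / rho (x, (s, (i, j, k))).
have rho0 p : 0 < rho p by apply: Rpower_pos.
have Th0 : 0 <= Th by apply: Rmult_le_pos; [apply: Rabs_pos|apply: Rlt_le; apply: Rinv_0_lt_compat].
have Hall p : E p -> T p <= Th * rho p.
  move=> Ep; have := Hmax p Ep; rewrite -/Th => h.
  have := Rmult_le_compat_r _ _ _ (Rlt_le _ _ (rho0 p)) h.
  by have -> : T p / rho p * rho p = T p by field; have := rho0 p; lra.
suff HTh : Th <= C * (M + Phi).
  apply: Rle_trans (Hall p0 Ep0) _; apply: Rmult_le_compat_r => //.
  exact: Rlt_le.
have s1 : 1 <= IZR s by apply: IZR_le.
have sabs : Rabs (IZR s) = IZR s by rewrite Rabs_pos_eq; lra.
set d := rad - n1 z x in Hx.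
have d0 : 0 < d by nra.
have drad : d <= rad by rewrite /d; have := n1_ge0 z x; lra.
have near y c : n1 x y <= c * IZR s -> d - c * IZR s <= rad - n1 z y.
  by move=> h; have := n1_tri z x y; rewrite /d; lra.
(* If the step is comparable with the distance to the boundary of the ball, the weight [rho] is
   bounded below and the crude bound [8 M] suffices. *)
case: (Rlt_le_dec d (2 * lam * IZR s)) => Hcase.
  have TM : T (x, (s, (i, j, k))) <= 8 * M.
    apply: df3_bound => y; rewrite sabs => hy; apply: Hw.
    by have := near y 3 hy; nra.
  have r1 : 1 <= Rpower (2 * lam) be * rho (x, (s, (i, j, k))).
    rewrite /rho /= -/d Rpower_mult_distr; [|lra|apply: Rdiv_lt_0_compat; lra].
    have <- : Rpower 1 be = 1 by rewrite /Rpower ln_1 Rmult_0_r exp_0.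
    apply: Rle_Rpower_l; first by rewrite /be; lra.
    split; first lra.
    apply: (Rmult_le_reg_r d) => //.
    have -> : 2 * lam * (IZR s / d) * d = 2 * lam * IZR s by field; lra.
    lra.
  have r0 := rho0 (x, (s, (i, j, k))).
  have : Th <= 8 * M * Rpower (2 * lam) be.
    apply: (Rmult_le_reg_r _ _ _ r0).
    have -> : Th * rho (x, (s, (i, j, k))) = T (x, (s, (i, j, k))) by rewrite /Th; field; lra.
    apply: Rle_trans TM _.
    have := Rmult_le_compat_l (8 * M) _ _ ltac:(lra) r1; lra.
  move=> h; apply: Rle_trans h _; rewrite /C.
  have : 0 <= Rpower (2 * lam) be * Phi by positivity.
  have : 0 <= 96 * C0 * lp / (8 - tb) * (M + Phi) by positivity.
  lra.
set r := rho (x, (s, (i, j, k))).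
have r0 : 0 < r by apply: rho0.
have rE : r = Rpower (IZR s / d) be by [].
have sd : 0 < IZR s / d by positivity.
set g := df3 i j k s w.
have inE y : n1 x y <= lam / 4 * IZR s -> 7 / 8 * d <= rad - n1 z y /\ lam * IZR s <= rad - n1 z y.
  by move=> /near h; split; nra.
have gb y : n1 x y <= lam / 4 * IZR s -> Rabs (g y) <= 2 * Th * r.
  move=> /inE [h1 h2]; apply: Rle_trans (Hall (y, (s, (i, j, k))) (conj Hs h2)) _.
  (* Nearby points lose at most 1/8 of the distance to the boundary, and [(8/7)^3 < 2]. *)
  have : rho (y, (s, (i, j, k))) <= 2 * r.
    rewrite /rho /=; apply: (Rle_trans _ (Rpower (8 / 7 * (IZR s / d)) be)).
      apply: Rle_Rpower_l; first by rewrite /be; lra.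
      split; first by positivity.
      have -> : 8 / 7 * (IZR s / d) = IZR s / (7 / 8 * d) by field; lra.
      apply: Rmult_le_compat_l; first lra.
      by apply: Rinv_le_contravar => //; nra.
    rewrite -Rpower_mult_distr; [|lra|lra].
    rewrite -rE; apply: Rmult_le_compat_r; first lra.
    apply: (Rle_trans _ (Rpower (8 / 7) 3)); first by apply: Rle_Rpower; rewrite /be; lra.
    have -> : 3 = INR 3 by rewrite /=; ring.
    by rewrite Rpower_pow; lra.
  by move/(Rmult_le_compat_l _ _ _ Th0); lra.
set Fs := 4 * (Phi * Rpower (IZR s / rad) al / (rad * rad)).
have lapg y : n1 x y <= lam / 4 * IZR s -> Rabs (lap g y) <= Fs.
  move=> h; rewrite lap_df3; apply: df3_bound_df => y' hy'; apply: Hf => //.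
  rewrite sabs in hy'.
  have := near y' (lam / 4 + 2) ltac:(have := n1_tri x y y'; lra).
  by nra.
have step l y : n1 x y <= 2 * IZR s -> Rabs (df l s g y) <= C0 * (2 * Th * r / lp + lp * (IZR s * IZR s * Fs)).
  move=> hy.
  have Hsl : (1 <= l' * s)%Z by nia.
  have one t : (0 <= t < s)%Z -> Rabs (df l 1 g (sh l t y)) <=
      C0 * (2 * Th * r / (lp * IZR s) + Fs * (lp * IZR s)).
    move=> ht; rewrite /df.
    have box y' : (forall m, (Z.abs (y' m - sh l t y m) <= l' * s)%Z) -> n1 x y' <= lam / 4 * IZR s.
      move=> hb.
      have h1 : n1 (sh l t y) y' <= INR N * (lp * IZR s).
        by apply: n1_box => m; rewrite -abs_IZR -mult_IZR; apply: IZR_le.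
      have h2 : n1 x (sh l t y) <= 3 * IZR s.
        have := n1_sh_le x y l t; rewrite -abs_IZR.
        have : IZR (Z.abs t) <= IZR s by apply: IZR_le; lia.
        by move=> ? h; move: h; split_Rabs; lra.
      by have := n1_tri x (sh l t y) y'; rewrite /lam; lra.
    have := grad_est g (sh l t y) l (l' * s) (2 * Th * r) Fs Hsl.
    rewrite mult_IZR -/lp -/C0; apply.
    - by positivity.
    - by apply: Rle_trans (lapg x _); [apply: Rabs_pos|rewrite n1_xx; nra].
    - by move=> y' /box; apply: gb.
    - by move=> y' /box; apply: lapg.
  apply: Rle_trans (df_steps l s g y _ ltac:(lia) one) _.
  by apply: Req_le; field; lra.
have Fs2 : IZR s * IZR s * Fs <= 4 * Phi * r.
  have e2 : IZR s * IZR s * Fs = 4 * Phi * ((IZR s / rad) ^ 2 * Rpower (IZR s / rad) al).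
    by rewrite /Fs; field; lra.
  have sr : 0 < IZR s / rad by positivity.
  rewrite e2 -Rpower_pow //.
  have -> : INR 2 = 2 by [].
  rewrite -Rpower_plus -/be rE; apply: Rmult_le_compat_l; first lra.
  apply: Rle_Rpower_l; first by rewrite /be; lra.
  split=> //; apply: Rmult_le_compat_l; first lra.
  by apply: Rinv_le_contravar.
have March : 8 * Rabs (g x) <= Rabs (df3 i j k (s + s) w x) + 12 * (C0 * (2 * Th * r / lp + lp * (4 * Phi * r))).
  apply: marchaud3 => l a a' _ _ _ /=.
  have up y : n1 x y <= 2 * IZR s -> Rabs (df l s g y) <= C0 * (2 * Th * r / lp + lp * (4 * Phi * r)).
    move=> hy; apply: Rle_trans (step l y hy) _.
    apply: Rmult_le_compat_l; first lra.
    by apply: Rplus_le_compat_l; apply: Rmult_le_compat_l; lra.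
  have sh1 l1 y : n1 x (sh l1 s y) <= n1 x y + IZR s.
    by have := n1_sh_le x y l1 s; rewrite sabs; split_Rabs; lra.
  have h0 := n1_xx x; have h1 := sh1 a x; have h2 := sh1 a (sh a' s x); have h3 := sh1 a' x.
  by split; apply: up; lra.
(* Maximality is used at the doubled step as well, which is admissible because [d >= 2 lam s]. *)
have T2 : Rabs (df3 i j k (s + s) w x) <= Th * (tb * r).
  have e : IZR (s + s) = 2 * IZR s by rewrite plus_IZR; ring.
  have h := Hall (x, ((s + s)%Z, (i, j, k))) (conj (ltac:(simpl; lia) : (1 <= s + s)%Z) (ltac:(simpl; rewrite e -/d; lra) : lam * IZR (s + s) <= rad - n1 z x)).
  apply: Rle_trans h _; apply: Rmult_le_compat_l => //.
  rewrite /rho /= e -/d.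
  have -> : 2 * IZR s / d = 2 * (IZR s / d) by field; lra.
  by rewrite -Rpower_mult_distr; [rewrite -rE /tb; lra|lra|lra].
have gx : Rabs (g x) = Th * r by rewrite /Th -/r; have -> : T (x, (s, (i, j, k))) = Rabs (g x) by []; field; lra.
rewrite gx in March.
have h1 : (8 - tb) * Th <= 24 * C0 * Th / lp + 48 * C0 * lp * Phi.
  apply: (Rmult_le_reg_r r) => //.
  have -> : (24 * C0 * Th / lp + 48 * C0 * lp * Phi) * r = 12 * (C0 * (2 * Th * r / lp + lp * (4 * Phi * r))) by field; lra.
  lra.
have h2 : 24 * C0 * Th / lp <= (8 - tb) / 2 * Th.
  have -> : 24 * C0 * Th / lp = (24 * C0 / lp) * Th by field; lra.
  apply: Rmult_le_compat_r => //; apply: (Rmult_le_reg_r lp); first lra.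
  have -> : 24 * C0 / lp * lp = 24 * C0 by field; lra.
  lra.
have h3 : Th <= 96 * C0 * lp / (8 - tb) * Phi.
  apply: (Rmult_le_reg_l ((8 - tb) / 2)); first lra.
  have -> : (8 - tb) / 2 * (96 * C0 * lp / (8 - tb) * Phi) = 48 * C0 * lp * Phi by field; lra.
  lra.
rewrite /C; have : 0 <= 96 * C0 * lp / (8 - tb) * M by positivity.
have : 0 <= Rpower (2 * lam) be * (M + Phi) by positivity.
lra.
Qed.
End ThirdDiff.

(** * Dyadic summation: from third to second differences *)

Definition z2 (m : nat) : Z := (2 ^ Z.of_nat m)%Z.

Lemma z2_0 : z2 0 = 1%Z. Proof. by []. Qed.
Lemma z2_S m : z2 m.+1 = (z2 m + z2 m)%Z.
Proof. by rewrite /z2 Nat2Z.inj_succ Z.pow_succ_r; lia. Qed.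
Lemma z2_ge1 m : (1 <= z2 m)%Z.
Proof. by elim: m => [|m IH]; rewrite ?z2_0 ?z2_S; lia. Qed.

Lemma z2_log s : (1 <= s)%Z -> exists n, (z2 n <= s < z2 n.+1)%Z.
Proof.
move=> hs; exists (Z.to_nat (Z.log2 s)).
rewrite /z2 Nat2Z.inj_succ Z2Nat.id; last exact: Z.log2_nonneg.
by apply: Z.log2_spec; lia.
Qed.

Lemma Rpower_z2 al m : Rpower (IZR (z2 m)) al = Rpower 2 al ^ m.
Proof.
elim: m => [|m IH]; first by rewrite z2_0 /Rpower ln_1 Rmult_0_r exp_0.
have h : 0 < IZR (z2 m) by apply: (IZR_lt 0); move: (z2_ge1 m); lia.
rewrite z2_S plus_IZR; have -> : IZR (z2 m) + IZR (z2 m) = 2 * IZR (z2 m) by ring.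
by rewrite -Rpower_mult_distr ?IH //; lra.
Qed.

Lemma Rpower_2_gt1 al : 0 < al -> 1 < Rpower 2 al.
Proof. by move=> h; rewrite -(Rpower_O 2); [apply: Rpower_lt; lra|lra]. Qed.

(* Summing the geometric series over the binary digits of [t]. *)
Lemma dyadic_sum (p : Z -> R) (b q : R) n : 0 <= b -> 1 < q ->
  (forall m t, (0 <= t)%Z -> (t + z2 m <= z2 n)%Z -> Rabs (p (t + z2 m)%Z - p t) <= b * q ^ m) ->
  forall t, (0 <= t < z2 n)%Z -> Rabs (p t - p 0%Z) <= b * q ^ n / (q - 1).
Proof.
move=> hb hq; elim: n => [|n IH] H t ht.
  have -> : t = 0%Z by move: ht; rewrite z2_0; lia.
  rewrite Rminus_diag_eq // Rabs_R0 /=.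
  by positivity.
have qn : 0 < q ^ n by apply: pow_lt; lra.
have {}IH : forall t, (0 <= t < z2 n)%Z -> Rabs (p t - p 0%Z) <= b * q ^ n / (q - 1).
  by apply: IH => m t' h1 h2; apply: H => //; rewrite z2_S; move: (z2_ge1 n); lia.
have e : b * q ^ n.+1 / (q - 1) = b * q ^ n + b * q ^ n / (q - 1) by rewrite /=; field; lra.
have pb : 0 <= b * q ^ n by positivity.
rewrite e; case: (Z_lt_le_dec t (z2 n)) => htn.
  by apply: Rle_trans (IH t _) _; [lia|lra].
have -> : p t - p 0%Z = (p (t - z2 n + z2 n)%Z - p (t - z2 n)%Z) + (p (t - z2 n)%Z - p 0%Z).
  by rewrite Z.sub_add; ring.
rewrite z2_S in ht.
apply: Rle_trans (Rabs_triang _ _) _; apply: Rplus_le_compat; last by apply: IH; lia.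
by apply: H; rewrite ?z2_S; lia.
Qed.

(** The count of edges from [x], now on the four corners of a parallelogram: [0 + 1 + 1 + 2 = 4]. *)
Lemma df2_marchaud {N} (i j : 'I_N) s w x b :
  Rabs (df3 i i j s w x) <= b -> Rabs (df3 j i j s w x) <= b -> Rabs (df3 i i j s w (sh j s x)) <= b ->
  Rabs (df2 i j (s + s) w x - 4 * df2 i j s w x) <= 4 * b.
Proof.
rewrite df2_double -[df3 i i j s w]/(df i s (df2 i j s w)) -[df3 j i j s w]/(df j s (df2 i j s w)) /df.
by set u := df2 i j s w => h1 h2 h3; split_Rabs; lra.
Qed.

Section SecondHoelder.
Context {N : nat} (al : R) (Hal : 0 < al < 1).

(** By [df2_marchaud] the quotient of [df2] at step [2^m] by [4^m] changes by at most a multiple of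
    [(2^m / rad)^al / rad^2] from one scale to the next, a geometric series ruled by its largest
    term. Starting from a scale comparable with [rad], where [4 M] bounds [df2], this gives the
    bound at step 1. Comparing with scale [2^m] at two points [2^m] apart gives the Hoelder estimate
    for dyadic steps, and [dyadic_sum] the general one. *)
Lemma second_diff : exists lam C : R, 4 <= lam /\ 0 < C /\
  forall (rad : R) (w : lat N -> R) z M Phi, 8 * lam <= rad -> 0 <= M -> 0 <= Phi ->
  (forall x, n1 z x <= rad -> Rabs (w x) <= M) ->
  (forall x i s, (1 <= s)%Z -> lam * IZR s <= rad - n1 z x ->
     Rabs (df i s (lap w) x) <= Phi * Rpower (IZR s / rad) al / (rad * rad)) ->
  forall x, n1 z x <= rad / 16 -> forall i j,
    Rabs (df2 i j 1 w x) <= C * (M + Phi) / (rad * rad) /\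
    forall k s, (1 <= s)%Z -> 8 * lam * IZR s <= rad ->
      Rabs (df k s (df2 i j 1 w) x) <= C * (M + Phi) * Rpower (IZR s / rad) al / (rad * rad).
Proof.
have [l0 [C0 [Hl0 [HC0 third]]]] := @third_diff N al ltac:(lra).
set q := Rpower 2 al.
have Hq : 1 < q by apply: Rpower_2_gt1; lra.
have iq : 0 < / (q - 1) by positivity.
have Hq2 : q <= 2 by rewrite -[X in _ <= X](Rpower_1 2); [apply: Rle_Rpower; lra|lra].
set B' := 2 * (8 * C0) / (q - 1) + 8 * C0.
have HB' : 0 < B'.
  by rewrite /B' /Rdiv; have := Rmult_lt_0_compat (2 * (8 * C0)) (/ (q - 1)) ltac:(lra) iq; lra.
set C := 64 * (l0 * l0) + 8 * C0 / (q - 1) + 2 * B' / (q - 1).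
have C1 : 0 < 64 * (l0 * l0) by nra.
have C2 : 0 < 8 * C0 / (q - 1) by positivity.
have C3 : 0 < 2 * B' / (q - 1) by positivity.
exists l0, C; split=> //; split; first by rewrite /C; lra.
move=> rad w z M Phi Hrad HM HPhi Hw Hf.
have r0 : 0 < rad by lra.
have rr : 0 < rad * rad by nra.
have irr : 0 < / (rad * rad) by positivity.
set e := Rpower (/ rad) al.
have e0 : 0 < e by apply: Rpower_pos.
have ez m : Rpower (IZR (z2 m) / rad) al = e * q ^ m.
  rewrite /Rdiv Rmult_comm -Rpower_mult_distr ?Rpower_z2 //; first by positivity.
  by apply: (IZR_lt 0); move: (z2_ge1 m); lia.
set b := 8 * C0 * (M + Phi) * e / (rad * rad).
have b0 : 0 <= b.
  by apply: Rmult_le_pos; [positivity|lra].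
have T3 x i j k m : n1 z x <= rad / 2 -> l0 * IZR (z2 m) <= rad / 2 ->
   Rabs (df3 i j k (z2 m) w x) <= b * q ^ m * (IZR (z2 m) * IZR (z2 m)).
  move=> hx hm.
  have s1 := z2_ge1 m; have s1R : 1 <= IZR (z2 m) by apply: IZR_le.
  have h := third rad w z M Phi r0 HM HPhi Hw Hf x i j k (z2 m) s1 ltac:(lra).
  apply: Rle_trans h _.
  have -> : b * q ^ m * (IZR (z2 m) * IZR (z2 m)) = C0 * (M + Phi) * (8 * (e * q ^ m * (IZR (z2 m) / rad) ^ 2)).
    by rewrite /b; field; lra.
  apply: Rmult_le_compat_l; first by positivity.
  apply: (Rle_trans _ (Rpower (2 * (IZR (z2 m) / rad)) (2 + al))).
    apply: Rle_Rpower_l; first lra.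
    split; first by positivity.
    have -> : 2 * (IZR (z2 m) / rad) = IZR (z2 m) / (rad / 2) by field; lra.
    by apply: Rmult_le_compat_l; [lra|apply: Rinv_le_contravar; lra].
  have sr : 0 < IZR (z2 m) / rad by positivity.
  rewrite -Rpower_mult_distr ; [rewrite !(Rpower_plus 2 al)|lra|lra].
  rewrite ez -(Rpower_pow 2) //.
  have -> : INR 2 = 2 by [].
  have -> : Rpower 2 2 = 4.
    have -> : 2 = INR 2 by [].
    by rewrite Rpower_pow; [rewrite /=; ring|rewrite /=; lra].
  rewrite -/q; set u := Rpower _ 2; have u0 : 0 < u by apply: Rpower_pos.
  have qm : 0 < e * q ^ m * u.
    by apply: Rmult_lt_0_compat => //; apply: Rmult_lt_0_compat => //; apply: pow_lt; lra.
  have -> : 4 * q * (u * (e * q ^ m)) = (4 * q) * (e * q ^ m * u) by ring.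
  by apply: Rmult_le_compat_r; lra.
have nsh x k s : (0 <= s)%Z -> n1 z (sh k s x) <= n1 z x + IZR s.
  move=> hs; have := n1_sh_le z x k s; rewrite (Rabs_pos_eq (IZR s)); last exact: IZR_le.
  by split_Rabs; lra.
have z2lt m : 0 < IZR (z2 m) by apply: (IZR_lt 0); move: (z2_ge1 m); lia.
have small m s : l0 * IZR (z2 m) <= s -> IZR (z2 m) <= s / 4.
  by move=> h; have := z2lt m; nra.
(* Telescoping [df2 (2^m) / 4^m] over the scales [2^m]. *)
have tele x i j n : n1 z x <= rad / 4 -> l0 * IZR (z2 n) <= rad / 2 ->
   Rabs (df2 i j 1 w x - df2 i j (z2 n) w x / (IZR (z2 n) * IZR (z2 n))) <= b * q ^ n / (q - 1).
  move=> hx; elim: n => [|n IH] hn.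
    rewrite z2_0 Rmult_1_l Rdiv_1_r Rminus_diag_eq // Rabs_R0 /=.
    by positivity.
  have hn' : l0 * IZR (z2 n) <= rad / 2.
    by move: hn; rewrite z2_S plus_IZR; have := z2lt n; nra.
  have {}IH := IH hn'.
  set s := z2 n in IH hn'.
  have s0 : 0 < IZR s by apply: z2lt.
  have Hm : Rabs (df2 i j (s + s) w x - 4 * df2 i j s w x) <= 4 * (b * q ^ n * (IZR s * IZR s)).
    apply: df2_marchaud; apply: T3 => //; try lra.
    have h := small n _ hn'; have := nsh x j s ltac:(move: (z2_ge1 n); rewrite /s; lia).
    by rewrite -/s in h; lra.
  rewrite z2_S -/s plus_IZR.
  have -> : df2 i j 1 w x - df2 i j (s + s) w x / ((IZR s + IZR s) * (IZR s + IZR s)) =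
     (df2 i j 1 w x - df2 i j s w x / (IZR s * IZR s)) +
     - ((df2 i j (s + s) w x - 4 * df2 i j s w x) * / (4 * (IZR s * IZR s))) by field; lra.
  apply: Rle_trans (Rabs_triang _ _) _.
  have i4 : 0 < / (4 * (IZR s * IZR s)) by positivity.
  rewrite Rabs_Ropp Rabs_mult (Rabs_pos_eq (/ _)); last lra.
  have := Rmult_le_compat_r _ _ _ (Rlt_le _ _ i4) Hm.
  have -> : 4 * (b * q ^ n * (IZR s * IZR s)) * / (4 * (IZR s * IZR s)) = b * q ^ n by field; lra.
  have -> : b * q ^ n.+1 / (q - 1) = b * q ^ n / (q - 1) + b * q ^ n by rewrite /=; field; lra.
  lra.
move=> x hx i j.
split.
  set s0 := Int_part (rad / (2 * l0)).
  have [hs1 hs2] := base_Int_part (rad / (2 * l0)); rewrite -/s0 in hs1 hs2.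
  have big : 4 <= rad / (2 * l0).
    by apply: (Rmult_le_reg_r (2 * l0)); [lra|have -> : rad / (2 * l0) * (2 * l0) = rad by field; lra]; lra.
  have hs0 : (1 <= s0)%Z by apply: le_IZR; lra.
  have [n [hn1 hn2]] := z2_log s0 hs0.
  have hn3 : IZR (z2 n) <= rad / (2 * l0) by apply: Rle_trans hs1; apply: IZR_le.
  have hn4 : rad / (2 * l0) <= 2 * IZR (z2 n).
    have : IZR s0 + 1 <= IZR (z2 n.+1) by rewrite -plus_IZR; apply: IZR_le; lia.
    by rewrite z2_S plus_IZR; lra.
  have hn5 : l0 * IZR (z2 n) <= rad / 2.
    have -> : rad / 2 = l0 * (rad / (2 * l0)) by field; lra.
    by apply: Rmult_le_compat_l; lra.
  have ht := tele x i j n ltac:(lra) hn5.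
  set s := z2 n in ht hn3 hn4 hn5.
  have s0' : 0 < IZR s by apply: z2lt.
  have hn6 : IZR s <= rad / 8 by have := small n _ hn5; rewrite -/s; lra.
  have D2 : Rabs (df2 i j s w x) <= 4 * M.
    have sp : (0 <= s)%Z by apply: le_IZR; lra.
    have a1 := nsh x i s sp; have a2 := nsh x j s sp; have a3 := nsh (sh i s x) j s sp.
    have w1 := Hw x ltac:(lra); have w2 := Hw (sh i s x) ltac:(lra).
    have w3 := Hw (sh j s x) ltac:(lra); have w4 := Hw (sh j s (sh i s x)) ltac:(lra).
    by rewrite /df2 /df; move: w1 w2 w3 w4; split_Rabs; lra.
  have qn : b * q ^ n <= 8 * C0 * (M + Phi) / (rad * rad).
    have -> : b * q ^ n = 8 * C0 * (M + Phi) / (rad * rad) * (e * q ^ n) by rewrite /b; field; lra.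
    rewrite -[X in _ <= X]Rmult_1_r; apply: Rmult_le_compat_l.
      by positivity.
    rewrite -ez -/s.
    have <- : Rpower 1 al = 1 by rewrite /Rpower ln_1 Rmult_0_r exp_0.
    apply: Rle_Rpower_l; first lra.
    split; first by positivity.
    apply: (Rmult_le_reg_r rad) => //; have -> : IZR s / rad * rad = IZR s by field; lra.
    lra.
  have D2s : Rabs (df2 i j s w x / (IZR s * IZR s)) <= 64 * (l0 * l0) * M / (rad * rad).
    have is2 : 0 < / (IZR s * IZR s) by positivity.
    rewrite /Rdiv Rabs_mult (Rabs_pos_eq (/ _)); last lra.
    apply: (Rle_trans _ (4 * M * / (IZR s * IZR s))); first by apply: Rmult_le_compat_r; lra.
    have -> : 64 * (l0 * l0) * M * / (rad * rad) = 4 * M * / (rad / (4 * l0) * (rad / (4 * l0))) by field; lra.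
    apply: Rmult_le_compat_l; first lra.
    have hv : 0 < rad / (4 * l0) by positivity.
    have hv2 : rad / (4 * l0) <= IZR s.
      have -> : rad / (4 * l0) = rad / (2 * l0) / 2 by field; lra.
      lra.
    by apply: Rinv_le_contravar; [nra|apply: Rmult_le_compat; lra].
  have hfin : Rabs (df2 i j 1 w x) <= 64 * (l0 * l0) * M / (rad * rad) + 8 * C0 * (M + Phi) / (rad * rad) / (q - 1).
    have := Rmult_le_compat_r _ _ _ (Rlt_le _ _ iq) qn; rewrite -/(Rdiv _ (q - 1)) => h.
    rewrite -/(Rdiv _ (q - 1)) in h.
    by move: ht D2s; split_Rabs; lra.
  apply: Rle_trans hfin _.
  have -> : 64 * (l0 * l0) * M / (rad * rad) + 8 * C0 * (M + Phi) / (rad * rad) / (q - 1) =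
    (64 * (l0 * l0) * M + 8 * C0 / (q - 1) * (M + Phi)) / (rad * rad) by field; lra.
  apply: Rmult_le_compat_r; first lra.
  rewrite /C; have : 0 <= 2 * B' / (q - 1) * (M + Phi) by positivity.
  have : 0 <= 64 * (l0 * l0) * Phi by positivity.
  lra.
move=> k s hs hsl.
(* Two telescoping errors, one at each end of the step, plus one third difference at scale [2^m]. *)
set b' := 2 * (b / (q - 1)) + b.
have b'0 : 0 <= b' by have := Rmult_le_pos _ _ b0 (Rlt_le _ _ iq); rewrite /b' /Rdiv; lra.
have dy y m : n1 z y <= rad / 8 -> l0 * IZR (z2 m) <= rad / 2 ->
   Rabs (df k (z2 m) (df2 i j 1 w) y) <= b' * q ^ m.
  move=> hy hm.
  have hsm := small m _ hm.
  have h1 := tele y i j m ltac:(lra) hm.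
  have h2 := tele (sh k (z2 m) y) i j m ltac:(have := nsh y k (z2 m) ltac:(move: (z2_ge1 m); lia); lra) hm.
  have h3 := T3 y k i j m ltac:(lra) hm.
  set s' := z2 m in h1 h2 h3 *.
  have s0 : 0 < IZR s' by apply: z2lt.
  have is2 : 0 < / (IZR s' * IZR s') by positivity.
  have {}h3 : Rabs ((df2 i j s' w (sh k s' y) - df2 i j s' w y) * / (IZR s' * IZR s')) <= b * q ^ m.
    rewrite Rabs_mult (Rabs_pos_eq (/ _)); last lra.
    apply: (Rmult_le_reg_r (IZR s' * IZR s')); first nra.
    rewrite Rmult_assoc Rinv_l ?Rmult_1_r; last nra.
    exact: h3.
  have -> : b' * q ^ m = 2 * (b * q ^ m / (q - 1)) + b * q ^ m by rewrite /b'; field; lra.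
  rewrite /df; move: h1 h2 h3; rewrite /Rdiv Rmult_minus_distr_r.
  by split_Rabs; lra.
have [n [hn1 hn2]] := z2_log s hs.
have hn3 : IZR (z2 n.+1) <= 2 * IZR s.
  by rewrite z2_S plus_IZR; have := IZR_le _ _ hn1; lra.
have nsmall : IZR (z2 n.+1) <= rad / 16.
  by have s0 : 1 <= IZR s := IZR_le _ _ hs; nra.
have H := dyadic_sum (fun t => df2 i j 1 w (sh k t x)) b' q n.+1 b'0 Hq.
have {H} H : Rabs (df2 i j 1 w (sh k s x) - df2 i j 1 w (sh k 0 x)) <= b' * q ^ n.+1 / (q - 1).
  apply: H; last lia.
  move=> m t ht0 htm.
  have -> : sh k (t + z2 m) x = sh k (z2 m) (sh k t x) by rewrite sh_add Z.add_comm.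
  have htR : IZR t + IZR (z2 m) <= IZR (z2 n.+1) by rewrite -plus_IZR; apply: IZR_le.
  have zm := z2lt m; have t0 : 0 <= IZR t by apply: IZR_le.
  apply: dy; first by have := nsh x k t ht0; lra.
  have : l0 * IZR (z2 m) <= l0 * (2 * IZR s) by apply: Rmult_le_compat_l; lra.
  lra.
rewrite /df; rewrite sh_0 in H; apply: Rle_trans H _.
have hq1 : b' * q ^ n.+1 / (q - 1) = B' * (M + Phi) / (rad * rad) / (q - 1) * (e * q ^ n.+1).
  by rewrite /b' /B' /b; field; lra.
rewrite hq1 -ez.
have hp : Rpower (IZR (z2 n.+1) / rad) al <= 2 * Rpower (IZR s / rad) al.
  have sR : 0 < IZR s by apply: (IZR_lt 0); lia.
  apply: (Rle_trans _ (Rpower (2 * (IZR s / rad)) al)).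
    apply: Rle_Rpower_l; first lra.
    split; first by apply: Rdiv_lt_0_compat.
    have -> : 2 * (IZR s / rad) = (2 * IZR s) / rad by field; lra.
    by apply: Rmult_le_compat_r => //; apply: Rlt_le; apply: Rinv_0_lt_compat.
  have sr : 0 < IZR s / rad by positivity.
  rewrite -Rpower_mult_distr // -/q; last lra.
  by apply: Rmult_le_compat_r => //; apply: Rlt_le; apply: Rpower_pos.
have X0 : 0 <= B' * (M + Phi) / (rad * rad) / (q - 1) by positivity.
apply: Rle_trans (Rmult_le_compat_l _ _ _ X0 hp) _.
set P := Rpower _ al; have P0 : 0 < P by apply: Rpower_pos.
have -> : B' * (M + Phi) / (rad * rad) / (q - 1) * (2 * P) = (2 * B' / (q - 1)) * ((M + Phi) * P / (rad * rad)).
  by field; lra.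
have -> : C * (M + Phi) * P / (rad * rad) = C * ((M + Phi) * P / (rad * rad)) by field; lra.
apply: Rmult_le_compat_r; last by rewrite /C; lra.
by positivity.
Qed.
End SecondHoelder.

(** * Interior estimates for the upwind scheme *)

Lemma Rdiv_mulK a b : 0 < b -> a / b * b = a.
Proof. by move=> h; field; lra. Qed.

Lemma Rpower_anti x b b' : 0 < x <= 1 -> b <= b' -> Rpower x b' <= Rpower x b.
Proof.
move=> hx hb; have hl : ln x <= 0 by rewrite -ln_1; case: (Req_dec x 1) => [->|ne]; [lra|apply: Rlt_le; apply: ln_increasing; lra].
rewrite /Rpower; have : b' * ln x <= b * ln x by nra.
by case: (Req_dec (b' * ln x) (b * ln x)) => [->|ne h]; [lra|apply: Rlt_le; apply: exp_increasing; lra].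
Qed.

Lemma Rpower_ge_id x b : 0 < x <= 1 -> b <= 1 -> x <= Rpower x b.
Proof. by move=> hx hb; rewrite -[X in X <= _](Rpower_1 x); [apply: Rpower_anti|lra]. Qed.

Lemma Rabs_mul_sub p q p' q' P Q dP dQ : Rabs p <= P -> Rabs q' <= Q ->
  Rabs (p - p') <= dP -> Rabs (q - q') <= dQ -> Rabs (p * q - p' * q') <= P * dQ + dP * Q.
Proof.
move=> h1 h2 h3 h4.
have -> : p * q - p' * q' = p * (q - q') + (p - p') * q' by ring.
apply: Rle_trans (Rabs_triang _ _) _; rewrite !Rabs_mult.
by apply: Rplus_le_compat; apply: Rmult_le_compat => //; apply: Rabs_pos.
Qed.

(* In lattice units: [rad] is the radius of the ball divided by the mesh size,
   and the right-hand side [a] carries the factor [rad ^ 2] for scaling. *)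
Definition dsol {N} (al m Mx A Cc H rad : R) (z : lat N) (u a c : lat N -> R) : Prop :=
  forall x, n1 z x <= rad ->
    [/\ m <= u x <= Mx, 0 <= a x <= A, 0 <= c x <= Cc,
        lap u x = c x / u x * upg u x - a x / (rad * rad) &
        forall i s, (1 <= s)%Z -> n1 z x + IZR s <= rad ->
          Rabs (df i s a x) <= H * Rpower (IZR s / rad) al /\
          Rabs (df i s c x) <= H * Rpower (IZR s / rad) al].

Lemma upgE {N} (u : lat N -> R) x : upg u x =
  \sum_(i < N) (pos (- df i 1 u x) * pos (- df i 1 u x) +
                pos (df i 1 u (sh i (-1) x)) * pos (df i 1 u (sh i (-1) x))).
Proof.
apply: sum_ext => i; rewrite /df sh_add Z.add_opp_diag_r sh_0.
by have -> : - (u (sh i 1 x) - u x) = u x - u (sh i 1 x) by ring.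
Qed.

Lemma n1_shp {N} (z x : lat N) k s : (0 <= s)%Z -> n1 z (sh k s x) <= n1 z x + IZR s.
Proof.
move=> hs; have := n1_sh_le z x k s; rewrite (Rabs_pos_eq (IZR s)); last exact: IZR_le.
by split_Rabs; lra.
Qed.

Lemma n1_shm {N} (z x : lat N) k : n1 z (sh k (-1) x) <= n1 z x + 1.
Proof.
have := n1_sh_le z x k (-1); rewrite -abs_IZR.
by have -> : Z.abs (-1) = 1%Z by []; split_Rabs; lra.
Qed.

Section RhsHoelder.
Context {N : nat} (al be m Mx A Cc H L1 F P eta : R).
Hypotheses (Hbe : 0 < be) (Hba : be <= al) (Hal : al < 1) (Hm : 0 < m).
Hypotheses (HCc : 0 <= Cc) (HH : 0 <= H) (HL1 : 0 <= L1) (HF : 0 <= F)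
  (HP : 0 <= P) (Heta : 0 < eta <= 1).

(** The right-hand side inherits the Hoelder exponent of the first differences: [a] and [c] are
    Hoelder continuous, [u] is Lipschitz and at least [m], and the squared positive part is locally
    Lipschitz. The exponent [be] is left free up to [al] because the bootstrap uses [al / 2] and
    then [al]. *)
Lemma rhs_hoelder : exists Phi, 0 <= Phi /\ forall rad z (u a c : lat N -> R) r1,
  0 < rad -> r1 <= rad -> dsol al m Mx A Cc H rad z u a c ->
  (forall x i, n1 z x <= r1 -> Rabs (df i 1 u x) <= L1 / rad) ->
  (forall x, n1 z x <= r1 -> Rabs (lap u x) <= F / (rad * rad)) ->
  (forall x i j s, (1 <= s)%Z -> IZR s <= eta * rad -> n1 z x + IZR s <= r1 ->
     Rabs (df j s (df i 1 u) x) <= P / rad * Rpower (IZR s / rad) be) ->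
  forall x j s, (1 <= s)%Z -> n1 z x + IZR s + 1 <= r1 ->
    Rabs (df j s (lap u) x) <= Phi * Rpower (IZR s / rad) be / (rad * rad).
Proof.
have HN := pos_INR N.
have im : 0 < / m by positivity.
set K1 := H / m + Cc * L1 / (m * m).
have HK1 : 0 <= K1.
  apply: Rplus_le_le_0_compat; apply: Rmult_le_pos; try lra; first nra.
  by positivity.
set Q0 := INR N * (2 * (L1 * L1)).
have HQ0 : 0 <= Q0 by apply: Rmult_le_pos => //; nra.
set Q1 := INR N * (4 * L1 * P).
have HQ1 : 0 <= Q1 by apply: Rmult_le_pos => //; nra.
have HCm : 0 <= Cc / m by positivity.
set Phi := Cc / m * Q1 + K1 * Q0 + H + 2 * F / eta.
have P1 : 0 <= Cc / m * Q1 by positivity.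
have P2 : 0 <= K1 * Q0 by positivity.
have P3 : 0 <= 2 * F / eta by positivity.
exists Phi; split; first by rewrite /Phi; lra.
move=> rad z u a c r1 Hrad Hr1 D HD HLap HP2 x j s Hs Hx.
have s1 : 1 <= IZR s by apply: IZR_le.
have n0 := n1_ge0 z x.
have sr : 0 < IZR s / rad <= 1.
  split; first by positivity.
  by apply: (Rmult_le_reg_r rad) => //; rewrite Rdiv_mulK //; lra.
set tau := Rpower (IZR s / rad) be.
have rr : 0 < rad * rad by nra.
have irr : 0 < / (rad * rad) by positivity.
have tau1 : IZR s / rad <= tau by apply: Rpower_ge_id => //; lra.
have tau2 : Rpower (IZR s / rad) al <= tau by apply: Rpower_anti.
set y := sh j s x.
have ny : n1 z y <= n1 z x + IZR s by apply: n1_shp; lia.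
(* For long steps [tau >= eta], and the bound on [lap u] at the two ends is enough. *)
case: (Rlt_le_dec (eta * rad) (IZR s)) => hse.
  have h1 := HLap x ltac:(lra); have h2 := HLap y ltac:(lra).
  apply: (Rle_trans _ (2 * (F / (rad * rad)))); first by apply: df_bound.
  have -> : 2 * (F / (rad * rad)) = 2 * F / (rad * rad) by field; lra.
  apply: Rmult_le_compat_r; first lra.
  apply: (Rle_trans _ (2 * F / eta * tau)); last by rewrite /Phi; nra.
  have : eta <= tau.
    apply: Rle_trans tau1; apply: (Rmult_le_reg_r rad) => //.
    by rewrite Rdiv_mulK //; lra.
  move=> h; apply: (Rle_trans _ (2 * F / eta * eta)); last exact: Rmult_le_compat_l.
  by rewrite Rdiv_mulK; lra.
have [ux ax cx ex Hac] := D x ltac:(lra).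
have [uy ay cy ey _] := D y ltac:(lra).
have [ha hc] := Hac j s Hs ltac:(lra).
rewrite /df -/y ex ey.
have dU : Rabs (u y - u x) <= L1 * tau.
  apply: (Rle_trans _ (IZR s * (L1 / rad))); last first.
    have -> : IZR s * (L1 / rad) = L1 * (IZR s / rad) by field; lra.
    by apply: Rmult_le_compat_l.
  apply: (df_steps j s u x (L1 / rad)); first lia.
  move=> t ht; apply: HD; have := n1_shp z x j t ltac:(lia).
  by have : IZR t <= IZR s := IZR_le t s ltac:(lia); lra.
have dkap : Rabs (c y / u y - c x / u x) <= K1 * tau.
  have -> : c y / u y - c x / u x = (c y - c x) / u y + - (c x * (u y - u x) / (u x * u y)) by field; lra.
  apply: Rle_trans (Rabs_triang _ _) _; rewrite Rabs_Ropp.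
  have iuy : 0 < / u y by positivity.
  have iuy' : / u y <= / m by apply: Rinv_le_contravar; lra.
  have e1 : Rabs ((c y - c x) / u y) <= H / m * tau.
    rewrite /Rdiv Rabs_mult (Rabs_pos_eq (/ _)); last lra.
    have -> : H * / m * tau = (H * tau) * / m by ring.
    apply: Rmult_le_compat => //; [exact: Rabs_pos|lra|].
    by apply: Rle_trans hc _; apply: Rmult_le_compat_l.
  have e2 : Rabs (c x * (u y - u x) / (u x * u y)) <= Cc * L1 / (m * m) * tau.
    have iuu : 0 < / (u x * u y) by positivity.
    have iuu' : / (u x * u y) <= / (m * m) by apply: Rinv_le_contravar; [nra|apply: Rmult_le_compat; lra].
    rewrite /Rdiv Rabs_mult (Rabs_pos_eq (/ _)); last lra.
    have -> : Cc * L1 * / (m * m) * tau = (Cc * (L1 * tau)) * / (m * m) by ring.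
    apply: Rmult_le_compat => //; [exact: Rabs_pos|lra|].
    rewrite Rabs_mult; apply: Rmult_le_compat => //; try exact: Rabs_pos.
    by rewrite Rabs_pos_eq; lra.
  by rewrite /K1; lra.
have Qb p : n1 z p + 1 <= r1 -> Rabs (upg u p) <= Q0 / (rad * rad).
  move=> hp; rewrite upgE.
  have -> : Q0 / (rad * rad) = INR N * (2 * ((L1 / rad) * (L1 / rad))) by rewrite /Q0; field; lra.
  have L0 : 0 <= L1 / rad by apply: Rle_trans (HD p j ltac:(lra)); apply: Rabs_pos.
  apply: sum_abs_le_const => i.
  have g1 := pos_sq_le (- df i 1 u p) (L1 / rad) ltac:(have := HD p i ltac:(lra); split_Rabs; lra) L0.
  have hm := n1_shm z p i.
  have g2 := pos_sq_le (df i 1 u (sh i (-1) p)) (L1 / rad) ltac:(have := HD (sh i (-1) p) i ltac:(lra); split_Rabs; lra) L0.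
  rewrite Rabs_pos_eq; first lra.
  by apply: Rplus_le_le_0_compat; apply: Rle_0_sqr.
have dQ : Rabs (upg u y - upg u x) <= Q1 * tau / (rad * rad).
  rewrite !upgE -sum_sub.
  have -> : Q1 * tau / (rad * rad) = INR N * (2 * (2 * (L1 / rad) * (P / rad * tau))) by rewrite /Q1; field; lra.
  apply: sum_abs_le_const => i.
  have hx1 := n1_shm z x i; have hy1 := n1_shm z y i.
  have dj p : n1 z p + IZR s <= r1 -> Rabs (df i 1 u (sh j s p) - df i 1 u p) <= P / rad * tau.
    by move=> hp; apply: HP2.
  have g1 := pos_sq_lip (- df i 1 u y) (- df i 1 u x) (L1 / rad)
     ltac:(rewrite Rabs_Ropp; apply: HD; lra) ltac:(rewrite Rabs_Ropp; apply: HD; lra).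
  have g2 := pos_sq_lip (df i 1 u (sh i (-1) y)) (df i 1 u (sh i (-1) x)) (L1 / rad)
     ltac:(apply: HD; lra) ltac:(apply: HD; lra).
  have d1 := dj x ltac:(lra); have d2 := dj (sh i (-1) x) ltac:(lra).
  rewrite -/y in d1; rewrite (sh_comm j i) -/y in d2.
  have L0 : 0 <= L1 / rad by apply: Rle_trans (HD x j ltac:(lra)); apply: Rabs_pos.
  have e1 : Rabs (- df i 1 u y - - df i 1 u x) = Rabs (df i 1 u y - df i 1 u x).
    by rewrite -Rabs_Ropp; congr Rabs; ring.
  rewrite e1 in g1.
  have := Rmult_le_compat_l (2 * (L1 / rad)) _ _ ltac:(lra) d1.
  have := Rmult_le_compat_l (2 * (L1 / rad)) _ _ ltac:(lra) d2.
  have T p p' t t' : Rabs (p + t - (p' + t')) <= Rabs (p - p') + Rabs (t - t').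
    by have -> : p + t - (p' + t') = p - p' + (t - t') by [ring]; apply: Rabs_triang.
  by move=> m1 m2; apply: Rle_trans (T _ _ _ _) _; lra.
have kb : Rabs (c y / u y) <= Cc / m.
  have iuy : 0 < / u y by positivity.
  rewrite Rabs_pos_eq; last by positivity.
  by apply: Rmult_le_compat; try lra; apply: Rinv_le_contravar; lra.
have M := Rabs_mul_sub _ _ _ _ _ _ _ _ kb (Qb x ltac:(lra)) dkap dQ.
have -> : c y / u y * upg u y - a y / (rad * rad) - (c x / u x * upg u x - a x / (rad * rad)) =
  (c y / u y * upg u y - c x / u x * upg u x) + - ((a y - a x) * / (rad * rad)) by field; lra.
apply: Rle_trans (Rabs_triang _ _) _; rewrite Rabs_Ropp Rabs_mult (Rabs_pos_eq (/ _)); last lra.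
have ha' : Rabs (a y - a x) * / (rad * rad) <= H * tau * / (rad * rad).
  apply: Rmult_le_compat_r; first lra.
  by apply: Rle_trans ha _; apply: Rmult_le_compat_l.
have -> : Phi * tau / (rad * rad) = Cc / m * (Q1 * tau / (rad * rad)) + K1 * tau * (Q0 / (rad * rad)) +
   H * tau * / (rad * rad) + 2 * F / eta * (tau * / (rad * rad)) by rewrite /Phi; field; lra.
have : 0 <= 2 * F / eta * (tau * / (rad * rad)) by positivity.
lra.
Qed.
End RhsHoelder.

(** [grad_est] for the increment [df j s u], which is at most [s L1 / rad] with Laplacian at most
    [2 F / rad^2]. On a cube of half-side [d] this gives [s / (rad d) + d / rad^2] up to constants,
    and [d = sqrt (s rad)] balances the two terms, hence the exponent 1/2. *)
Lemma first_hoelder {N} (L1 F : R) : 0 <= L1 -> 0 <= F -> exists P eta, 0 <= P /\ 0 < eta <= 1 /\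
  forall rad z (u : lat N -> R), 1 <= rad ->
  (forall x i, n1 z x <= rad / 2 -> Rabs (df i 1 u x) <= L1 / rad) ->
  (forall x, n1 z x <= rad / 2 -> Rabs (lap u x) <= F / (rad * rad)) ->
  forall x i j s, (1 <= s)%Z -> IZR s <= eta * rad -> n1 z x + IZR s <= rad / 4 ->
    Rabs (df i 1 (df j s u) x) <= P / rad * Rpower (IZR s / rad) (/ 2).
Proof.
move=> HL HF; have HN := pos_INR N.
set C0 := 4 + 3 * INR N.
set e := / (16 * (INR N + 1)).
have He : 0 < e by apply: Rinv_0_lt_compat; lra.
have HeN : e * (INR N + 1) = / 16 by rewrite /e; field; lra.
exists (C0 * (L1 + 4 * F)), (e * e).
split; first by apply: Rmult_le_pos; rewrite /C0; lra.
split; first by nra.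
move=> rad z u Hrad HD HLap x i j s Hs Hse Hx.
have s1 : 1 <= IZR s by apply: IZR_le.
have sr : 0 < IZR s / rad by positivity.
have rr : 0 < rad * rad by nra.
rewrite Rpower_sqrt //; set q := sqrt (IZR s / rad).
have q0 : 0 < q by apply: sqrt_lt_R0.
have qq : q * q = IZR s / rad by apply: sqrt_sqrt; lra.
have sE : IZR s = q * q * rad by rewrite qq Rdiv_mulK; lra.
have qr1 : 1 <= q * rad.
  by apply: Rsqr_incr_0; rewrite /Rsqr; nra.
set d := up (q * rad); have [d1 d2] := archimed (q * rad); rewrite -/d in d1 d2.
have Hd : (1 <= d)%Z by apply: le_IZR; lra.
have box y : (forall k, (Z.abs (y k - x k) <= d)%Z) -> n1 z y + IZR s <= rad / 2.
  move=> hb; have h1 : n1 x y <= INR N * IZR d.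
    by apply: n1_box => k; rewrite -abs_IZR; apply: IZR_le.
  have h2 := n1_tri z x y.
  have h3 : INR N * IZR d <= INR N * (2 * (e * rad)).
    by apply: Rmult_le_compat_l => //; nra.
  have h4 : INR N * (2 * (e * rad)) = 2 * (e * (INR N + 1)) * rad - 2 * (e * rad) by ring.
  rewrite HeN in h4.
  have : 0 < e * rad by positivity.
  lra.
have := grad_est (df j s u) x i d (IZR s * (L1 / rad)) (2 * (F / (rad * rad))) Hd.
rewrite -/C0 => G; apply: Rle_trans (G _ _ _ _) _.
- by positivity.
- by positivity.
- move=> y /box hy; apply: df_steps; first lia.
  move=> t ht; apply: HD; have := n1_shp z y j t ltac:(lia).
  by have : IZR t <= IZR s := IZR_le t s ltac:(lia); lra.
- move=> y /box hy; rewrite lap_df; apply: df_bound; apply: HLap; last by lra.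
  by have := n1_shp z y j s ltac:(lia); lra.
have -> : C0 * (L1 + 4 * F) / rad * q = C0 * (L1 / rad * q + 4 * F * q / rad) by field; lra.
apply: Rmult_le_compat_l; first by rewrite /C0; lra.
have LR : 0 <= L1 / rad by positivity.
have FR : 0 <= F / (rad * rad) by positivity.
apply: Rplus_le_compat.
  have -> : IZR s * (L1 / rad) / IZR d = L1 / rad * (IZR s / IZR d) by field; lra.
  apply: Rmult_le_compat_l => //; apply: (Rmult_le_reg_r (IZR d)); first lra.
  by rewrite Rdiv_mulK ?sE; nra.
have -> : 4 * F * q / rad = 2 * (F / (rad * rad)) * (2 * (q * rad)) by field; lra.
by apply: Rmult_le_compat_l; lra.
Qed.

Section Interior.
Context {N : nat} (al m Mx A Cc H : R).
Hypotheses (Hal : 0 < al < 1) (Hm : 0 < m) (HMx : 0 < Mx) (HA : 0 <= A) (HCc : 0 <= Cc) (HH : 0 <= H).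

(** A bootstrap on shrinking balls: Lipschitz bound, bounded Laplacian, Hoelder first differences,
    Hoelder Laplacian, bounded second differences; a second round raises the exponent to [al]. The
    lower bound [m] on [u] enters at once, through [c / u <= Cc / m] in [lipschitz_est]. *)
Lemma interior_est : exists eta C R0, 0 < eta <= 1 /\ 0 < C /\ 0 < R0 /\
  forall rad z (u a c : lat N -> R), R0 <= rad -> dsol al m Mx A Cc H rad z u a c ->
  forall x, n1 z x <= eta * rad -> forall i j,
    [/\ Rabs (df i 1 u x) <= C / rad, Rabs (df2 i j 1 u x) <= C / (rad * rad) &
        forall k s, (1 <= s)%Z -> IZR s <= eta * rad ->
          Rabs (df k s (df2 i j 1 u) x) <= C * Rpower (IZR s / rad) al / (rad * rad)].
Proof.
have HN := pos_INR N.
have im : 0 < / m by positivity.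
have HCm : 0 <= Cc / m by positivity.
have [L [Rl [HL [HRl lip]]]] := lipschitz_est N A (Cc / m) Mx HA HCm HMx.
set L1 := 2 * L.
have HL1 : 0 <= L1 by rewrite /L1; lra.
set F := Cc / m * (INR N * (2 * (L1 * L1))) + A.
have HF : 0 <= F.
  by apply: Rplus_le_le_0_compat => //; apply: Rmult_le_pos => //; apply: Rmult_le_pos => //; nra.
have [P1 [eta1 [HP1 [Heta1 hoel1]]]] := @first_hoelder N L1 F HL1 HF.
set be := al / 2.
have Hbe : 0 < be < 1 by rewrite /be; lra.
have [Ph1 [HPh1 rhs1]] := @rhs_hoelder N al be m Mx A Cc H L1 F P1 eta1 ltac:(lra) ltac:(rewrite /be; lra)
   ltac:(lra) Hm HCc HH HL1 HF HP1 Heta1.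
have [l1 [C1 [Hl1 [HC1 sd1]]]] := @second_diff N be Hbe.
set P2 := C1 * (Mx + Ph1) * 64.
have HP2 : 0 <= P2 by apply: Rmult_le_pos; [apply: Rmult_le_pos; lra|lra].
have [Ph2 [HPh2 rhs2]] := @rhs_hoelder N al al m Mx A Cc H L1 F P2 1 ltac:(lra) ltac:(lra)
   ltac:(lra) Hm HCc HH HL1 HF HP2 ltac:(lra).
have [l2 [C2 [Hl2 [HC2 sd2]]]] := @second_diff N al Hal.
set C3 := C2 * (Mx + Ph2) * 8 * (512 * 512 * 512).
(* [8192] is 16 times 512: the last application of [second_diff] is on the ball of radius
   [rad / 512], of which it controls a sixteenth. The factor [l2] keeps the steps admissible. *)
set eta := / (8192 * l2).
have Heta : 0 < eta by apply: Rinv_0_lt_compat; lra.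
have Hetal : eta * l2 = / 8192 by rewrite /eta; field; lra.
have Heta' : eta <= / 8192 by nra.
have HC3 : 0 <= C3 by do 2 (apply: Rmult_le_pos; last lra); apply: Rmult_le_pos; lra.
exists eta, (L1 + C3 + 1), (2 * Rl + 64 * l1 + 4096 * l2 + 4096).
split; first lra; split; first lra; split; first lra.
move=> rad z u a c Hrad D.
have r0 : 1 <= rad by lra.
have rr : 0 < rad * rad by nra.
have irr : 0 < / (rad * rad) by positivity.
have low x : n1 z x <= rad -> - (A / (rad * rad)) <= lap u x <= Cc / m * upg u x.
  move=> hx; have [hu ha hc he _] := D x hx.
  have ug : 0 <= upg u x by apply: sum_ge0 => i; apply: Rplus_le_le_0_compat; apply: Rle_0_sqr.
  have iu : 0 < / u x by positivity.
  have cu : 0 <= c x / u x <= Cc / m.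
    split; first by positivity.
    by apply: Rmult_le_compat; try lra; apply: Rinv_le_contravar; lra.
  have aa : 0 <= a x / (rad * rad) <= A / (rad * rad).
    split; first by positivity.
    by apply: Rmult_le_compat_r; lra.
  rewrite he; split.
    by have := Rmult_le_pos _ _ cu.1 ug; lra.
  by have := Rmult_le_compat_r _ _ _ ug cu.2; lra.
have lipx x i s : n1 z x <= rad / 2 -> Z.abs s = 1%Z -> Rabs (u (sh i s x) - u x) <= L1 / rad.
  move=> hx hs.
  have inb y : n1 x y <= rad / 2 -> n1 z y <= rad by have := n1_tri z x y; lra.
  have -> : L1 / rad = L / (rad / 2) by rewrite /L1; field; lra.
  apply: (lip (rad / 2) u x) => //; first lra.
    by move=> y /inb hy; have [] := D y hy => *; lra.
  move=> y /inb hy; have [h1 h2] := low y hy; split=> //.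
  apply: Rle_trans h1; apply: Ropp_le_contravar; apply: Rmult_le_compat_l => //.
  by apply: Rinv_le_contravar; nra.
have D1 x i : n1 z x <= rad / 2 -> Rabs (df i 1 u x) <= L1 / rad by move=> hx; apply: lipx.
have LapF x : n1 z x <= rad / 2 -> Rabs (lap u x) <= F / (rad * rad).
  move=> hx; have [h1 h2] := low x ltac:(lra).
  have L0 : 0 <= L1 / rad by positivity.
  have ub : upg u x <= INR N * (2 * ((L1 / rad) * (L1 / rad))).
    apply: sum_le_const => i.
    have g1 := lipx x i 1%Z hx erefl; have g2 := lipx x i (-1)%Z hx erefl.
    have := pos_sq_le (u x - u (sh i 1 x)) (L1 / rad) ltac:(split_Rabs; lra) L0.
    have := pos_sq_le (u x - u (sh i (-1) x)) (L1 / rad) ltac:(split_Rabs; lra) L0.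
    lra.
  have e1 : F / (rad * rad) = Cc / m * (INR N * (2 * ((L1 / rad) * (L1 / rad)))) + A / (rad * rad).
    by rewrite /F; field; lra.
  have := Rmult_le_compat_l _ _ _ HCm ub => h3.
  have u0 : 0 <= Cc / m * (INR N * (2 * ((L1 / rad) * (L1 / rad)))) by positivity.
  have A0 : 0 <= A / (rad * rad) by positivity.
  by rewrite e1; apply: Rabs_le; lra.
have Hu x : n1 z x <= rad -> Rabs (u x) <= Mx.
  by move=> hx; have [hu _ _ _ _] := D x hx; rewrite Rabs_pos_eq; lra.
(* First pass with exponent al / 2, since [first_hoelder] only gives exponent 1 / 2. *)
have srle s : (1 <= s)%Z -> IZR s <= rad -> 0 < IZR s / rad <= 1.
  move=> hs h; have s1 : 1 <= IZR s by apply: IZR_le.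
  split; first by positivity.
  by apply: (Rmult_le_reg_r rad); [lra|rewrite Rdiv_mulK; lra].
have H1 x i j s : (1 <= s)%Z -> IZR s <= eta1 * rad -> n1 z x + IZR s <= rad / 4 ->
    Rabs (df j s (df i 1 u) x) <= P1 / rad * Rpower (IZR s / rad) be.
  move=> hs hse hx; rewrite df_comm; apply: Rle_trans (hoel1 rad z u r0 D1 LapF x i j s hs hse hx) _.
  apply: Rmult_le_compat_l; first by positivity.
  apply: Rpower_anti; last by rewrite /be; lra.
  by apply: srle => //; have := n1_ge0 z x; lra.
have F1 := rhs1 rad z u a c (rad / 4) ltac:(lra) ltac:(lra) D
   (fun x i hx => D1 x i ltac:(lra)) (fun x hx => LapF x ltac:(lra)) H1.
have B2 x i j : n1 z x <= rad / 128 -> Rabs (df2 i j 1 u x) <= P2 / (rad * rad).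
  move=> hx.
  have G1 y : n1 z y <= rad / 8 -> Rabs (u y) <= Mx by move=> hy; apply: Hu; lra.
  have G2 y k s : (1 <= s)%Z -> l1 * IZR s <= rad / 8 - n1 z y ->
     Rabs (df k s (lap u) y) <= Ph1 * Rpower (IZR s / (rad / 8)) be / (rad / 8 * (rad / 8)).
    move=> hs hsy; have s1 : 1 <= IZR s by apply: IZR_le.
    have hy := n1_ge0 z y.
    apply: Rle_trans (F1 y k s hs ltac:(nra)) _.
    have sr : 0 < IZR s / rad by positivity.
    apply: Rmult_le_compat.
    + by positivity.
    + lra.
    + apply: Rmult_le_compat_l => //; apply: Rle_Rpower_l; first lra.
      by split=> //; apply: Rmult_le_compat_l; [lra|apply: Rinv_le_contravar; lra].
    + by apply: Rinv_le_contravar; nra.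
  have [hb _] := sd1 (rad / 8) u z Mx Ph1 ltac:(lra) ltac:(lra) HPh1 G1 G2 x ltac:(lra) i j.
  by apply: Rle_trans hb _; apply: Req_le; rewrite /P2; field; lra.
(* Second pass: second differences are now bounded, so first differences are Lipschitz. *)
have H2 x i j s : (1 <= s)%Z -> IZR s <= 1 * rad -> n1 z x + IZR s <= rad / 128 ->
    Rabs (df j s (df i 1 u) x) <= P2 / rad * Rpower (IZR s / rad) al.
  move=> hs hse hx.
  have h1 : Rabs (df j s (df i 1 u) x) <= IZR s * (P2 / (rad * rad)).
    apply: df_steps; first lia.
    move=> t ht; apply: (B2 _ j i); have := n1_shp z x j t ltac:(lia).
    by have : IZR t <= IZR s := IZR_le t s ltac:(lia); lra.
  apply: Rle_trans h1 _.
  have -> : IZR s * (P2 / (rad * rad)) = P2 / rad * (IZR s / rad) by field; lra.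
  apply: Rmult_le_compat_l; first by positivity.
  by apply: Rpower_ge_id; [apply: srle => //; lra|lra].
have F2 := rhs2 rad z u a c (rad / 128) ltac:(lra) ltac:(lra) D
   (fun x i hx => D1 x i ltac:(lra)) (fun x hx => LapF x ltac:(lra)) H2.
move=> x hx i j.
have hxe : n1 z x <= rad / 512 / 16 by nra.
have G1 y : n1 z y <= rad / 512 -> Rabs (u y) <= Mx by move=> hy; apply: Hu; lra.
have G2 y k s : (1 <= s)%Z -> l2 * IZR s <= rad / 512 - n1 z y ->
   Rabs (df k s (lap u) y) <= Ph2 * Rpower (IZR s / (rad / 512)) al / (rad / 512 * (rad / 512)).
  move=> hs hsy; have s1 : 1 <= IZR s by apply: IZR_le.
  apply: Rle_trans (F2 y k s hs ltac:(nra)) _.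
  have sr : 0 < IZR s / rad by positivity.
  apply: Rmult_le_compat.
  + by positivity.
  + lra.
  + apply: Rmult_le_compat_l => //; apply: Rle_Rpower_l; first lra.
    by split=> //; apply: Rmult_le_compat_l; [lra|apply: Rinv_le_contravar; lra].
  + by apply: Rinv_le_contravar; nra.
have [hb hc] := sd2 (rad / 512) u z Mx Ph2 ltac:(lra) ltac:(lra) HPh2 G1 G2 x hxe i j.
have K0 : 0 <= C2 * (Mx + Ph2) by positivity.
split.
- apply: Rle_trans (D1 x i ltac:(nra)) _; apply: Rmult_le_compat_r; last lra.
  by positivity.
- apply: Rle_trans hb _.
  have -> : C2 * (Mx + Ph2) / (rad / 512 * (rad / 512)) = C2 * (Mx + Ph2) * (512 * 512) / (rad * rad) by field; lra.
  by apply: Rmult_le_compat_r; [lra|rewrite /C3; lra].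
move=> k s hs hse; have s1 : 1 <= IZR s by apply: IZR_le.
apply: Rle_trans (hc k s hs _) _.
  have : 8 * l2 * IZR s <= 8 * l2 * (eta * rad) by apply: Rmult_le_compat_l; lra.
  have -> : 8 * l2 * (eta * rad) = 8 * (eta * l2) * rad by ring.
  by rewrite Hetal; lra.
have sr : 0 < IZR s / rad by positivity.
have pw : Rpower (IZR s / (rad / 512)) al <= 512 * Rpower (IZR s / rad) al.
  have -> : IZR s / (rad / 512) = 512 * (IZR s / rad) by field; lra.
  rewrite -Rpower_mult_distr //; last lra.
  apply: Rmult_le_compat_r; first by positivity.
  by rewrite -[X in _ <= X](Rpower_1 512); [apply: Rle_Rpower; lra|lra].
set p := Rpower (IZR s / rad) al in pw *.
have p0 : 0 < p by apply: Rpower_pos.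
apply: (Rle_trans _ (C2 * (Mx + Ph2) * (512 * p) / (rad / 512 * (rad / 512)))).
  apply: Rmult_le_compat_r; first by positivity.
  by apply: Rmult_le_compat_l.
have -> : C2 * (Mx + Ph2) * (512 * p) / (rad / 512 * (rad / 512)) = (C2 * (Mx + Ph2) * (512 * 512 * 512)) * p / (rad * rad) by field; lra.
apply: Rmult_le_compat_r; first lra.
apply: Rmult_le_compat_r; first lra.
rewrite /C3; lra.
Qed.
End Interior.

(** * Solvability and comparison for the upwind scheme *)

Lemma continuity_pt_eq f g t : (forall x, f x = g x) -> continuity_pt f t -> continuity_pt g t.
Proof. by move=> /functional_extensionality ->. Qed.

Lemma continuity_sum (N : nat) (f : 'I_N -> R -> R) : (forall i, continuity (f i)) ->
  continuity (fun t => \sum_(i < N) f i t).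
Proof.
move=> H t; have : forall s : seq 'I_N, continuity_pt (fun t => \big[Rplus/0]_(i <- s) f i t) t.
  elim=> [|i s IH].
    apply: (continuity_pt_eq (fun=> 0)); first by move=> x; rewrite big_nil.
    by apply: continuity_pt_const => ? ?.
  apply: (continuity_pt_eq (fun x => f i x + \big[Rplus/0]_(j <- s) f j x)).
    by move=> x; rewrite big_cons.
  by apply: continuity_pt_plus; [apply: H|apply: IH].
by move=> h; apply: h.
Qed.

Lemma continuity_pos_sq y : continuity (fun t => pos (t - y) * pos (t - y)).
Proof.
have H : continuity (fun t => / 2 * (Rabs (t - y) + (t - y))).
  by move=> t; reg; apply: Rcontinuity_abs.
have E t : / 2 * (Rabs (t - y) + (t - y)) = pos (t - y).
  by rewrite /pos /Rmax; case: Rle_dec => h; split_Rabs; lra.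
move=> t; apply: (continuity_pt_eq (fun t => / 2 * (Rabs (t - y) + (t - y)) * (/ 2 * (Rabs (t - y) + (t - y))))).
  by move=> x; rewrite E.
by apply: continuity_pt_mult; apply: H.
Qed.

(* The monotonicity of the upwind scheme in the central value. *)
Lemma upwind_mono c t t' y : 0 <= c -> 0 <= y -> 0 < t' -> t' <= t ->
  t - t' <= (t - y + c * (pos (t - y) * pos (t - y)) / t) - (t' - y + c * (pos (t' - y) * pos (t' - y)) / t').
Proof.
move=> hc hy ht' htt.
have key : pos (t' - y) * pos (t' - y) / t' <= pos (t - y) * pos (t - y) / t.
  case: (Rle_lt_dec t' y) => h.
    rewrite (pos_0 (t' - y)) ?Rmult_0_l; last lra.
    by rewrite /Rdiv Rmult_0_l; positivity.
  rewrite !pos_id; [|lra|lra].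
  have e : (t - y) * (t - y) / t - (t' - y) * (t' - y) / t' = (t - t') * (t * t' - y * y) * / (t * t') by field; lra.
  have : 0 <= (t - t') * (t * t' - y * y) * / (t * t').
    apply: Rmult_le_pos; last by positivity.
    by apply: Rmult_le_pos; nra.
  lra.
have := Rmult_le_compat_l _ _ _ hc key; rewrite /Rdiv -!Rmult_assoc; lra.
Qed.

Section Existence.
Context {N : nat} (HN : (0 < N)%nat) (D : lat N -> Prop) (b c U : lat N -> R).
Hypothesis Hb : forall k, D k -> 0 < b k.
Hypothesis Hc : forall k, D k -> 0 <= c k.
Hypothesis HU : forall k, D k -> 0 < U k.
Hypothesis HU1 : forall k i, D k -> 0 <= U (sh i 1 k) /\ 0 <= U (sh i (-1) k).
Hypothesis HUl : forall k, D k -> lap U k <= - b k.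

Let Esum (u : lat N -> R) k t := \sum_(i < N) ((t - u (sh i 1 k)) + (t - u (sh i (-1) k))).
Let Qsum (u : lat N -> R) k t := \sum_(i < N) (pos (t - u (sh i 1 k)) * pos (t - u (sh i 1 k)) +
                pos (t - u (sh i (-1) k)) * pos (t - u (sh i (-1) k))).
(** The equation at [k] for the central value [t] with the neighbours frozen, multiplied by [t] to
    clear the division. *)
Definition local_sol (u : lat N -> R) k t := 0 < t /\ t * Esum u k t + c k * Qsum u k t = b k * t.

Lemma local_sol_ex u k : D k -> (forall y, 0 <= u y) -> exists t, local_sol u k t.
Proof.
move=> Dk Hu.
have N1 : 1 <= INR N by apply: (le_INR 1); apply/leP.
have b0 := Hb k Dk; have c0 := Hc k Dk.
pose f t := t * Esum u k t + c k * Qsum u k t - b k * t.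
have Cf : continuity f.
  have CE : continuity (Esum u k).
    by apply: continuity_sum => i t; reg.
  have CQ : continuity (Qsum u k).
    apply: continuity_sum => i t; apply: continuity_pt_plus; exact: continuity_pos_sq.
  move=> t; apply: continuity_pt_minus; last by reg.
  apply: continuity_pt_plus; apply: continuity_pt_mult.
  - by reg.
  - exact: CE.
  - by apply: continuity_pt_const => ? ?.
  - exact: CQ.
have E1 t : Esum u k t = 2 * INR N * t - Esum (fun y => - u y) k 0.
  have -> : 2 * INR N * t = INR N * (2 * t) by ring.
  by rewrite /Esum -sum_const -sum_sub; apply: sum_ext => i; ring.
set S := Esum (fun y => - u y) k 0 in E1.
have S0 : 0 <= S.
  by apply: sum_ge0 => i; have := Hu (sh i 1 k); have := Hu (sh i (-1) k); lra.
set g := 2 * INR N * (1 + c k).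
have g0 : 0 < g by rewrite /g; apply: Rmult_lt_0_compat; lra.
(* [t = 0] is a spurious root of [f], so the bracket starts at a positive point where [f] is not
   positive: there the quadratic terms are at most half of [b t]. *)
set t0 := b k / (2 * g).
have t0p : 0 < t0 by apply: Rdiv_lt_0_compat; lra.
have tg : g * t0 = b k / 2 by rewrite /t0; field; lra.
have f0 : f t0 <= 0.
  have Q0 : Qsum u k t0 <= INR N * (2 * (t0 * t0)).
    apply: sum_le_const => i.
    have := pos_sq_le (t0 - u (sh i 1 k)) t0 ltac:(have := Hu (sh i 1 k); lra) ltac:(lra).
    have := pos_sq_le (t0 - u (sh i (-1) k)) t0 ltac:(have := Hu (sh i (-1) k); lra) ltac:(lra).
    lra.
  have := Rmult_le_compat_l _ _ _ c0 Q0.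
  rewrite /f E1 => h.
  have : t0 * (2 * INR N * t0) + c k * (INR N * (2 * (t0 * t0))) = t0 * (g * t0) by rewrite /g; ring.
  rewrite tg; nra.
set t1 := S + b k + t0.
have f1 : 0 <= f t1.
  have Q0 : 0 <= c k * Qsum u k t1.
    apply: Rmult_le_pos => //; apply: sum_ge0 => i.
    by apply: Rplus_le_le_0_compat; apply: Rle_0_sqr.
  rewrite /f E1.
  have t1p : 0 < t1 by rewrite /t1; lra.
  have : b k <= 2 * INR N * t1 - S by rewrite /t1; nra.
  by move/(Rmult_le_compat_l _ _ _ (Rlt_le _ _ t1p)); lra.
have [t [ht ft]] := IVT_cor f t0 t1 Cf ltac:(rewrite /t1; lra) ltac:(nra).
by exists t; split; [lra|rewrite /f in ft; lra].
Qed.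

(** Divided by [t], the equation says that a sum of terms increasing in [t] ([upwind_mono]) and
    decreasing in the neighbours equals [b]. The case [u = v] gives uniqueness of the local
    solution. *)
Lemma local_sol_mono u v k t s : D k -> (forall y, 0 <= u y <= v y) ->
  local_sol u k t -> local_sol v k s -> t <= s.
Proof.
move=> Dk Huv [t0 et] [s0 es]; apply: Rnot_lt_le => hst.
have N1 : 1 <= INR N by apply: (le_INR 1); apply/leP.
have c0 := Hc k Dk.
pose e r y := r - y + c k * (pos (r - y) * pos (r - y)) / r.
pose ee (w : lat N -> R) r := \sum_(i < N) (e r (w (sh i 1 k)) + e r (w (sh i (-1) k))).
have eeE w r : 0 < r -> r * Esum w k r + c k * Qsum w k r = r * ee w r.
  move=> hr; rewrite /Esum /Qsum /ee -!sum_scal -sum_add; apply: sum_ext => i.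
  by rewrite /e; field; lra.
have Eu : ee u t = b k.
  by apply: (Rmult_eq_reg_l t); [rewrite -eeE // et; ring|lra].
have Ev : ee v s = b k.
  by apply: (Rmult_eq_reg_l s); [rewrite -eeE // es; ring|lra].
have : \sum_(i < N) (2 * (t - s)) <= ee u t - ee v s.
  rewrite -sum_sub; apply: sum_le => i.
  have one y : t - s <= e t (u y) - e s (v y).
    have h1 := upwind_mono (c k) t s (u y) c0 (Huv y).1 s0 ltac:(lra).
    have h2 : pos (s - v y) * pos (s - v y) <= pos (s - u y) * pos (s - u y).
      have p1 : pos (s - v y) <= pos (s - u y) by apply: pos_le; have := (Huv y).2; lra.
      by apply: Rmult_le_compat => //; apply: pos_ge0.
    have is0 : 0 < / s by positivity.
    have h3 : c k * (pos (s - v y) * pos (s - v y)) / s <= c k * (pos (s - u y) * pos (s - u y)) / s.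
      by apply: Rmult_le_compat_r; [lra|apply: Rmult_le_compat_l].
    by rewrite /e; have := (Huv y).2; lra.
  by have := one (sh i 1 k); have := one (sh i (-1) k); lra.
by rewrite sum_const Eu Ev; nra.
Qed.

Lemma local_sol_le u k t : D k -> (forall i, u (sh i 1 k) <= U (sh i 1 k)) ->
  (forall i, u (sh i (-1) k) <= U (sh i (-1) k)) -> local_sol u k t -> t <= U k.
Proof.
move=> Dk H1 H2 [t0 et]; apply: Rnot_lt_le => hlt.
have N1 : 1 <= INR N by apply: (le_INR 1); apply/leP.
have Q0 : 0 <= c k * Qsum u k t.
  apply: Rmult_le_pos; first exact: Hc.
  by apply: sum_ge0 => i; apply: Rplus_le_le_0_compat; apply: Rle_0_sqr.
have EU : - lap U k + INR N * (2 * (t - U k)) <= Esum u k t.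
  rewrite -lap_opp -sum_const /lap -sum_add; apply: sum_le => i.
  by have := H1 i; have := H2 i; lra.
have := HUl k Dk.
have : t * Esum u k t <= t * b k by lra.
move/(Rmult_le_reg_l _ _ _ t0); nra.
Qed.

(** For nonnegative neighbours the local solution exists and is unique, so the last clause says that
    [s] lies below the update that solves the equation node by node. The bound by [U] makes suprema
    finite. *)
Definition subsol (s : lat N -> R) := forall k, [/\ 0 <= s k, ~ D k -> s k = 0, D k -> s k <= U k &
  D k -> forall t, local_sol s k t -> s k <= t].

(** The pointwise supremum [u] of all subsolutions is a subsolution, by monotonicity of the local
    solution. Its update [T] is another one and lies above it, so [u = T] is a fixed point.
    Positivity in [D] comes for free, local solutions being positive. *)
Lemma discrete_ex : exists u : lat N -> R, forall k,
  [/\ 0 <= u k, ~ D k -> u k = 0 &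
      D k -> 0 < u k <= U k /\ lap u k = c k / u k * upg u k - b k].
Proof.
have S0 : subsol (fun=> 0).
  move=> k; split=> //; [lra|by move=> Dk; apply: Rlt_le; apply: HU|].
  by move=> _ t [h _]; lra.
have lubE k : exists l, is_lub (fun v => exists s, subsol s /\ v = s k) l.
  pose E v := exists s, subsol s /\ v = s k.
  have bE : bound E.
    exists (Rmax (U k) 0) => v [s [hs ->]]; have [h1 h2 h3 _] := hs k.
    case: (classic (D k)) => [/h3 h|/h2 ->]; last exact: Rmax_r.
    by apply: Rle_trans h _; apply: Rmax_l.
  have nE : exists v, E v by exists 0, (fun=> 0).
  by have [l hl] := completeness E bE nE; exists l.
pose u k := proj1_sig (constructive_indefinite_description _ (lubE k)).
have Hu k : is_lub (fun v => exists s, subsol s /\ v = s k) (u k).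
  by rewrite /u; case: constructive_indefinite_description.
have ub s k : subsol s -> s k <= u k by move=> hs; apply: (Hu k).1; exists s.
have lb k v : (forall s, subsol s -> s k <= v) -> u k <= v.
  by move=> H; apply: (Hu k).2 => x [s [hs ->]]; apply: H.
have u0 k : 0 <= u k by apply: (ub (fun=> 0)).
have usub : subsol u.
  move=> k; split=> //.
  - move=> nD; apply: Rle_antisym => //; apply: lb => s hs; have [_ h _ _] := hs k.
    by rewrite (h nD); lra.
  - by move=> Dk; apply: lb => s hs; have [_ _ h _] := hs k; apply: h.
  move=> Dk t ht; apply: lb => s hs; have [s0 _ _ hst] := hs k.
  have sp y : 0 <= s y by have [] := hs y.
  have [t' ht'] := local_sol_ex s k Dk sp.
  apply: Rle_trans (hst Dk t' ht') _.
  by apply: (local_sol_mono s u k) => // y; split=> //; apply: ub.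
pose T k := if excluded_middle_informative (D k) then epsilon (inhabits 0) (local_sol u k) else 0.
have TD k : D k -> local_sol u k (T k).
  move=> Dk; rewrite /T; case: (excluded_middle_informative (D k)) => // ?.
  by apply: epsilon_spec; apply: local_sol_ex.
have TnD k : ~ D k -> T k = 0 by rewrite /T; case: (excluded_middle_informative (D k)).
have uT k : u k <= T k.
  have [_ h1 _ h2] := usub k.
  by case: (classic (D k)) => Dk; [apply: h2 => //; apply: TD|rewrite h1 // TnD //; lra].
have Tsub : subsol T.
  move=> k; split.
  - by apply: Rle_trans (uT k).
  - exact: TnD.
  - move=> Dk.
    (* Outside [D] the candidate is 0, so [U] has only to be nonnegative at the neighbours of
       [D]. *)
    have uU y : 0 <= U y -> u y <= U y.
      by move=> hy; have [_ h1 h2 _] := usub y; case: (classic (D y)) => [/h2 //|/h1 ->].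
    apply: (local_sol_le u k) => //; last by apply: TD.
      by move=> i; apply: uU; have [] := HU1 k i Dk.
    by move=> i; apply: uU; have [] := HU1 k i Dk.
  move=> Dk t ht; apply: (local_sol_mono u T k) => //.
  exact: TD.
have TE k : u k = T k by apply: Rle_antisym => //; apply: ub.
exists u => k; have [h0 h1 h2 _] := usub k; split=> // Dk.
have [up eu] := TD k Dk; rewrite -TE in up eu.
split; first by split=> //; apply: h2.
have -> : upg u k = Qsum u k (u k) by [].
have -> : lap u k = - Esum u k (u k).
  by rewrite -[LHS]Ropp_involutive -lap_opp; congr (- _); apply: sum_ext => i; ring.
apply: (Rmult_eq_reg_l (u k)); last lra.
have -> : u k * (c k / u k * Qsum u k (u k) - b k) = c k * Qsum u k (u k) - b k * u k by field; lra.
lra.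
Qed.
End Existence.

(** Homogeneity replaces a comparison of differences. At a maximum [th > 1] of [s / u] the multiple
    [s / th] touches [u] from below, and it satisfies the inequality with [- b / th], which exceeds
    [- b]. *)
Lemma lower_comparison {N} (u s b c : lat N -> R) : (forall k, 0 <= u k) -> (forall k, 0 <= s k) ->
  fin (fun k => 0 < s k) ->
  (forall k, 0 < s k -> [/\ 0 < u k, 0 < b k, 0 <= c k, lap u k = c k / u k * upg u k - b k &
     - b k <= lap s k - c k / s k * upg s k]) ->
  forall k, s k <= u k.
Proof.
move=> Hu Hs fins H k0; apply: Rnot_lt_le => h0.
have sk0 : 0 < s k0 by have := Hu k0; lra.
have [k [sk Hmax]] := argmax (fun k => 0 < s k) (fun k => s k / u k) fins (ex_intro _ _ sk0).
have [uk bk ck eu es] := H k sk.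
set th := s k / u k in Hmax.
have th1 : 1 < th.
  have [uk0 _ _ _ _] := H k0 sk0.
  apply: Rlt_le_trans (Hmax k0 sk0); apply: (Rmult_lt_reg_r (u k0)) => //.
  have -> : s k0 / u k0 * u k0 = s k0 by field; lra.
  lra.
have ith : 0 < / th < 1 by split; [apply: Rinv_0_lt_compat; lra|rewrite -Rinv_1; apply: Rinv_lt_contravar; lra].
have ske : s k = th * u k by rewrite /th; field; lra.
have uge y : s y * / th <= u y.
  case: (Rle_lt_dec (s y) 0) => hy.
    by have -> : s y = 0 by [apply: Rle_antisym]; rewrite Rmult_0_l.
  have [uy _ _ _ _] := H y hy.
  apply: (Rmult_le_reg_r (th * / u y)); first by positivity.
  have -> : s y * / th * (th * / u y) = s y / u y by field; lra.
  have -> : u y * (th * / u y) = th by field; lra.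
  exact: Hmax.
have uke : u k = s k * / th by rewrite ske; field; lra.
have L : lap s k * / th <= lap u k.
  rewrite Rmult_comm -sum_scal; apply: sum_le => i.
  by have := uge (sh i 1 k); have := uge (sh i (-1) k); rewrite uke; lra.
have Q : upg u k <= upg s k * (/ th * / th).
  rewrite Rmult_comm -sum_scal; apply: sum_le => i.
  have one y : pos (u k - u y) * pos (u k - u y) <= / th * / th * (pos (s k - s y) * pos (s k - s y)).
    have p : pos (u k - u y) <= / th * pos (s k - s y).
      apply: Rmax_lub; last by apply: Rmult_le_pos; [lra|exact: pos_ge0].
      apply: (Rle_trans _ (/ th * (s k - s y))).
        by rewrite uke; have := uge y; lra.
      by apply: Rmult_le_compat_l; [lra|exact: pos_ge].
    have p0 := pos_ge0 (u k - u y).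
    have := Rmult_le_compat _ _ _ _ p0 p0 p p; lra.
  by have := one (sh i 1 k); have := one (sh i (-1) k); lra.
have ck' : 0 <= c k / u k by positivity.
have e2 : c k / u k * (upg s k * (/ th * / th)) = c k / s k * upg s k * / th.
  by rewrite uke; field; lra.
have := Rmult_le_compat_r _ _ _ (Rlt_le _ _ ith.1) es.
by nra.
Qed.

(** The gradient term of the scheme is nonnegative, so solutions satisfy [lap u >= - b] and the
    linear maximum principle applies to them. *)
Lemma upper_comparison {N} (u V b : lat N -> R) (P : lat N -> Prop) : fin P ->
  (forall k, P k -> lap V k < - b k <= lap u k) ->
  (forall k i s, Z.abs s = 1%Z -> P k -> ~ P (sh i s k) -> u (sh i s k) <= V (sh i s k)) ->
  forall k, P k -> u k <= V k.
Proof.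
move=> finP Hl Hb k0 Pk0; apply: Rnot_lt_le => h0.
have [k [Pk Hmax]] := argmax P (fun k => u k - V k) finP (ex_intro _ _ Pk0).
have := Hmax k0 Pk0 => h1.
have : lap (fun y => u y - V y) k <= 0.
  have nb i s : Z.abs s = 1%Z -> u (sh i s k) - V (sh i s k) <= u k - V k.
    move=> hs; case: (classic (P (sh i s k))) => h; first exact: Hmax.
    by have := Hb k i s hs Pk h; lra.
  by apply: lap_max_le0 => i; split; apply: nb.
by rewrite lap_sub; have := Hl k Pk; lra.
Qed.

(** * The scheme on a domain *)

Section Dist.
Context {N : nat}.
Implicit Types x y : RN N.

Lemma dist_sym x y : dist x y = dist y x.
Proof. by rewrite /dist; congr sqrt; apply: sum_ext => i; ring. Qed.

Lemma dist_coord x y i : Rabs (x i - y i) <= dist x y.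
Proof.
rewrite -sqrt_Rsqr_abs; apply: sqrt_le_1_alt.
by apply: (sum_term (fun i => (x i - y i) * (x i - y i))) => j; apply: Rle_0_sqr.
Qed.

Lemma dist_le_sum x y : dist x y <= \sum_(i < N) Rabs (x i - y i).
Proof.
set S := \sum_(i < N) _.
have S0 : 0 <= S by apply: sum_ge0 => i; apply: Rabs_pos.
rewrite -(sqrt_Rsqr S) //; apply: sqrt_le_1_alt; rewrite /Rsqr /norm2.
have -> : S * S = \sum_(i < N) (S * Rabs (x i - y i)) by rewrite sum_scal.
apply: sum_le => i; rewrite -[X in X <= _]Rabs_pos_eq; last exact: Rle_0_sqr.
rewrite Rabs_mult; apply: Rmult_le_compat_r; first exact: Rabs_pos.
by apply: (sum_term (fun i => Rabs (x i - y i))) => j; apply: Rabs_pos.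
Qed.

Lemma dist_box x y r : (forall i, Rabs (x i - y i) <= r) -> dist x y <= INR N * r.
Proof. by move=> H; apply: Rle_trans (dist_le_sum x y) _; apply: sum_le_const. Qed.

Lemma dist_ge0 x y : 0 <= dist x y.
Proof. exact: sqrt_pos. Qed.

Lemma dist_gt0 x y : x <> y -> 0 < dist x y.
Proof.
move=> ne; case: (dist_ge0 x y) => // e0; case: ne.
apply: functional_extensionality => i; have := dist_coord x y i; rewrite -e0.
by split_Rabs; lra.
Qed.

Lemma dist_xx x : dist x x = 0.
Proof.
apply: Rle_antisym; last exact: dist_ge0.
have := dist_box x x 0; rewrite Rmult_0_r; apply=> i.
by rewrite Rminus_diag_eq // Rabs_R0; lra.
Qed.

Lemma dist_upd x i t : dist x (upd x i t) <= Rabs (t - x i).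
Proof.
apply: Rle_trans (dist_le_sum _ _) _.
have -> : \sum_(j < N) Rabs (x j - upd x i t j) = \sum_(j < N) (if j == i then Rabs (t - x i) else 0).
  apply: sum_ext => j; rewrite /upd; case: eqP => [->|_]; first by rewrite Rabs_minus_sym.
  by rewrite Rminus_diag_eq // Rabs_R0.
by have := @sum_delta N i (Rabs (t - x i)); lra.
Qed.

Lemma in_closure (U : RN N -> Prop) x : U x -> closure U x.
Proof. by move=> Ux e he; exists x; rewrite dist_xx. Qed.
End Dist.

Definition pt {N} (h : R) (k : lat N) : RN N := fun i => h * IZR (k i).

Lemma pt_sh {N} h (k : lat N) i s : pt h (sh i s k) = upd (pt h k) i (h * IZR (k i) + h * IZR s).
Proof.
apply: functional_extensionality => j; rewrite /pt /upd /sh; case: eqP => [->|//].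
by rewrite plus_IZR; ring.
Qed.

(** [Rpower 0 al] is 1, not 0, so Hoelder bounds are carried with a positive upper bound [d] of the
    distance; this covers [x = y] too. *)
Lemma holder_upd {N} (U : RN N -> Prop) al f : 0 < al -> holder_on U al f -> exists K, 0 <= K /\
  forall x y d, U x -> U y -> 0 < d -> dist x y <= d -> Rabs (f x - f y) <= K * Rpower d al.
Proof.
move=> hal [K HK]; exists (Rabs K); split; first exact: Rabs_pos.
move=> x y d Ux Uy hd hxy.
have p := Rpower_pos d al.
case: (classic (x = y)) => [->|ne].
  by rewrite Rminus_diag_eq // Rabs_R0; positivity.
apply: Rle_trans (HK x y Ux Uy ne) _.
have p' := Rpower_pos (dist x y) al.
apply: (Rle_trans _ (Rabs K * Rpower (dist x y) al)).
  by apply: Rmult_le_compat_r; [lra|exact: Rle_abs].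
apply: Rmult_le_compat_l; first exact: Rabs_pos.
by apply: Rle_Rpower_l; [lra|split=> //; apply: dist_gt0].
Qed.

Lemma holder_bounded {N} (U : RN N -> Prop) al f : 0 < al -> is_bounded U -> holder_on (closure U) al f ->
  exists A, 0 < A /\ forall x, U x -> Rabs (f x) <= A.
Proof.
move=> hal [Mb HMb] /(holder_upd _ _ _ hal) [K [HK Hf]].
case: (classic (exists x, U x)) => [[x0 U0]|no]; last first.
  by exists 1; split; [lra|move=> x Ux; case: no; exists x].
set d := INR N * (2 * Rabs Mb) + 1.
have HN := pos_INR N.
have d0 : 0 < d by have := Rmult_le_pos _ _ HN (Rabs_pos Mb); rewrite /d; lra.
exists (Rabs (f x0) + K * Rpower d al + 1); split.
  have := Rabs_pos (f x0); have := Rmult_le_pos _ _ HK (Rlt_le _ _ (Rpower_pos d al)); lra.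
move=> x Ux.
have hd : dist x x0 <= d.
  apply: (Rle_trans _ (INR N * (2 * Rabs Mb))); last by rewrite /d; lra.
  apply: dist_box => i.
  have := HMb x Ux; have := HMb x0 U0; have := dist_coord x (fun=> 0) i; have := dist_coord x0 (fun=> 0) i.
  by split_Rabs; lra.
by have := Hf x x0 d (in_closure _ _ Ux) (in_closure _ _ U0) d0 hd; split_Rabs; lra.
Qed.

Definition scheme {N} (Omega : RN N -> Prop) (a c : RN N -> R) (Mx h : R) (u : lat N -> R) : Prop :=
  forall k, [/\ 0 <= u k, ~ Omega (pt h k) -> u k = 0 &
    Omega (pt h k) -> 0 < u k <= Mx /\
      lap u k = c (pt h k) / u k * upg u k - h * h * a (pt h k)].

(** The supersolution is [A ((Mb + 2)^2 - |x|^2)], with lattice Laplacian [- 2 N A h^2]. The 2 keeps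
    it positive in [Omega] and nonnegative one step outside, as [h <= 1]. Its maximum [Mx] does not
    depend on [h]. *)
Lemma scheme_ex {N} (Omega : RN N -> Prop) (a c : RN N -> R) A : (0 < N)%nat -> is_bounded Omega ->
  (forall x, Omega x -> 0 < a x <= A) -> (forall x, Omega x -> 0 < c x) ->
  exists Mx, 0 < Mx /\ forall h, 0 < h <= 1 -> exists u, scheme Omega a c Mx h u.
Proof.
move=> HN [Mb HMb] Ha Hc.
case: (classic (exists x, Omega x)) => [[x0 O0]|no]; last first.
  exists 1; split; first lra.
  move=> h _; exists (fun=> 0) => k; split=> //; first lra.
  by move=> Ok; case: no; exists (pt h k).
have A0 : 0 < A by have := Ha x0 O0; lra.
have N1 : 1 <= INR N by apply: (le_INR 1); apply/leP.
have Mb0 : 0 <= Mb by apply: Rle_trans (dist_ge0 x0 (fun=> 0)) (HMb x0 O0).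
set R0 := (Mb + 2) * (Mb + 2).
exists (A * R0); split; first by apply: Rmult_lt_0_compat => //; rewrite /R0; nra.
move=> h Hh.
pose g (j : 'I_N) (t : Z) := - A * (h * IZR t * (h * IZR t)).
pose U (k : lat N) := A * R0 + \sum_(j < N) g j (k j).
have Uk k : U k = A * (R0 - norm2 (pt h k)).
  have -> : A * (R0 - norm2 (pt h k)) = A * R0 + - A * norm2 (pt h k) by ring.
  by rewrite /U /norm2 -sum_scal.
have n2 k : Omega (pt h k) -> norm2 (pt h k) <= Mb * Mb.
  move=> /HMb; rewrite /dist => hk.
  have -> : norm2 (pt h k) = norm2 (fun i => pt h k i - 0) by apply: sum_ext => i; ring.
  rewrite -(sqrt_sqrt (norm2 _)); first by apply: Rmult_le_compat => //; apply: sqrt_pos.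
  by apply: sum_ge0 => i; apply: Rle_0_sqr.
have Ush k i s : U (sh i s k) = U k - A * (h * h) * (2 * IZR (k i) * IZR s + IZR s * IZR s).
  by rewrite /U (sep_sh g) /g plus_IZR; ring.
have coord k i : Omega (pt h k) -> Rabs (h * IZR (k i)) <= Mb.
  move=> Ok; apply: Rle_trans (HMb _ Ok); rewrite -[X in Rabs X]Rminus_0_r.
  exact: (dist_coord (pt h k) (fun=> 0) i).
have nbU k i s : Omega (pt h k) -> s = 1%Z \/ s = (-1)%Z -> 0 <= U (sh i s k).
  move=> Ok hs; rewrite Ush Uk.
  have h1 := n2 k Ok; have h2 := coord k i Ok.
  have h3 : h * (h * IZR (k i)) <= Mb by move: h2; split_Rabs; nra.
  have h4 : - Mb <= h * (h * IZR (k i)) by move: h2; split_Rabs; nra.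
  have h5 : h * h <= 1 by nra.
  have : 0 <= A * (R0 - norm2 (pt h k) - (h * h) * (2 * IZR (k i) * IZR s + IZR s * IZR s)).
    apply: Rmult_le_pos; first lra.
    by rewrite /R0; case: hs => ->; nra.
  lra.
have hb k : Omega (pt h k) -> 0 < h * h * a (pt h k).
  by move=> /Ha ?; apply: Rmult_lt_0_compat; nra.
have hc k : Omega (pt h k) -> 0 <= c (pt h k) by move=> /Hc ?; lra.
have hU k : Omega (pt h k) -> 0 < U k.
  by move=> /n2 ?; rewrite Uk; apply: Rmult_lt_0_compat => //; rewrite /R0; nra.
have hUl k : Omega (pt h k) -> lap U k <= - (h * h * a (pt h k)).
  move=> Ok.
  have -> : lap U k = INR N * (- (2 * A * (h * h))).
    by rewrite -sum_const; apply: sum_ext => i; rewrite !Ush; ring.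
  have := Ha _ Ok => ha; have hh : 0 < h * h by nra.
  have : h * h * a (pt h k) <= h * h * A by apply: Rmult_le_compat_l; lra.
  have : 1 * (2 * A * (h * h)) <= INR N * (2 * A * (h * h)).
    by apply: Rmult_le_compat_r => //; nra.
  nra.
have [u Hu] := discrete_ex HN (fun k => Omega (pt h k)) (fun k => h * h * a (pt h k)) (fun k => c (pt h k)) U hb hc hU
  (fun k i Ok => conj (nbU k i 1%Z Ok (or_introl erefl)) (nbU k i (-1)%Z Ok (or_intror erefl))) hUl.
exists u => k; have [h1 h2 h3] := Hu k; split=> // Ok.
have [h4 h5] := h3 Ok; split=> //; split; first lra.
apply: Rle_trans h4.2 _; rewrite Uk; apply: Rmult_le_compat_l; first lra.
have : 0 <= norm2 (pt h k) by apply: sum_ge0 => i; apply: Rle_0_sqr.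
lra.
Qed.

Lemma fin_pt {N} h (x0 : RN N) r : 0 < h -> fin (fun k => forall i, Rabs (pt h k i - x0 i) <= r).
Proof.
move=> hh; apply: fin_sub (fin_n1 (fun=> 0%Z) (INR N * ((\sum_(j < N) Rabs (x0 j) + r) / h))) => k Hk.
apply: n1_box => i; rewrite Z.sub_0_r.
have h1 := sum_term (fun j => Rabs (x0 j)) i (fun j => Rabs_pos _).
apply: (Rmult_le_reg_r h) => //; rewrite Rdiv_mulK //.
have := Hk i; rewrite /pt -{2}(Rabs_pos_eq h); last lra.
rewrite -Rabs_mult (Rmult_comm (IZR _)); move: h1 => /=; split_Rabs; lra.
Qed.

(** Squaring the paraboloid keeps [|grad s|^2 / s] bounded where [s] vanishes, so the singular term
    costs only a multiple of [e], as does the Laplacian; a small [e] brings both below [a0]. *)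
Lemma scheme_lower {N} (Omega : RN N -> Prop) (a c : RN N -> R) Mx Cc a0 r1 (x0 : RN N) :
  (0 < N)%nat -> 0 < a0 -> 0 < r1 -> (forall x, Omega x -> 0 < c x <= Cc) ->
  (forall x, dist x0 x < r1 -> Omega x /\ a0 <= a x) ->
  exists m, 0 < m /\ forall h u, 0 < h <= 1 -> scheme Omega a c Mx h u ->
    forall k, (forall i, Rabs (pt h k i - x0 i) <= r1 / (2 * INR N)) -> m <= u k.
Proof.
move=> NN ha0 hr1 Hc Hin.
have N1 : 1 <= INR N by apply: (le_INR 1); apply/leP.
have Cc0 : 0 < Cc by have [O0 _] := Hin x0 ltac:(rewrite dist_xx; lra); have := Hc _ O0; lra.
(* Per unit of [e h^2]: the Laplacian of the subsolution, its singular term, and a 1 for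
   positivity. *)
set g := 4 * INR N * (r1 * r1) + 8 * INR N * Cc * ((2 * r1 + 1) * (2 * r1 + 1)) + 1.
have NC : 0 < INR N * Cc by nra.
have g1 : 0 <= INR N * (r1 * r1) by nra.
have g2 : 0 <= INR N * Cc * ((2 * r1 + 1) * (2 * r1 + 1)) by nra.
have g0 : 0 < g by rewrite /g; lra.
set e := a0 / g.
have e0 : 0 < e by apply: Rdiv_lt_0_compat.
have eg : e * g = a0 by rewrite /e; field; lra.
exists (e * ((r1 * r1 / 2) * (r1 * r1 / 2))); split.
  by positivity.
move=> h u hh Hs.
pose gg (j : 'I_N) (t : Z) := - ((h * IZR t - x0 j) * (h * IZR t - x0 j)).
pose w (k : lat N) := r1 * r1 + \sum_(j < N) gg j (k j).
pose s k := e * (pos (w k) * pos (w k)).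
have wE k : w k = r1 * r1 - norm2 (fun i => pt h k i - x0 i).
  have -> : norm2 (fun i => pt h k i - x0 i) = - \sum_(j < N) gg j (k j).
    have -> : - \sum_(j < N) gg j (k j) = (-1) * \sum_(j < N) gg j (k j) by ring.
    by rewrite -sum_scal; apply: sum_ext => i; rewrite /gg /pt; ring.
  rewrite /w; ring.
have wsh k i t : w (sh i t k) = w k - (2 * (h * IZR t) * (pt h k i - x0 i) + h * h * (IZR t * IZR t)).
  by rewrite /w (sep_sh gg) /gg /pt plus_IZR; ring.
have s0 k : 0 <= s k by apply: Rmult_le_pos; [lra|apply: Rle_0_sqr].
have spos k : 0 < s k -> 0 < w k.
  move=> hs; apply: Rnot_le_lt => /pos_0 h0; rewrite /s h0 in hs; lra.
have wdist k : 0 < w k -> dist x0 (pt h k) < r1.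
  rewrite wE dist_sym /dist => hw.
  rewrite -(sqrt_Rsqr r1); last lra.
  by apply: sqrt_lt_1_alt; split; [apply: sum_ge0 => i; apply: Rle_0_sqr|rewrite /Rsqr; lra].
have wle k : w k <= r1 * r1.
  have : 0 <= norm2 (fun i => pt h k i - x0 i) by apply: sum_ge0 => i; apply: Rle_0_sqr.
  by rewrite wE; lra.
have coord k i : 0 < w k -> Rabs (pt h k i - x0 i) < r1.
  move=> /wdist hd; apply: Rle_lt_trans hd; rewrite Rabs_minus_sym; exact: dist_coord.
have fins : fin (fun k => 0 < s k).
  by apply: fin_sub (fin_pt h x0 r1 hh.1) => k /spos hw i; apply: Rlt_le; apply: coord.
have step k i t : 0 < w k -> t = 1%Z \/ t = (-1)%Z -> Rabs (w k - w (sh i t k)) <= h * (2 * r1 + 1).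
  move=> hw ht; have hc := coord k i hw; rewrite wsh.
  have e1 : IZR t * IZR t = 1 by case: ht => ->; ring.
  have -> : w k - (w k - (2 * (h * IZR t) * (pt h k i - x0 i) + h * h * (IZR t * IZR t))) =
    h * (2 * (IZR t * (pt h k i - x0 i)) + h) by rewrite e1; ring.
  rewrite Rabs_mult (Rabs_pos_eq h); last lra.
  apply: Rmult_le_compat_l; first lra.
  by case: ht hc => ->; split_Rabs; lra.
have main : forall k, s k <= u k.
  apply: (lower_comparison u s (fun k => h * h * a (pt h k)) (fun k => c (pt h k))) => //.
    by move=> k; have [] := Hs k.
  move=> k sk; have hw := spos k sk.
  have [Ok ak] := Hin _ (wdist k hw); have hc := Hc _ Ok.
  have [_ _ /(_ Ok) [hu eu]] := Hs k.
  have hh2 : 0 < h * h by nra.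
  have hha : 0 < h * h * a (pt h k) by positivity.
  split=> //; [lra|lra|].
  have pw : pos (w k) = w k by apply: pos_id; lra.
  have L : 2 * e * w k * lap w k <= lap s k.
    rewrite -sum_scal; apply: sum_le => i.
    (* The tangent at [w k] of the convex function [w_+^2] reduces [lap s] to [lap w]. *)
    have tan y : e * (2 * (w k * w y) - w k * w k) <= s y.
      rewrite /s; apply: Rmult_le_compat_l; first lra.
      case: (Rle_lt_dec 0 (w y)) => hy; first by rewrite pos_id //; have := Rle_0_sqr (w k - w y); rewrite /Rsqr; lra.
      rewrite pos_0; last lra.
      by have := Rmult_le_pos (w k) (- w y) ltac:(lra) ltac:(lra); have := Rle_0_sqr (w k); rewrite /Rsqr; lra.
    have := tan (sh i 1 k); have := tan (sh i (-1) k).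
    by rewrite {5}/s pw; lra.
  have Lw : lap w k = - (2 * INR N * (h * h)).
    have -> : - (2 * INR N * (h * h)) = INR N * (- (2 * (h * h))) by ring.
    by rewrite -sum_const; apply: sum_ext => i; rewrite !wsh; ring.
  have Q : upg s k <= INR N * (2 * (4 * e * s k * (h * h * ((2 * r1 + 1) * (2 * r1 + 1))))).
    apply: sum_le_const => i.
    have one t : t = 1%Z \/ t = (-1)%Z -> pos (s k - s (sh i t k)) * pos (s k - s (sh i t k)) <=
         4 * e * s k * (h * h * ((2 * r1 + 1) * (2 * r1 + 1))).
      move=> ht; have hst := step k i t hw ht.
      set y := sh i t k in hst *.
      set q := pos (w y); have q0 : 0 <= q by apply: pos_ge0.
      set B := h * (2 * r1 + 1) in hst.
      have B0 : 0 <= B by apply: Rmult_le_pos; lra.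
      have pq : Rabs (w k - q) <= B.
        by apply: Rle_trans hst; rewrite -{1}pw; apply: pos_lip.
      have -> : h * h * ((2 * r1 + 1) * (2 * r1 + 1)) = B * B by rewrite /B; ring.
      have -> : s k = e * (w k * w k) by rewrite /s pw.
      have -> : s y = e * (q * q) by [].
      have wB : 0 <= 2 * w k * B by positivity.
      have le1 : e * (w k * w k) - e * (q * q) <= e * (2 * w k * B).
        have -> : e * (w k * w k) - e * (q * q) = e * (w k * w k - q * q) by ring.
        apply: Rmult_le_compat_l; first lra.
        case: (Rle_lt_dec (w k) q) => hq; first by nra.
        have hq2 : w k - q <= B by move: pq; split_Rabs; lra.
        have -> : w k * w k - q * q = (w k + q) * (w k - q) by ring.
        by apply: Rmult_le_compat; lra.
      have := pos_sq_le _ _ le1 ltac:(positivity).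
      lra.
    by have := one 1%Z (or_introl erefl); have := one (-1)%Z (or_intror erefl); lra.
  have csk : 0 <= c (pt h k) / s k by positivity.
  have Q2 := Rmult_le_compat_l _ _ _ csk Q.
  have E2 : c (pt h k) / s k * (INR N * (2 * (4 * e * s k * (h * h * ((2 * r1 + 1) * (2 * r1 + 1)))))) =
     c (pt h k) * (8 * INR N * e * (h * h * ((2 * r1 + 1) * (2 * r1 + 1)))) by field; lra.
  rewrite E2 in Q2.
  have Q3 : c (pt h k) * (8 * INR N * e * (h * h * ((2 * r1 + 1) * (2 * r1 + 1)))) <=
     Cc * (8 * INR N * e * (h * h * ((2 * r1 + 1) * (2 * r1 + 1)))).
    apply: Rmult_le_compat_r; last lra.
    by positivity.
  have L2 : - (4 * INR N * (r1 * r1) * e * (h * h)) <= lap s k.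
    apply: Rle_trans L; rewrite Lw.
    have : w k * (4 * INR N * e * (h * h)) <= r1 * r1 * (4 * INR N * e * (h * h)).
      by apply: Rmult_le_compat_r => //; do 2 (apply: Rmult_le_pos; try nra).
    lra.
  have fin1 : h * h * (e * g) <= h * h * a (pt h k).
    by rewrite eg; apply: Rmult_le_compat_l; lra.
  have fin2 : 0 <= h * h * e by positivity.
  by rewrite /g in fin1; lra.
move=> k Hk; apply: Rle_trans (main k).
have nb : norm2 (fun i => pt h k i - x0 i) <= r1 * r1 / 2.
  apply: (Rle_trans _ (INR N * (r1 / (2 * INR N) * (r1 / (2 * INR N))))).
    apply: sum_le_const => i; set t := pt h k i - x0 i.
    rewrite -[X in X <= _]Rabs_pos_eq; last exact: Rle_0_sqr.
    by rewrite Rabs_mult; apply: Rmult_le_compat; try exact: Rabs_pos; exact: Hk.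
  have -> : INR N * (r1 / (2 * INR N) * (r1 / (2 * INR N))) = r1 * r1 * / (4 * INR N) by field; lra.
  by apply: Rmult_le_compat_l; [nra|apply: Rinv_le_contravar; lra].
have hw : r1 * r1 / 2 <= w k by rewrite wE; lra.
have rp : 0 <= r1 * r1 / 2 by nra.
rewrite /s pos_id; last lra.
by apply: Rmult_le_compat_l; [lra|apply: Rmult_le_compat].
Qed.

Definition floor_pt {N} (h : R) (x : RN N) : lat N := fun i => Int_part (x i / h).

Lemma floor_ptP {N} h (x : RN N) i : 0 < h -> x i - h < pt h (floor_pt h x) i <= x i.
Proof.
move=> hh; rewrite /pt /floor_pt; have [h1 h2] := base_Int_part (x i / h).
set t := IZR _ in h1 h2 *; have e : x i = h * (x i / h) by field; lra.
have h3 : h * t <= h * (x i / h) by apply: Rmult_le_compat_l; lra.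
have h4 : h * (x i / h) < h * (t + 1) by apply: Rmult_lt_compat_l; lra.
lra.
Qed.

(** [interior_est] with [rad = r' / h], centred at the lattice point below [x0]. Multiplying [a] by
    [r'^2] turns [h^2 a] into the form required by [dsol], and the constants come out independent of
    [h]. *)
Lemma scheme_local {N} (Omega : RN N -> Prop) (a c : RN N -> R) Mx A Cc K al r m (x0 : RN N) :
  0 < al < 1 -> 0 < Mx -> 0 <= A -> 0 <= Cc -> 0 <= K -> 0 < r -> 0 < m ->
  (forall x, Omega x -> 0 < a x <= A) -> (forall x, Omega x -> 0 < c x <= Cc) ->
  (forall x y d, Omega x -> Omega y -> 0 < d -> dist x y <= d ->
     Rabs (a x - a y) <= K * Rpower d al /\ Rabs (c x - c y) <= K * Rpower d al) ->
  (forall x, (forall i, Rabs (x i - x0 i) <= r) -> Omega x) ->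
  (forall h u, 0 < h <= 1 -> scheme Omega a c Mx h u ->
     forall k, (forall i, Rabs (pt h k i - x0 i) <= r) -> m <= u k) ->
  exists rho C, 0 < rho <= r /\ 0 < C /\ forall h u, 0 < h <= 1 -> h <= rho -> scheme Omega a c Mx h u ->
    forall k, (forall i, Rabs (pt h k i - x0 i) <= rho) -> forall i j,
    [/\ Rabs (df i 1 u k) <= C * h, Rabs (df2 i j 1 u k) <= C * (h * h) &
        forall l s, (1 <= s)%Z -> h * IZR s <= rho ->
          Rabs (df l s (df2 i j 1 u) k) <= C * (h * h) * Rpower (h * IZR s) al].
Proof.
move=> Hal HMx HA HCc HK Hr Hm Ha Hc Hac HO Hlow.
have HN := pos_INR N.
set r' := r / 2; have Hr' : 0 < r' by rewrite /r'; lra.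
set B := r' * r' * K * Rpower r' al + K * Rpower r' al.
have Kp : 0 <= K * Rpower r' al by positivity.
have B1 : 0 <= r' * r' * (K * Rpower r' al) by positivity.
have HB : 0 <= B by rewrite /B; lra.
have HA' : 0 <= r' * r' * A by positivity.
have [eta [C [R0 [Heta [HC [HR0 est]]]]]] := @interior_est N al m Mx (r' * r' * A) Cc B Hal Hm HMx HA' HCc HB.
set e1 := / (2 * (INR N + 1) / eta + R0 + 2).
have Ne : 0 < 2 * (INR N + 1) / eta by positivity.
have He1 : 0 < e1 by apply: Rinv_0_lt_compat; lra.
have e1P : e1 * (2 * (INR N + 1) / eta + R0 + 2) = 1 by rewrite /e1; apply: Rinv_l; lra.
have e1a : e1 * (2 * (INR N + 1) / eta) <= 1.
  by have := Rmult_lt_0_compat _ _ He1 HR0; lra.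
have e1b : e1 * R0 <= 1 by have := Rmult_lt_0_compat _ _ He1 Ne; lra.
have e1d : e1 * (2 * (INR N + 1)) <= eta.
  have -> : e1 * (2 * (INR N + 1)) = e1 * (2 * (INR N + 1) / eta) * eta by field; lra.
  by rewrite -[X in _ <= X]Rmult_1_l; apply: Rmult_le_compat_r; lra.
set rho := r' * e1.
have rho0 : 0 < rho by apply: Rmult_lt_0_compat.
have rho2 : rho * 2 <= r' by rewrite /rho; nra.
have rhoR : rho * R0 <= r' by rewrite /rho Rmult_assoc; nra.
have rhoN : rho * (2 * (INR N + 1)) <= r' * eta.
  by rewrite /rho Rmult_assoc; apply: Rmult_le_compat_l; lra.
set P := Rpower (/ r') al; have P0 : 0 < P by apply: Rpower_pos.
have ir : 0 < / r' by positivity.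
have irr : 0 < / (r' * r') by positivity.
set C' := C * / r' + C * / (r' * r') + C * P * / (r' * r').
have c1 : 0 < C * / r' by positivity.
have c2 : 0 < C * / (r' * r') by positivity.
have c3 : 0 < C * P * / (r' * r') by positivity.
exists rho, C'; split; first by rewrite /r' in rho2; lra.
split; first by rewrite /C'; lra.
move=> h u Hh Hhr Hs k Hk i j.
set z := floor_pt h x0; set rad := r' / h.
have hrad : h * rad = r' by rewrite /rad; field; lra.
have rad0 : 0 < rad by apply: Rdiv_lt_0_compat; lra.
have zx l : Rabs (pt h z l - x0 l) <= h.
  by have := floor_ptP h x0 l Hh.1; rewrite -/z => ?; split_Rabs; lra.
have box x : n1 z x <= rad -> forall l, Rabs (pt h x l - x0 l) <= r.
  move=> hx l.
  have h1 : h * Rabs (IZR (x l - z l)) <= r'.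
    by rewrite -hrad; apply: Rmult_le_compat_l; [lra|apply: Rle_trans (coord_n1 z x l) hx].
  have h2 : pt h x l - pt h z l = h * IZR (x l - z l) by rewrite /pt minus_IZR; ring.
  have h3 : Rabs (pt h x l - pt h z l) <= r' by rewrite h2 Rabs_mult (Rabs_pos_eq h); lra.
  by have := zx l; rewrite /r' in h3 rho2; move: h3; split_Rabs; lra.
have inO x : n1 z x <= rad -> Omega (pt h x) by move/box; apply: HO.
have D : dsol al m Mx (r' * r' * A) Cc B rad z u (fun x => r' * r' * a (pt h x)) (fun x => c (pt h x)).
  move=> x hx; have Ox := inO x hx.
  have ha := Ha _ Ox; have hc := Hc _ Ox.
  have [_ _ /(_ Ox) [hu eu]] := Hs x.
  have rr : 0 < r' * r' by nra.
  split.
  - by split; [apply: (Hlow h u) => //; apply: box|lra].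
  - by split; [apply: Rmult_le_pos; lra|apply: Rmult_le_compat_l; lra].
  - by lra.
  - rewrite eu; congr (_ - _); rewrite /rad; field; lra.
  move=> l s hs hxs.
  have sp : 0 < IZR s by apply: (IZR_lt 0); lia.
  have hsp : 0 < h * IZR s by positivity.
  have Oy : Omega (pt h (sh l s x)) by apply: inO; have := n1_shp z x l s ltac:(lia); lra.
  have dd : dist (pt h (sh l s x)) (pt h x) <= h * IZR s.
    rewrite dist_sym pt_sh; apply: Rle_trans (dist_upd _ _ _) _.
    by rewrite /pt; have -> : h * IZR (x l) + h * IZR s - h * IZR (x l) = h * IZR s by [ring]; rewrite Rabs_pos_eq; lra.
  have [d1 d2] := Hac _ _ _ Oy Ox hsp dd.
  have e : Rpower (h * IZR s) al = Rpower r' al * Rpower (IZR s / rad) al.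
    rewrite Rpower_mult_distr //; last by positivity.
    by congr Rpower; rewrite -hrad; field; lra.
  rewrite e in d1 d2.
  set t := Rpower (IZR s / rad) al in d1 d2 *; have t0 : 0 < t by apply: Rpower_pos.
  split.
    rewrite /df -Rmult_minus_distr_l Rabs_mult (Rabs_pos_eq (r' * r')); last lra.
    apply: (Rle_trans _ (r' * r' * (K * (Rpower r' al * t)))); first by apply: Rmult_le_compat_l; lra.
    have : 0 <= K * Rpower r' al * t by positivity.
    by rewrite /B; lra.
  apply: Rle_trans d2 _.
  have : 0 <= r' * r' * (K * Rpower r' al) * t by positivity.
  by rewrite /B; lra.
have Rrad : R0 <= rad.
  apply: (Rmult_le_reg_l h); first lra.
  by rewrite hrad; apply: Rle_trans rhoR; apply: Rmult_le_compat_r; lra.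
have kz : n1 z k <= eta * rad.
  apply: (Rle_trans _ (INR N * (2 * rho / h))).
    apply: n1_box => l; apply: (Rmult_le_reg_l h); first lra.
    have -> : h * (2 * rho / h) = 2 * rho by field; lra.
    rewrite -{1}(Rabs_pos_eq h); last lra.
    rewrite -Rabs_mult minus_IZR Rmult_minus_distr_l.
    by have := zx l; have := Hk l; rewrite /pt; split_Rabs; lra.
  apply: (Rmult_le_reg_l h); first lra.
  have -> : h * (INR N * (2 * rho / h)) = rho * (2 * (INR N + 1)) - 2 * rho by field; lra.
  have -> : h * (eta * rad) = r' * eta by rewrite -hrad; ring.
  lra.
have [h1 h2 h3] := est rad z u _ _ Rrad D k kz i j.
have er : / rad = h * / r' by rewrite /rad; field; lra.
have err : / (rad * rad) = h * h * / (r' * r') by rewrite /rad; field; lra.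
have hh : 0 < h * h by nra.
split.
- apply: Rle_trans h1 _; rewrite /Rdiv er.
  have -> : C * (h * / r') = (C * / r') * h by ring.
  by apply: Rmult_le_compat_r; [lra|rewrite /C'; lra].
- apply: Rle_trans h2 _; rewrite /Rdiv err.
  have -> : C * (h * h * / (r' * r')) = (C * / (r' * r')) * (h * h) by ring.
  by apply: Rmult_le_compat_r; [lra|rewrite /C'; lra].
move=> l s hs hsr.
have sp : 0 < IZR s by apply: (IZR_lt 0); lia.
have hse : IZR s <= eta * rad.
  apply: (Rmult_le_reg_l h); first lra.
  have -> : h * (eta * rad) = r' * eta by rewrite -hrad; ring.
  nra.
apply: Rle_trans (h3 l s hs hse) _; rewrite /Rdiv err.
have -> : IZR s * / rad = / r' * (h * IZR s) by rewrite er; ring.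
rewrite -Rpower_mult_distr //; last by positivity.
set t := Rpower (h * IZR s) al; have t0 : 0 < t by apply: Rpower_pos.
have -> : C * (Rpower (/ r') al * t) * (h * h * / (r' * r')) = (C * P * / (r' * r')) * (h * h) * t by rewrite /P; ring.
apply: Rmult_le_compat_r; first lra.
by apply: Rmult_le_compat_r; [lra|rewrite /C'; lra].
Qed.

(** * Boundary barriers *)

Lemma derivable_pt_lim_eq f g x l : (forall t, f t = g t) -> derivable_pt_lim f x l -> derivable_pt_lim g x l.
Proof. by move=> /functional_extensionality ->. Qed.

(** The mean value theorem for the even function [G] and then for [f']: a one-sided bound on [f'']
    is enough, without continuity of [f'']. *)
Lemma second_diff_le f f' f'' t0 h q : 0 < h ->
  (forall t, Rabs (t - t0) <= h -> [/\ derivable_pt_lim f t (f' t), derivable_pt_lim f' t (f'' t) & f'' t <= q]) ->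
  f (t0 + h) + f (t0 - h) - 2 * f t0 <= q * (h * h).
Proof.
move=> hh H.
pose G t := f (t0 + t) + f (t0 - t) - q * (t * t).
pose G' t := f' (t0 + t) - f' (t0 - t) - 2 * q * t.
have dG c : 0 <= c <= h -> derivable_pt_lim G c (G' c).
  move=> hc.
  have [d1 _ _] := H (t0 + c) ltac:(split_Rabs; lra).
  have [d2 _ _] := H (t0 - c) ltac:(split_Rabs; lra).
  have p1 : derivable_pt_lim (fun t => t0 + t) c 1.
    have -> : 1 = 0 + 1 by ring.
    by apply: derivable_pt_lim_plus; [exact: derivable_pt_lim_const|exact: derivable_pt_lim_id].
  have p2 : derivable_pt_lim (fun t => t0 - t) c (-1).
    have -> : -1 = 0 - 1 by ring.
    by apply: derivable_pt_lim_minus; [exact: derivable_pt_lim_const|exact: derivable_pt_lim_id].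
  have c1 := derivable_pt_lim_comp _ _ c _ _ p1 d1.
  have c2 := derivable_pt_lim_comp _ _ c _ _ p2 d2.
  have c3 : derivable_pt_lim (fun t => q * (t * t)) c (q * (1 * c + c * 1)).
    apply: (derivable_pt_lim_scal (fun t => t * t)).
    by apply: (derivable_pt_lim_mult id id); exact: derivable_pt_lim_id.
  have := derivable_pt_lim_minus _ _ _ _ _ (derivable_pt_lim_plus _ _ _ _ _ c1 c2) c3.
  have -> : f' (t0 + c) * 1 + f' (t0 - c) * -1 - q * (1 * c + c * 1) = G' c by rewrite /G'; ring.
  exact: derivable_pt_lim_eq.
have [c [e hc]] := MVT_cor2 G G' 0 h hh dG.
have G'le : G' c <= 0.
  have [xi [e2 hxi]] := MVT_cor2 f' f'' (t0 - c) (t0 + c) ltac:(lra)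
    (fun t ht => let: And3 _ h2 _ := H t ltac:(split_Rabs; lra) in h2).
  have [_ _ h3] := H xi ltac:(split_Rabs; lra).
  rewrite /G' e2; have -> : t0 + c - (t0 - c) = 2 * c by ring.
  by have := Rmult_le_compat_r (2 * c) _ _ ltac:(lra) h3; lra.
have : G h - G 0 <= 0 by rewrite e; nra.
by rewrite /G Rplus_0_r Rminus_0_r; lra.
Qed.

Lemma mvt_abs f f' L a b :
  (forall t, Rabs (t - a) <= Rabs (b - a) -> derivable_pt_lim f t (f' t) /\ Rabs (f' t) <= L) ->
  Rabs (f b - f a) <= L * Rabs (b - a).
Proof.
move=> H; case: (Rtotal_order a b) => [ab|[<-|ba]].
- have [c [-> hc]] := MVT_cor2 f f' a b ab (fun t ht => (H t ltac:(split_Rabs; lra)).1).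
  rewrite Rabs_mult; apply: Rmult_le_compat_r; first exact: Rabs_pos.
  by apply: (H c _).2; split_Rabs; lra.
- by rewrite !Rminus_diag_eq // Rabs_R0; lra.
have [c [e hc]] := MVT_cor2 f f' b a ba (fun t ht => (H t ltac:(split_Rabs; lra)).1).
rewrite (Rabs_minus_sym (f b)) e (Rabs_minus_sym b) Rabs_mult; apply: Rmult_le_compat_r; first exact: Rabs_pos.
by apply: (H c _).2; split_Rabs; lra.
Qed.

Section Upd.
Context {N : nat}.
Implicit Types x y : RN N.
Lemma upd_i x i t : upd x i t i = t. Proof. by rewrite /upd eqxx. Qed.
Lemma upd_upd x i s t : upd (upd x i s) i t = upd x i t.
Proof. by apply: functional_extensionality => j; rewrite /upd; case: eqP. Qed.
Lemma upd_id x i : upd x i (x i) = x.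
Proof. by apply: functional_extensionality => j; rewrite /upd; case: eqP => [->|]. Qed.

Lemma has_partial_upd i f x t l : has_partial i f (upd x i t) l -> derivable_pt_lim (fun s => f (upd x i s)) t l.
Proof.
rewrite /has_partial upd_i; apply: derivable_pt_lim_eq => s; by rewrite upd_upd.
Qed.

End Upd.

Definition box {N} (x0 : RN N) (r : R) (x : RN N) : Prop := forall i, Rabs (x i - x0 i) < r.

Lemma box_upd {N} (x0 x : RN N) r i t : box x0 r x -> Rabs (t - x0 i) < r -> box x0 r (upd x i t).
Proof. by move=> H ht j; rewrite /upd; case: eqP => [->|_]. Qed.

Lemma box_le {N} (x0 x : RN N) r r' : r <= r' -> box x0 r x -> box x0 r' x.
Proof. by move=> h H i; have := H i; lra. Qed.

Lemma box_dist {N} (x0 x : RN N) r d : INR N * r < d -> box x0 r x -> dist x0 x < d.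
Proof.
move=> h H; apply: Rle_lt_trans h; rewrite dist_sym; apply: dist_box => i.
by apply: Rlt_le; apply: H.
Qed.

Lemma box_small (N : nat) d : 0 < d -> exists r, 0 < r /\ forall x0 x : RN N, box x0 r x -> dist x0 x < d.
Proof.
move=> hd; have HN := pos_INR N; exists (d / (INR N + 1)).
have h : 0 < d / (INR N + 1) by positivity.
split=> // x0 x; apply: box_dist.
have -> : INR N * (d / (INR N + 1)) = d - d / (INR N + 1) by field; lra.
lra.
Qed.

(** [M1 W] is a supersolution that exceeds [Mx] on the sides of the box. A lattice point just
    outside [Omega] may have [W < 0], but it is one step away from a point where [W >= 0], so
    [W >= - Lw h] there; hence the added [Lw h], which tends to 0 with the mesh. *)
Lemma barrier_bound {N} (Omega : RN N -> Prop) (a c : RN N -> R) Mx A (x0 : RN N) (W : RN N -> R)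
  (DW Dii : 'I_N -> RN N -> R) (q : 'I_N -> R) r1 Lw :
  0 < Mx -> 0 < r1 -> 0 <= Lw -> 0 < A ->
  (forall x, Omega x -> 0 < a x <= A) -> (forall x, Omega x -> 0 < c x) ->
  (forall x i, box x0 r1 x -> [/\ has_partial i W x (DW i x), has_partial i (DW i) x (Dii i x),
      Dii i x <= q i & Rabs (DW i x) <= Lw]) ->
  \sum_(i < N) q i <= -1 ->
  (forall x, Omega x -> box x0 r1 x -> forall i, (x i - x0 i) * (x i - x0 i) <= W x) ->
  (forall e, 0 < e -> exists d, 0 < d /\ forall x, box x0 d x -> W x <= e) ->
  forall e, 0 < e -> exists d h0, 0 < d /\ 0 < h0 /\ forall h u, 0 < h <= h0 -> scheme Omega a c Mx h u ->
    forall k, Omega (pt h k) -> box x0 d (pt h k) -> u k <= e.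
Proof.
move=> HMx Hr1 HLw HA Ha Hc HW Hq HWlow HWc e He.
set r2 := r1 / 2; have Hr2 : 0 < r2 by rewrite /r2; lra.
set M1 := A + 1 + Mx / (r2 * r2).
have rr : 0 < r2 * r2 by nra.
have Mr : 0 < Mx / (r2 * r2) by positivity.
have M10 : 0 < M1 by rewrite /M1; lra.
have [d [Hd HWd]] := HWc (e / (2 * M1)) ltac:(positivity).
set h0 := Rmin (r2 / 2) (e / (2 * M1 * (Lw + 1))).
have ML : 0 < 2 * M1 * (Lw + 1) by positivity.
exists (Rmin d r2), h0; split; first by apply: Rmin_glb_lt.
split; first by apply: Rmin_glb_lt; [lra|apply: Rdiv_lt_0_compat].
move=> h u [hh hh0] Hs k0 O0 bk0.
have hr2 : h <= r2 / 2 by apply: Rle_trans hh0 _; apply: Rmin_l.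
have hLe : M1 * (Lw * h) <= e / 2.
  have h1 : h <= e / (2 * M1 * (Lw + 1)) by apply: Rle_trans hh0 _; apply: Rmin_r.
  have : (2 * M1 * (Lw + 1)) * h <= e.
    have -> : e = 2 * M1 * (Lw + 1) * (e / (2 * M1 * (Lw + 1))) by field; lra.
    by apply: Rmult_le_compat_l; lra.
  have := Rmult_lt_0_compat _ _ M10 hh; lra.
pose V k := M1 * (W (pt h k) + Lw * h).
pose P k := Omega (pt h k) /\ box x0 r2 (pt h k).
have finP : fin P by apply: fin_sub (fin_pt h x0 r2 hh) => k [_ hk] i; apply: Rlt_le.
have seg k i t : box x0 r2 (pt h k) -> Rabs (t - pt h k i) <= h -> box x0 r1 (upd (pt h k) i t).
  move=> hk ht; apply: box_upd; first by apply: box_le hk; rewrite /r2; lra.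
  by have := hk i; rewrite /r2 in hr2 *; move: ht; split_Rabs; lra.
have sh_upd k i s : pt h (sh i s k) = upd (pt h k) i (pt h k i + h * IZR s) by rewrite pt_sh.
have main : forall k, P k -> u k <= V k.
  apply: (upper_comparison u V (fun k => h * h * a (pt h k)) P finP).
    move=> k [Ok bk]; have [_ _ /(_ Ok) [hu ->]] := Hs k.
    have ha := Ha _ Ok; have hc := Hc _ Ok.
    have hh2 : 0 < h * h by nra.
    split; last first.
      have : 0 <= c (pt h k) / u k * upg u k.
        apply: Rmult_le_pos; first by positivity.
        by apply: sum_ge0 => i; apply: Rplus_le_le_0_compat; apply: Rle_0_sqr.
      lra.
    have LV : lap V k <= M1 * (\sum_(i < N) (h * h * q i)).
      rewrite -sum_scal; apply: sum_le => i.
      have := second_diff_le (fun t => W (upd (pt h k) i t)) (fun t => DW i (upd (pt h k) i t))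
        (fun t => Dii i (upd (pt h k) i t)) (pt h k i) h (q i) hh.
      rewrite upd_id /V !sh_upd => H.
      have {}H := H (fun t ht => let: And4 p1 p2 p3 _ := HW _ i (seg k i t bk ht) in And3 (has_partial_upd _ _ _ _ _ p1) (has_partial_upd _ _ _ _ _ p2) p3).
      have e1 : pt h k i + h * IZR 1 = pt h k i + h by rewrite Rmult_1_r.
      have e2 : pt h k i + h * IZR (-1) = pt h k i - h by ring.
      rewrite e1 e2.
      have := Rmult_le_compat_l _ _ _ (Rlt_le _ _ M10) H; lra.
    have : M1 * (\sum_(i < N) (h * h * q i)) <= - (M1 * (h * h)).
      by rewrite sum_scal; have := Rmult_le_compat_l (M1 * (h * h)) _ _ ltac:(nra) Hq; lra.
    have : h * h * a (pt h k) <= h * h * A by apply: Rmult_le_compat_l; lra.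
    have : h * h * A < h * h * M1 by apply: Rmult_lt_compat_l => //; rewrite /M1; lra.
    lra.
  move=> k i s hs [Ok bk] nP.
  have s1 : Rabs (pt h k i + h * IZR s - pt h k i) = h.
    have -> : pt h k i + h * IZR s - pt h k i = h * IZR s by ring.
    by rewrite Rabs_mult -abs_IZR hs Rabs_pos_eq; lra.
  have by1 : box x0 r1 (pt h (sh i s k)) by rewrite sh_upd; apply: seg => //; lra.
  have Lh : 0 <= Lw * h by positivity.
  case: (classic (Omega (pt h (sh i s k)))) => Oy; last first.
    have [_ /(_ Oy) -> _] := Hs (sh i s k); rewrite /V; apply: Rmult_le_pos; first lra.
    suff Wl : Rabs (W (pt h (sh i s k)) - W (pt h k)) <= Lw * h.
      have bk1 : box x0 r1 (pt h k) by apply: box_le bk; rewrite /r2; lra.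
      have := HWlow _ Ok bk1 i; have := Rle_0_sqr (pt h k i - x0 i).
      by rewrite /Rsqr; move: Wl; split_Rabs; lra.
    have := mvt_abs (fun t => W (upd (pt h k) i t)) (fun t => DW i (upd (pt h k) i t)) Lw
      (pt h k i) (pt h k i + h * IZR s).
    rewrite s1 upd_id -sh_upd; apply=> t ht.
    have [p1 _ _ p4] := HW _ i (seg k i t bk ltac:(lra)); split=> //.
    exact: has_partial_upd p1.
  have [j hj] : exists j, r2 <= Rabs (pt h (sh i s k) j - x0 j).
    by apply: NNPP => no; apply: nP; split=> // j; apply: Rnot_le_lt => h'; apply: no; exists j.
  have Wy := HWlow _ Oy by1 j.
  have r2le : r2 * r2 <= (pt h (sh i s k) j - x0 j) * (pt h (sh i s k) j - x0 j).
    by rewrite -[X in _ <= X]Rabs_pos_eq; [rewrite Rabs_mult; apply: Rmult_le_compat; lra|exact: Rle_0_sqr].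
  have [_ _ /(_ Oy) [hu _]] := Hs (sh i s k); rewrite /V.
  have h1 : Mx <= M1 * (r2 * r2).
    rewrite /M1; have -> : (A + 1 + Mx / (r2 * r2)) * (r2 * r2) = (A + 1) * (r2 * r2) + Mx by field; lra.
    nra.
  by have := Rmult_le_compat_l M1 _ _ (Rlt_le _ _ M10) (Rle_trans _ _ _ r2le Wy); nra.
have bd : box x0 d (pt h k0) by apply: box_le bk0; apply: Rmin_l.
have br : box x0 r2 (pt h k0) by apply: box_le bk0; apply: Rmin_r.
apply: Rle_trans (main k0 (conj O0 br)) _; rewrite /V.
have := Rmult_le_compat_l _ _ _ (Rlt_le _ _ M10) (HWd _ bd).
have -> : M1 * (e / (2 * M1)) = e / 2 by field; lra.
lra.
Qed.

Lemma fin_delta {N} (P : 'I_N -> R -> Prop) : (forall i, exists d, 0 < d /\ P i d) ->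
  (forall i d d', 0 < d' -> d' <= d -> P i d -> P i d') -> exists d, 0 < d /\ forall i, P i d.
Proof.
move=> H mono.
have [d [hd Hd]] : exists d, 0 < d /\ forall i, i \in enum 'I_N -> P i d.
  elim: (enum 'I_N) => [|i s [d [hd IH]]]; first by exists 1; split=> //; lra.
  have [d' [hd' Hd']] := H i; exists (Rmin d d'); split; first exact: Rmin_glb_lt.
  have m0 : 0 < Rmin d d' by apply: Rmin_glb_lt.
  move=> j; rewrite inE => /orP[/eqP ->|/IH hj].
    by apply: (mono i d') => //; exact: Rmin_r.
  by apply: (mono j d) => //; exact: Rmin_l.
by exists d; split=> // i; apply: Hd; rewrite mem_enum.
Qed.

(** One coordinate is switched at a time, so that one-dimensional estimates suffice. The
    intermediate points mix coordinates of [x] and [y]; a box around [x0] that contains [x] and [y]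
    contains them, while a ball need not. This is why neighbourhoods are boxes. *)
Lemma path_bound {N} (f : RN N -> R) (x y : RN N) e :
  (forall z i, (forall j, z j = x j \/ z j = y j) -> z i = x i -> Rabs (f (upd z i (y i)) - f z) <= e) ->
  Rabs (f y - f x) <= INR N * e.
Proof.
move=> H; pose mix (m : nat) : RN N := fun j => if (j < m)%N then y j else x j.
have mixN : mix N = y by apply: functional_extensionality => j; rewrite /mix ltn_ord.
suff : forall m, (m <= N)%N -> Rabs (f (mix m) - f x) <= INR m * e by move/(_ N (leqnn N)); rewrite mixN.
elim=> [_|m IH hm].
  have -> : mix 0%N = x by apply: functional_extensionality => j; rewrite /mix.
  by rewrite Rminus_diag_eq // Rabs_R0 /=; lra.
have {}IH := IH (ltnW hm); pose i := Ordinal hm.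
have e1 : mix m.+1 = upd (mix m) i (y i).
  apply: functional_extensionality => j; rewrite /mix /upd ltnS leq_eqVlt.
  have -> : (nat_of_ord j == m) = (j == i) by [].
  by case: eqP => [->|].
have := H (mix m) i (fun j => ltac:(rewrite /mix; case: ifP; auto)) ltac:(by rewrite /mix /= ltnn).
by rewrite -e1 S_INR; split_Rabs; lra.
Qed.

Definition cont_at {N} (f : RN N -> R) (x0 : RN N) : Prop :=
  forall e, 0 < e -> exists d, 0 < d /\ forall x, box x0 d x -> Rabs (f x - f x0) <= e.

Section ContAt.
Context {N : nat} (x0 : RN N).
Implicit Types f g : RN N -> R.

Lemma cont_at_const k : cont_at (fun _ : RN N => k) x0.
Proof. by move=> e he; exists 1; split=> [|x _]; [lra|rewrite Rminus_diag_eq // Rabs_R0; lra]. Qed.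

Lemma cont_at_coord i : cont_at (fun x : RN N => x i) x0.
Proof. by move=> e he; exists e; split=> // x hx; apply: Rlt_le; apply: hx. Qed.

Lemma cont_at_two f g e : 0 < e -> cont_at f x0 -> cont_at g x0 -> exists d, 0 < d /\
  forall x, box x0 d x -> Rabs (f x - f x0) <= e /\ Rabs (g x - g x0) <= e.
Proof.
move=> he /(_ e he) [d [hd Hd]] /(_ e he) [d' [hd' Hd']].
exists (Rmin d d'); split; first exact: Rmin_glb_lt.
move=> x hx; split; [apply: Hd|apply: Hd']; apply: box_le hx; [exact: Rmin_l|exact: Rmin_r].
Qed.

Lemma cont_at_add f g : cont_at f x0 -> cont_at g x0 -> cont_at (fun x => f x + g x) x0.
Proof.
move=> Hf Hg e he; have [d [hd H]] := cont_at_two f g (e / 2) ltac:(lra) Hf Hg.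
exists d; split=> // x /H [h1 h2]; move: h1 h2; split_Rabs; lra.
Qed.

Lemma cont_at_mul f g : cont_at f x0 -> cont_at g x0 -> cont_at (fun x => f x * g x) x0.
Proof.
move=> Hf Hg e he.
set M := Rabs (f x0) + Rabs (g x0) + 1.
have M1 : 1 <= M by rewrite /M; have := Rabs_pos (f x0); have := Rabs_pos (g x0); lra.
set e' := Rmin 1 (e / (2 * M)).
have he' : 0 < e' by apply: Rmin_glb_lt; [lra|apply: Rdiv_lt_0_compat; lra].
have e1 : e' <= 1 by apply: Rmin_l.
have e2 : e' * (2 * M) <= e.
  have -> : e = e / (2 * M) * (2 * M) by field; lra.
  by apply: Rmult_le_compat_r; [lra|apply: Rmin_r].
have [d [hd H]] := cont_at_two f g e' he' Hf Hg.
exists d; split=> // x /H [h1 h2].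
have b1 : Rabs (f x) <= M by rewrite /M; have := Rabs_pos (g x0); move: h1; split_Rabs; lra.
have b2 : Rabs (g x0) <= M by rewrite /M; have := Rabs_pos (f x0); lra.
have := Rabs_mul_sub _ _ _ _ _ _ _ _ b1 b2 h1 h2; lra.
Qed.

Lemma cont_at_sub f g : cont_at f x0 -> cont_at g x0 -> cont_at (fun x => f x - g x) x0.
Proof.
move=> Hf Hg e he; have [d [hd H]] := cont_at_two f g (e / 2) ltac:(lra) Hf Hg.
exists d; split=> // x /H [h1 h2]; move: h1 h2; split_Rabs; lra.
Qed.

Lemma cont_at_sum (F : 'I_N -> RN N -> R) : (forall i, cont_at (F i) x0) ->
  cont_at (fun x => \sum_(i < N) F i x) x0.
Proof.
move=> H e he; have HN := pos_INR N.
have he' : 0 < e / (INR N + 1) by positivity.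
have [d [hd Hd]] := fin_delta (fun i d => forall x, box x0 d x -> Rabs (F i x - F i x0) <= e / (INR N + 1))
  (fun i => H i _ he') (fun i d d' _ hdd Hi x hx => Hi x (box_le _ _ _ _ hdd hx)).
exists d; split=> // x hx; rewrite -sum_sub.
apply: Rle_trans (sum_abs_le_const _ _ (fun i => Hd i x hx)) _.
have -> : INR N * (e / (INR N + 1)) = e - e / (INR N + 1) by field; lra.
lra.
Qed.

Lemma cont_on_at (U : RN N -> Prop) f r : 0 < r -> (forall x, box x0 r x -> U x) -> cont_on U f -> cont_at f x0.
Proof.
move=> hr HU Hf e he.
have U0 : U x0 by apply: HU => i; rewrite Rminus_diag_eq // Rabs_R0.
have [d [hd Hd]] := Hf x0 U0 e he.
have [d' [hd' Hd']] := box_small N d hd.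
exists (Rmin r d'); split; first exact: Rmin_glb_lt.
move=> x hx; apply: Rlt_le; apply: Hd.
  by apply: HU; apply: box_le hx; apply: Rmin_l.
by apply: Hd'; apply: box_le hx; apply: Rmin_r.
Qed.
End ContAt.

Lemma derivable_lim_bound f t0 l : derivable_pt_lim f t0 l -> exists d, 0 < d /\
  forall t, Rabs (t - t0) < d -> Rabs (f t - f t0) <= (Rabs l + 1) * Rabs (t - t0).
Proof.
move=> H; have [d Hd] := H 1 Rlt_0_1.
exists d; split; first exact: cond_pos.
move=> t ht; case: (Req_dec t t0) => [->|ne].
  by rewrite !Rminus_diag_eq // Rabs_R0; lra.
have := Hd (t - t0) ltac:(lra) ht.
have -> : t0 + (t - t0) = t by ring.
set s := t - t0 => h.
have s0 : s <> 0 by rewrite /s; lra.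
have -> : f t - f t0 = (f t - f t0) / s * s by field.
rewrite Rabs_mult; apply: Rmult_le_compat_r; first exact: Rabs_pos.
by move: h; split_Rabs; lra.
Qed.

(** A substitute for the chain rule on [psi (phi y) = y]. Move [y0] by [s] in the direction [i0]:
    the preimage moves by at most [C s], since [phi] has a partial derivative there, while a
    vanishing gradient would let the coordinate [i0] of [psi] change by [o(s)] only, not by [s]. *)
Lemma chart_gradient {N} (B : RN N -> Prop) al (x0 : RN N) (i0 : 'I_N) r (psi phi : RN N -> RN N)
  (Dg : 'I_N -> RN N -> R) :
  0 < r -> (forall x, box x0 r x -> B x) ->
  is_open (fun y => exists x, B x /\ psi x = y) ->
  (forall x, B x -> phi (psi x) = x) ->
  C2a_vec (fun y => exists x, B x /\ psi x = y) al phi ->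
  (forall x, box x0 r x -> forall i, has_partial i (fun x => psi x i0) x (Dg i x)) ->
  (forall i, cont_at (Dg i) x0) ->
  exists i, Dg i x0 <> 0.
Proof.
move=> hr HB Hop Hinv Hphi Hg Hcont; apply: NNPP => no.
have Dg0 i : Dg i x0 = 0 by apply: NNPP => h; apply: no; exists i.
have HN : 0 < INR N by apply: (lt_INR 0); apply/ltP; apply: leq_ltn_trans (ltn_ord i0).
have B0 : B x0 by apply: HB => i; rewrite Rminus_diag_eq // Rabs_R0.
set y0 := psi x0.
have Dy0 : exists x, B x /\ psi x = y0 by exists x0.
have [r' [hr' Hr']] := Hop y0 Dy0.
have Hl k : exists l, derivable_pt_lim (fun t => phi (upd y0 i0 t) k) (y0 i0) l.
  by have [Dp [D2p [H1 _]]] := Hphi k; exists (Dp i0 y0); exact: H1.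
have [l Hl'] : exists l : 'I_N -> R, forall k, derivable_pt_lim (fun t => phi (upd y0 i0 t) k) (y0 i0) (l k).
  exists (fun k => proj1_sig (ClassicalEpsilon.constructive_indefinite_description _ (Hl k))) => k.
  by case: ClassicalEpsilon.constructive_indefinite_description.
set C := \sum_(k < N) Rabs (l k) + 1.
have HC k : Rabs (l k) + 1 <= C by rewrite /C; have := sum_term (fun k => Rabs (l k)) k (fun k => Rabs_pos _) => /=; lra.
have C0 : 0 < C by have := HC i0; have := Rabs_pos (l i0); lra.
have [d [hd Hd]] := fin_delta (fun k d => forall t, Rabs (t - y0 i0) < d ->
   Rabs (phi (upd y0 i0 t) k - phi (upd y0 i0 (y0 i0)) k) <= (Rabs (l k) + 1) * Rabs (t - y0 i0))
   (fun k => derivable_lim_bound _ _ _ (Hl' k)) (fun k d d' _ hdd H t ht => H t (Rlt_le_trans _ _ _ ht hdd)).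
(* With this [eta] the coordinate [i0] would change by at most [s / 2], although it changes by
   [s]. *)
set eta := / (2 * INR N * C).
have NC : 0 < 2 * INR N * C by nra.
have he : 0 < eta by apply: Rinv_0_lt_compat.
have [rho [hrho Hrho]] := fin_delta (fun i d => forall x, box x0 d x -> Rabs (Dg i x - Dg i x0) <= eta)
   (fun i => Hcont i _ he) (fun i d d' _ hdd Hi x hx => Hi x (box_le _ _ _ _ hdd hx)).
set rr := Rmin r rho; have hrr : 0 < rr by apply: Rmin_glb_lt.
set s := Rmin (Rmin (d / 2) (r' / 2)) (rr / (2 * C)).
have hs : 0 < s by rewrite /s; repeat (apply: Rmin_glb_lt); try lra; apply: Rdiv_lt_0_compat; lra.
have s1 : s < d by have := Rmin_l (Rmin (d / 2) (r' / 2)) (rr / (2 * C)); have := Rmin_l (d / 2) (r' / 2); rewrite -/s; lra.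
have s2 : s < r' by have := Rmin_l (Rmin (d / 2) (r' / 2)) (rr / (2 * C)); have := Rmin_r (d / 2) (r' / 2); rewrite -/s; lra.
have s3 : C * s < rr.
  apply: (Rle_lt_trans _ (C * (rr / (2 * C)))); first by apply: Rmult_le_compat_l; [lra|exact: Rmin_r].
  have -> : C * (rr / (2 * C)) = rr / 2 by field; lra.
  lra.
set t := y0 i0 + s; have ts : t - y0 i0 = s by rewrite /t; ring.
have [x [Bx ex]] : exists x, B x /\ psi x = upd y0 i0 t.
  apply: Hr'; apply: Rle_lt_trans (dist_upd _ _ _) _; rewrite ts Rabs_pos_eq; lra.
have Hx k : Rabs (x k - x0 k) <= C * s.
  have := Hd k t ltac:(rewrite ts Rabs_pos_eq; lra).
  rewrite -ex upd_id Hinv // /y0 Hinv // -/y0 ts (Rabs_pos_eq s); last lra.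
  by have := Rmult_le_compat_r s _ _ ltac:(lra) (HC k); lra.
have P : Rabs (psi x i0 - psi x0 i0) <= INR N * (eta * (C * s)).
  apply: (path_bound (fun x => psi x i0)) => z i hz hzi.
  have zb : box x0 rr z.
    move=> j; case: (hz j) => ->; first by rewrite Rminus_diag_eq // Rabs_R0.
    by have := Hx j; lra.
  have := mvt_abs (fun t => psi (upd z i t) i0) (fun t => Dg i (upd z i t)) eta (z i) (x i).
  rewrite upd_id => H; apply: (Rle_trans _ (eta * Rabs (x i - z i))).
    apply: H => t' ht'; have hb : box x0 rr (upd z i t').
      by apply: box_upd => //; have := Hx i; rewrite hzi in ht'; move: ht'; split_Rabs; lra.
    split; first by apply: (has_partial_upd i (fun x => psi x i0)); apply: Hg; apply: box_le hb; apply: Rmin_l.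
    by have := Hrho i _ (box_le _ _ _ _ (Rmin_r _ _) hb); rewrite Dg0 Rminus_0_r.
  by apply: Rmult_le_compat_l; [lra|rewrite hzi; exact: Hx].
move: P; rewrite ex upd_i -/y0 ts Rabs_pos_eq; last lra.
have -> : INR N * (eta * (C * s)) = s / 2 by rewrite /eta; field; lra.
lra.
Qed.

Lemma norm2_upd {N} (x x0 : RN N) i t : norm2 (fun j => upd x i t j - x0 j) =
  norm2 (fun j => x j - x0 j) - (x i - x0 i) * (x i - x0 i) + (t - x0 i) * (t - x0 i).
Proof.
have := sum_diff1 (fun j => (upd x i t j - x0 j) * (upd x i t j - x0 j)) (fun j => (x j - x0 j) * (x j - x0 j)) i.
rewrite upd_i /norm2 => H.
have {}H := H (fun j (ji : j != i) => ltac:(by rewrite /upd (negbTE ji))).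
lra.
Qed.

(* The barrier [g - K g^2 + |x - x0|^2], where [g] is the first coordinate of the
   boundary chart: the term [- K g^2] contributes [- 2 K |grad g|^2] to its
   Laplacian at [x0], and [grad g (x0) <> 0]. *)
Lemma scheme_boundary {N} (Omega : RN N -> Prop) al (a c : RN N -> R) Mx A (x0 : RN N) :
  (0 < N)%nat -> 0 < Mx -> 0 < A ->
  (forall x, Omega x -> 0 < a x <= A) -> (forall x, Omega x -> 0 < c x) ->
  C2a_boundary Omega al -> boundary Omega x0 ->
  forall e, 0 < e -> exists d h0, 0 < d /\ 0 < h0 /\ forall h u, 0 < h <= h0 -> scheme Omega a c Mx h u ->
    forall k, Omega (pt h k) -> box x0 d (pt h k) -> u k <= e.
Proof.
move=> NN HMx HA Ha Hc Hbd bx0.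
have [r [psi [phi [hr [Hop [Hinv [Hpos [Hzero [Hpsi Hphi]]]]]]]]] := Hbd x0 bx0.
pose i0 : 'I_N := Ordinal NN.
have [Dg [D2g [p1 [p2 [cg [cDg [cD2g _]]]]]]] := Hpsi i0.
have [rb [hrb Hrb]] := box_small N r hr.
have HB x : box x0 rb x -> ball x0 r x by exact: Hrb.
have B0 : ball x0 r x0 by rewrite /ball dist_xx.
have [i1 hi1] : exists i, Dg i x0 <> 0.
  apply: (chart_gradient (ball x0 r) al x0 i0 rb psi phi Dg) => //.
    by move=> x /HB hx i; apply: p1.
  by move=> i; apply: (cont_on_at x0 _ _ rb hrb HB).
pose g x := psi x i0.
have g0 : g x0 = 0 by apply: (Hzero x0 B0 bx0 i0).
have gpos x : ball x0 r x -> Omega x -> 0 < g x by move=> Bx Ox; apply: (Hpos x Bx Ox i0).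
set S := \sum_(i < N) (Dg i x0 * Dg i x0).
have HS : 0 < S.
  apply: (Rlt_le_trans _ (Dg i1 x0 * Dg i1 x0)); first by nra.
  by apply: (sum_term (fun i => Dg i x0 * Dg i x0)) => j; apply: Rle_0_sqr.
set Lp := \sum_(i < N) D2g i i x0.
have HN := pos_INR N.
(* [3 N] is [2 N] from the Laplacian of [|x - x0|^2] plus the slack 1 in each [q i]; the final 1
   makes the sum of the [q i] at most [-1]. *)
set K := (Rabs Lp + 3 * INR N + 1) / (2 * S).
have HK : 0 < K by apply: Rdiv_lt_0_compat; have := Rabs_pos Lp; lra.
have KS : 2 * K * S = Rabs Lp + 3 * INR N + 1 by rewrite /K; field; lra.
pose W x := g x - K * (g x * g x) + norm2 (fun i => x i - x0 i).
pose DW i x := Dg i x * (1 - 2 * K * g x) + 2 * (x i - x0 i).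
pose Dii i x := D2g i i x * (1 - 2 * K * g x) + Dg i x * (- 2 * K * Dg i x) + 2.
pose q i := Dii i x0 + 1.
have cg0 : cont_at g x0 by apply: (cont_on_at x0 _ _ rb hrb HB).
have cD0 i : cont_at (Dg i) x0 by apply: (cont_on_at x0 _ _ rb hrb HB).
have cDD0 i : cont_at (D2g i i) x0 by apply: (cont_on_at x0 _ _ rb hrb HB).
have c1 : cont_at (fun x => 1 - 2 * K * g x) x0.
  by apply: cont_at_sub; [exact: cont_at_const|apply: cont_at_mul => //; exact: cont_at_const].
have cDW i : cont_at (DW i) x0.
  apply: cont_at_add; first exact: cont_at_mul.
  apply: cont_at_mul; first exact: cont_at_const.
  by apply: cont_at_sub; [exact: cont_at_coord|exact: cont_at_const].
have cDii i : cont_at (Dii i) x0.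
  apply: cont_at_add; last exact: cont_at_const.
  apply: cont_at_add; first exact: cont_at_mul.
  by apply: cont_at_mul => //; apply: cont_at_mul => //; exact: cont_at_const.
have cW : cont_at W x0.
  apply: cont_at_add.
    apply: cont_at_sub => //; apply: cont_at_mul; first exact: cont_at_const.
    exact: cont_at_mul.
  apply: (cont_at_sum x0 (fun i x => (x i - x0 i) * (x i - x0 i))) => i.
  have cc : cont_at (fun x : RN N => x i - x0 i) x0.
    by apply: cont_at_sub; [exact: cont_at_coord|exact: cont_at_const].
  exact: (cont_at_mul x0 _ _ cc cc).
have W0 : W x0 = 0.
  have -> : W x0 = norm2 (fun i => x0 i - x0 i) by rewrite /W g0; ring.
  by rewrite /norm2 (sum_ext _ (fun=> 0)) ?sum_const => [|i]; ring.
set Lw := \sum_(i < N) Rabs (DW i x0) + 1.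
have HLw i : Rabs (DW i x0) + 1 <= Lw.
  apply: Rplus_le_compat_r.
  exact: (sum_term (fun i => Rabs (DW i x0)) i (fun i => Rabs_pos _)).
have Lw0 : 0 <= Lw by have := HLw i0; have := Rabs_pos (DW i0 x0); lra.
have [r2 [hr2 Hr2]] := fin_delta (fun i d => forall x, box x0 d x -> Rabs (Dii i x - Dii i x0) <= 1 /\ Rabs (DW i x - DW i x0) <= 1)
  (fun i => cont_at_two x0 _ _ 1 Rlt_0_1 (cDii i) (cDW i)) (fun i d d' _ hdd Hi x hx => Hi x (box_le _ _ _ _ hdd hx)).
have iK : 0 < / K by positivity.
(* In [Omega], where [g > 0], the bound [g <= / K] makes [g - K g^2] nonnegative, so that [W]
   dominates [|x - x0|^2]. *)
have [r3 [hr3 Hr3]] := cg0 (/ K) iK.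
set r1 := Rmin rb (Rmin r2 r3).
have hr1 : 0 < r1 by do 2 apply: Rmin_glb_lt => //.
have b1 x : box x0 r1 x -> ball x0 r x by move=> hx; apply: HB; apply: box_le hx; apply: Rmin_l.
have b2 x : box x0 r1 x -> box x0 r2 x.
  by apply: box_le; apply: Rle_trans (Rmin_r _ _) _; apply: Rmin_l.
have b3 x : box x0 r1 x -> box x0 r3 x.
  by apply: box_le; apply: Rle_trans (Rmin_r _ _) _; apply: Rmin_r.
have n2 (x : RN N) i : (x i - x0 i) * (x i - x0 i) <= norm2 (fun i => x i - x0 i).
  by apply: (sum_term (fun i => (x i - x0 i) * (x i - x0 i))) => j; apply: Rle_0_sqr.
apply: (barrier_bound Omega a c Mx A x0 W DW Dii q r1 Lw) => //.
- move=> x i hx; have Bx := b1 x hx.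
  have dg : derivable_pt_lim (fun t => g (upd x i t)) (x i) (Dg i x) by apply: p1.
  have dDg : derivable_pt_lim (fun t => Dg i (upd x i t)) (x i) (D2g i i x) by apply: p2.
  have did : derivable_pt_lim (fun t => t - x0 i) (x i) 1.
    have -> : 1 = 1 - 0 by ring.
    by apply: derivable_pt_lim_minus; [exact: derivable_pt_lim_id|exact: derivable_pt_lim_const].
  have dW : has_partial i W x (DW i x).
    have e1 : derivable_pt_lim (fun t => K * (g (upd x i t) * g (upd x i t))) (x i)
        (K * (Dg i x * g (upd x i (x i)) + g (upd x i (x i)) * Dg i x)).
      apply: (derivable_pt_lim_scal (fun t => g (upd x i t) * g (upd x i t))).
      exact: (derivable_pt_lim_mult (fun t => g (upd x i t)) (fun t => g (upd x i t))).
    have e2 : derivable_pt_lim (fun t => (norm2 (fun j => x j - x0 j) - (x i - x0 i) * (x i - x0 i)) +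
       (t - x0 i) * (t - x0 i)) (x i) (0 + (1 * (x i - x0 i) + (x i - x0 i) * 1)).
      apply: (derivable_pt_lim_plus (fun=> _) (fun t => (t - x0 i) * (t - x0 i))); first exact: derivable_pt_lim_const.
      exact: (derivable_pt_lim_mult (fun t => t - x0 i) (fun t => t - x0 i)).
    have := derivable_pt_lim_plus _ _ _ _ _ (derivable_pt_lim_minus _ _ _ _ _ dg e1) e2.
    rewrite upd_id.
    have -> : Dg i x - K * (Dg i x * g x + g x * Dg i x) + (0 + (1 * (x i - x0 i) + (x i - x0 i) * 1)) = DW i x.
      by rewrite /DW; ring.
    by apply: derivable_pt_lim_eq => t; rewrite /W norm2_upd.
  have dDW : has_partial i (DW i) x (Dii i x).
    have e1 : derivable_pt_lim (fun t => 1 - 2 * K * g (upd x i t)) (x i) (0 - 2 * K * Dg i x).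
      apply: (derivable_pt_lim_minus (fun=> 1) (fun t => 2 * K * g (upd x i t))); first exact: derivable_pt_lim_const.
      exact: (derivable_pt_lim_scal (fun t => g (upd x i t))).
    have e2 := derivable_pt_lim_mult _ _ _ _ _ dDg e1.
    have e3 := derivable_pt_lim_scal _ 2 _ _ did.
    have := derivable_pt_lim_plus _ _ _ _ _ e2 e3.
    rewrite upd_id.
    have -> : D2g i i x * (1 - 2 * K * g x) + Dg i x * (0 - 2 * K * Dg i x) + 2 * 1 = Dii i x.
      by rewrite /Dii; ring.
    by apply: derivable_pt_lim_eq => t; rewrite /DW upd_i.
  have [h1 h2] := Hr2 i x (b2 x hx).
  by split=> //; [rewrite /q; move: h1|have := HLw i; move: h2]; split_Rabs; lra.
- have -> : \sum_(i < N) q i = Lp - 2 * K * S + INR N * 3.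
    rewrite /Lp /S -sum_scal -sum_sub -sum_const -sum_add; apply: sum_ext => i.
    by rewrite /q /Dii g0; ring.
  by rewrite KS; have := Rle_abs Lp; lra.
- move=> x Ox hx i; apply: Rle_trans (n2 x i) _.
  have gp := gpos x (b1 x hx) Ox.
  have gK : g x <= / K by have := Hr3 x (b3 x hx); rewrite g0; split_Rabs; lra.
  have : K * g x <= 1.
    by rewrite -(Rinv_r K); [apply: Rmult_le_compat_l; lra|lra].
  by rewrite /W; nra.
move=> e he; have [d [hd Hd]] := cW e he; exists d; split=> // x /Hd; rewrite W0; split_Rabs; lra.
Qed.

(** * Limits along an ultrafilter *)

(** A free ultrafilter gives every bounded sequence a limit. One choice serves [u] and its
    difference quotients at all points at once, in place of compactness and diagonal
    subsequences. *)
Record ultra (F : (nat -> Prop) -> Prop) : Prop := Ultra {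
  ultra_em : forall P, F P \/ F (fun n => ~ P n);
  ultra_and : forall P Q, F P -> F Q -> F (fun n => P n /\ Q n);
  ultra_sub : forall P Q : nat -> Prop, (forall n, P n -> Q n) -> F P -> F Q;
  ultra_ne : forall P, F P -> exists n, P n;
  ultra_ge : forall n0, F (fun n => (n0 <= n)%nat) }.

Lemma ultra_ex : exists F, ultra F.
Proof.
have [F [UF sF]] := @filter.ultraFilterLemma nat filter.eventually filter.eventually_filter.
have PF := @filter.ultra_proper _ _ UF.
have FF := @filter.filter_filter _ _ PF.
exists F; split.
- by move=> P; case: (@filter.in_ultra_setVsetC nat F P UF) => h; [left|right].
- by move=> P Q hP hQ; apply: (@filter.filterI _ F FF P Q).
- by move=> P Q PQ hP; apply: (@filter.filterS _ F FF P Q).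
- by move=> P hP; have [n hn] := @filter.filter_ex _ F PF P hP; exists n.
by move=> n0; apply: sF; exists n0.
Qed.

Section UltraLimit.
Context (F : (nat -> Prop) -> Prop) (HF : ultra F).
Implicit Types (f g : nat -> R).

Definition cv f (l : R) : Prop := forall e, 0 < e -> F (fun n => Rabs (f n - l) < e).
Definition ulim f : R := epsilon (inhabits 0) (cv f).

Lemma ultra_all (P : nat -> Prop) : (forall n, P n) -> F P.
Proof. by move=> H; apply: (ultra_sub F HF _ _ _ (ultra_ge F HF 0%N)) => n _; apply: H. Qed.

Lemma ultra_and2 (P Q S : nat -> Prop) : (forall n, P n -> Q n -> S n) -> F P -> F Q -> F S.
Proof. by move=> H hP hQ; apply: (ultra_sub F HF _ _ _ (ultra_and F HF _ _ hP hQ)) => n [? ?]; apply: H. Qed.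

(** The limit is the supremum of the [t] that lie below [f] on a large set. Maximality of the
    ultrafilter turns the failure of [l + e / 2 <= f] into a bound on a large set. *)
Lemma cv_ex f C : F (fun n => Rabs (f n) <= C) -> exists l, cv f l.
Proof.
move=> HC; pose E t := F (fun n => t <= f n).
have bE : bound E.
  exists C => t Et; have [n [h1 h2]] := ultra_ne F HF _ (ultra_and F HF _ _ HC Et).
  by move: h1; split_Rabs; lra.
have nE : exists t, E t.
  by exists (- C); apply: (ultra_sub F HF _ _ _ HC) => n h; move: h; split_Rabs; lra.
have [l [ub lb]] := completeness E bE nE; exists l => e he.
have h1 : F (fun n => l - e < f n).
  have [t [Et ht]] : exists t, E t /\ l - e < t.
    apply: NNPP => no; have : l <= l - e; last lra.
    apply: lb => t Et; apply: Rnot_lt_le => ht; apply: no; by exists t.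
  by apply: (ultra_sub F HF _ _ _ Et) => n; lra.
have h2 : F (fun n => ~ l + e / 2 <= f n).
  by case: (ultra_em F HF (fun n => l + e / 2 <= f n)) => // /ub; lra.
by apply: (ultra_and2 _ _ _ _ h1 h2) => n a b; split_Rabs; lra.
Qed.

Lemma ulim_cv f C : F (fun n => Rabs (f n) <= C) -> cv f (ulim f).
Proof. by move=> /cv_ex h; apply: epsilon_spec. Qed.

Lemma cv_le f g l l' : cv f l -> cv g l' -> F (fun n => f n <= g n) -> l <= l'.
Proof.
move=> Hf Hg H; apply: le_epsilon => e he.
have [n [[h1 h2] h3]] := ultra_ne F HF _ (ultra_and F HF _ _ (ultra_and F HF _ _ (Hf (e / 2) ltac:(lra)) (Hg (e / 2) ltac:(lra))) H).
by move: h1 h2 h3; split_Rabs; lra.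
Qed.

Lemma cv_eq f g l l' : cv f l -> cv g l' -> F (fun n => f n = g n) -> l = l'.
Proof.
move=> Hf Hg H; apply: Rle_antisym; [apply: (cv_le f g)|apply: (cv_le g f)] => //.
  by apply: (ultra_sub F HF _ _ _ H) => n ->; lra.
by apply: (ultra_sub F HF _ _ _ H) => n ->; lra.
Qed.

Lemma cv_const k : cv (fun=> k) k.
Proof. by move=> e he; apply: ultra_all => n; rewrite Rminus_diag_eq // Rabs_R0. Qed.

Lemma cv_ext f g l : F (fun n => f n = g n) -> cv f l -> cv g l.
Proof. by move=> H Hf e he; apply: (ultra_and2 _ _ _ _ H (Hf e he)) => n <-. Qed.

Lemma cv_add f g l l' : cv f l -> cv g l' -> cv (fun n => f n + g n) (l + l').
Proof.
move=> Hf Hg e he; apply: (ultra_and2 _ _ _ _ (Hf (e / 2) ltac:(lra)) (Hg (e / 2) ltac:(lra))) => n h1 h2.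
by move: h1 h2; split_Rabs; lra.
Qed.

Lemma cv_mul f g l l' : cv f l -> cv g l' -> cv (fun n => f n * g n) (l * l').
Proof.
move=> Hf Hg e he.
set M := Rabs l + Rabs l' + 1.
have M1 : 1 <= M by rewrite /M; have := Rabs_pos l; have := Rabs_pos l'; lra.
set e' := Rmin 1 (e / (4 * M)).
have he' : 0 < e' by apply: Rmin_glb_lt; [lra|apply: Rdiv_lt_0_compat; lra].
have e1 : e' <= 1 by apply: Rmin_l.
have e2 : e' * (4 * M) <= e.
  have -> : e = e / (4 * M) * (4 * M) by field; lra.
  by apply: Rmult_le_compat_r; [lra|apply: Rmin_r].
apply: (ultra_and2 _ _ _ _ (Hf e' he') (Hg e' he')) => n h1 h2.
have b1 : Rabs (f n) <= M by rewrite /M; have := Rabs_pos l'; move: h1; split_Rabs; lra.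
have b2 : Rabs l' <= M by rewrite /M; have := Rabs_pos l; lra.
have := Rabs_mul_sub _ _ _ _ _ _ _ _ b1 b2 (Rlt_le _ _ h1) (Rlt_le _ _ h2); lra.
Qed.

Lemma cv_sub f g l l' : cv f l -> cv g l' -> cv (fun n => f n - g n) (l - l').
Proof.
move=> Hf Hg; have -> : l - l' = l + (-1) * l' by ring.
apply: (cv_ext (fun n => f n + (-1) * g n)); first by apply: ultra_all => n; ring.
by apply: cv_add => //; apply: cv_mul => //; exact: cv_const.
Qed.

Lemma cv_squeeze f g l : cv g 0 -> F (fun n => Rabs (f n - l) <= g n) -> cv f l.
Proof.
move=> Hg H e he; apply: (ultra_and2 _ _ _ _ H (Hg e he)) => n h1 h2.
by move: h1 h2; split_Rabs; lra.
Qed.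

Lemma cv_pos f l : cv f l -> cv (fun n => pos (f n)) (pos l).
Proof.
move=> Hf e he; apply: (ultra_sub F HF _ _ _ (Hf e he)) => n h.
by apply: Rle_lt_trans h; apply: pos_lip.
Qed.

Lemma cv_abs_le f l b : cv f l -> F (fun n => Rabs (f n) <= b) -> Rabs l <= b.
Proof.
move=> Hf H; apply: Rabs_le; split.
  by apply: (cv_le (fun=> - b) f) => //; [exact: cv_const|apply: (ultra_sub F HF _ _ _ H) => n h; move: h; split_Rabs; lra].
by apply: (cv_le f (fun=> b)) => //; [exact: cv_const|apply: (ultra_sub F HF _ _ _ H) => n h; move: h; split_Rabs; lra].
Qed.

Lemma cv_sum (N : nat) (f : 'I_N -> nat -> R) (l : 'I_N -> R) : (forall i, cv (f i) (l i)) ->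
  cv (fun n => \sum_(i < N) f i n) (\sum_(i < N) l i).
Proof.
move=> H; suff : forall s : seq 'I_N, cv (fun n => \big[Rplus/0]_(i <- s) f i n) (\big[Rplus/0]_(i <- s) l i) by apply.
elim=> [|i s IH].
  by rewrite big_nil; apply: (cv_ext (fun=> 0)); [apply: ultra_all => n; rewrite big_nil|exact: cv_const].
rewrite big_cons; apply: (cv_ext (fun n => f i n + \big[Rplus/0]_(j <- s) f j n)).
  by apply: ultra_all => n; rewrite big_cons.
exact: cv_add.
Qed.

Definition mesh (n : nat) : R := / (INR n + 1).

Lemma mesh_pos n : 0 < mesh n <= 1.
Proof.
have := pos_INR n => h; split; first by apply: Rinv_0_lt_compat; lra.
by rewrite -Rinv_1; apply: Rinv_le_contravar; lra.
Qed.

Lemma mesh_small e : 0 < e -> F (fun n => mesh n < e).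
Proof.
move=> he; have [n0 hn0] : exists n0, / e < INR n0.
  have [h1 _] := archimed (Rabs (/ e)).
  exists (Z.to_nat (up (Rabs (/ e)))); rewrite INR_IZR_INZ Z2Nat.id.
    by have := Rle_abs (/ e); lra.
  by apply: le_IZR; have := Rabs_pos (/ e); lra.
apply: (ultra_sub F HF _ _ _ (ultra_ge F HF n0)) => n hn.
have h1 : INR n0 <= INR n by apply: le_INR; apply/leP.
rewrite /mesh -(Rinv_inv e); apply: Rinv_lt_contravar; last lra.
by have := Rinv_0_lt_compat _ he => ?; nra.
Qed.

Lemma cv_mesh_pow al k : 0 < al -> 0 < k -> cv (fun n => Rpower (k * mesh n) al) 0.
Proof.
move=> hal hk e he; set d := Rpower e (/ al).
have hd : 0 < d by apply: Rpower_pos.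
apply: (ultra_sub F HF _ _ _ (mesh_small (d / k) _)); last by positivity.
move=> n hn; have [m0 _] := mesh_pos n.
rewrite Rminus_0_r Rabs_pos_eq; last by positivity.
have -> : e = Rpower d al by rewrite /d Rpower_mult Rinv_l ?Rpower_1 //; lra.
apply: Rlt_Rpower_l => //; split; first exact: Rmult_lt_0_compat.
have -> : d = k * (d / k) by field; lra.
exact: Rmult_lt_compat_l.
Qed.
End UltraLimit.

(** [df_steps] for [w] minus the linear function of slope [D] in the coordinate [i]. *)
Lemma df_lin {N} i s (w : lat N -> R) x D b : (0 <= s)%Z ->
  (forall t, (0 <= t < s)%Z -> Rabs (df i 1 w (sh i t x) - D) <= b) ->
  Rabs (df i s w x - IZR s * D) <= IZR s * b.
Proof.
move=> hs H; pose v (y : lat N) := w y - IZR (y i) * D.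
have dv t y : df i t v y = df i t w y - IZR t * D.
  by rewrite /df /v sh_i plus_IZR; ring.
rewrite -dv; apply: df_steps => // t ht; rewrite dv Rmult_1_l; exact: H.
Qed.

Lemma pt_sh_i {N} h (k : lat N) i s : pt h (sh i s k) i = pt h k i + h * IZR s.
Proof. by rewrite pt_sh upd_i. Qed.

Lemma pt_sh_j {N} h (k : lat N) i s j : j != i -> pt h (sh i s k) j = pt h k j.
Proof. by move=> ji; rewrite pt_sh /upd (negbTE ji). Qed.

(** * Regularity of the limit *)

Section Good.
Context (F : (nat -> Prop) -> Prop) (HF : ultra F) {N : nat} (al : R) (Hal : 0 < al < 1).
Context (x0 : RN N) (rho : R) (Hrho : 0 < rho).

Definition inb n (k : lat N) : Prop := forall i, Rabs (pt (mesh n) k i - x0 i) <= rho.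

(** A bound and a Hoelder bound with one constant for all [n] in a set of the ultrafilter, as the
    estimates hold only for a fine mesh. Steps are positive; [good_diff] reads the negative ones
    from the other end. *)
Definition good C (G : nat -> lat N -> R) : Prop := F (fun n => forall k, inb n k ->
  Rabs (G n k) <= C /\ forall i s, (1 <= s)%Z -> mesh n * IZR s <= rho ->
    Rabs (df i s (G n) k) <= C * Rpower (mesh n * IZR s) al).

Definition flim (G : nat -> lat N -> R) (x : RN N) : R := ulim F (fun n => G n (floor_pt (mesh n) x)).

Lemma floor_near n (x : RN N) i : Rabs (pt (mesh n) (floor_pt (mesh n) x) i - x i) <= mesh n.
Proof. by have [h1 h2] := floor_ptP (mesh n) x i (mesh_pos n).1; split_Rabs; lra. Qed.

Lemma floor_in n x r : mesh n < rho - r -> box x0 r x -> inb n (floor_pt (mesh n) x).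
Proof. by move=> hn hx i; have := hx i; have := floor_near n x i; split_Rabs; lra. Qed.

Lemma ev_in x r : r < rho -> box x0 r x -> F (fun n => inb n (floor_pt (mesh n) x)).
Proof.
move=> hr hx; apply: (ultra_sub F HF _ _ _ (mesh_small F HF (rho - r) ltac:(lra))) => n hn.
exact: floor_in hn hx.
Qed.

Lemma flim_cv C G x r : good C G -> r < rho -> box x0 r x ->
  cv F (fun n => G n (floor_pt (mesh n) x)) (flim G x).
Proof.
move=> HG hr hx; apply: (ulim_cv F HF _ C).
by apply: (ultra_and2 F HF _ _ _ _ HG (ev_in x r hr hx)) => n h1 h2; have [] := h1 _ h2.
Qed.

Lemma floor_upd n (x : RN N) i t : exists s, floor_pt (mesh n) (upd x i t) = sh i s (floor_pt (mesh n) x) /\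
  Rabs (mesh n * IZR s - (t - x i)) <= mesh n.
Proof.
set k := floor_pt (mesh n) x; set k' := floor_pt (mesh n) (upd x i t).
exists (k' i - k i)%Z.
have e : k' = sh i (k' i - k i) k.
  apply: functional_extensionality => j; case: (altP (j =P i)) => [->|ji]; first by rewrite sh_i; lia.
  by rewrite sh_j // /k /k' /floor_pt /upd (negbTE ji).
split=> //.
have h1 := floor_ptP (mesh n) (upd x i t) i (mesh_pos n).1.
have h2 := floor_ptP (mesh n) x i (mesh_pos n).1.
rewrite upd_i -/k' in h1; rewrite -/k in h2; rewrite minus_IZR.
by rewrite /pt in h1 h2; split_Rabs; lra.
Qed.

Lemma good_diff C G n k i s : (forall k, inb n k -> Rabs (G n k) <= C /\ forall i s, (1 <= s)%Z -> mesh n * IZR s <= rho ->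
    Rabs (df i s (G n) k) <= C * Rpower (mesh n * IZR s) al) ->
  inb n k -> inb n (sh i s k) -> forall d, 0 < d -> d <= rho -> mesh n * Rabs (IZR s) <= d ->
  Rabs (G n (sh i s k) - G n k) <= C * Rpower d al.
Proof.
move=> H hk hk' d hd hdr hs; have [m0 _] := mesh_pos n.
have C0 : 0 <= C by have [h _] := H k hk; apply: Rle_trans h; apply: Rabs_pos.
have P t : (1 <= t)%Z -> mesh n * IZR t <= d -> Rpower (mesh n * IZR t) al <= Rpower d al.
  move=> ht htd; apply: Rle_Rpower_l; first lra.
  by split=> //; apply: Rmult_lt_0_compat => //; apply: (IZR_lt 0); lia.
case: (Z_lt_le_dec 0 s) => hs0.
  have sR : 0 < IZR s by apply: (IZR_lt 0).
  rewrite Rabs_pos_eq in hs; last lra.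
  have [_ h] := H k hk; apply: Rle_trans (h i s ltac:(lia) ltac:(lra)) _.
  by apply: Rmult_le_compat_l => //; apply: P => //; lia.
case: (Z.eq_dec s 0) => [->|ne].
  rewrite sh_0 Rminus_diag_eq // Rabs_R0; apply: Rmult_le_pos => //.
  by positivity.
have sR : IZR s < 0 by apply: (IZR_lt s 0); lia.
rewrite Rabs_left // -opp_IZR in hs.
have [_ h] := H _ hk'; have := h i (- s)%Z ltac:(lia) ltac:(lra).
rewrite /df sh_add Z.add_opp_diag_l sh_0 => h'; rewrite Rabs_minus_sym; apply: Rle_trans h' _.
by apply: Rmult_le_compat_l => //; apply: P => //; lia.
Qed.

Lemma good_C C G : good C G -> 0 <= C.
Proof.
move=> HG; have hx : box x0 (rho / 2) x0 by move=> i; rewrite Rminus_diag_eq // Rabs_R0; lra.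
have [n [h1 h2]] := ultra_ne F HF _ (ultra_and F HF _ _ HG (ev_in x0 (rho / 2) ltac:(lra) hx)).
by have [h _] := h1 _ h2; apply: Rle_trans h; apply: Rabs_pos.
Qed.

Lemma pow2 C tau : 0 <= C -> 0 < tau -> C * Rpower (2 * tau) al <= 2 * C * Rpower tau al.
Proof.
move=> hC ht; rewrite -Rpower_mult_distr //; last lra.
have : Rpower 2 al <= 2 by rewrite -[X in _ <= X](Rpower_1 2); [apply: Rle_Rpower; lra|lra].
move=> h; have := Rmult_le_compat_r (C * Rpower tau al) _ _ (Rmult_le_pos _ _ hC (Rlt_le _ _ (Rpower_pos _ _))) h.
lra.
Qed.

(** Rounding changes the displacement by at most one mesh, so once the mesh is below [tau] the
    lattice displacement is at most [2 tau]. *)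
Lemma flim_holder1 C G x i t : good C G -> box x0 (rho / 4) x -> Rabs (t - x0 i) < rho / 4 -> t <> x i ->
  Rabs (flim G (upd x i t) - flim G x) <= 2 * C * Rpower (Rabs (t - x i)) al.
Proof.
move=> HG hx ht ne.
have hx' : box x0 (rho / 4) (upd x i t) by apply: box_upd.
have c1 := flim_cv C G _ (rho / 4) HG ltac:(lra) hx; have c2 := flim_cv C G _ (rho / 4) HG ltac:(lra) hx'.
set tau := Rabs (t - x i).
have tau0 : 0 < tau by apply: Rabs_pos_lt; lra.
have taur : 2 * tau <= rho by have := hx i; rewrite /tau; move: ht; split_Rabs; lra.
apply: Rle_trans (pow2 C tau (good_C C G HG) tau0).
apply: (cv_abs_le F HF _ _ _ (cv_sub F HF _ _ _ _ c2 c1)).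
apply: (ultra_and2 F HF _ _ _ _ HG (ultra_and F HF _ _ (mesh_small F HF tau tau0)
  (ultra_and F HF _ _ (ev_in x (rho / 4) ltac:(lra) hx) (ev_in _ (rho / 4) ltac:(lra) hx')))) => n h1 [h2 [h3 h4]].
have [s [e hs]] := floor_upd n x i t.
rewrite e in h4 *; apply: (good_diff C G n) => //; first lra.
rewrite -{1}(Rabs_pos_eq (mesh n)); last by have := mesh_pos n; lra.
by rewrite -Rabs_mult; rewrite /tau in h2 *; move: hs h2; split_Rabs; lra.
Qed.

Lemma flim_holder C G x y d : good C G -> box x0 (rho / 4) x -> box x0 (rho / 4) y ->
  0 < d -> dist x y <= d -> Rabs (flim G x - flim G y) <= INR N * (2 * C) * Rpower d al.
Proof.
move=> HG hx hy hd hxy; have C0 := good_C C G HG.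
have -> : INR N * (2 * C) * Rpower d al = INR N * (2 * C * Rpower d al) by ring.
apply: path_bound => z i hz _.
have hzb : box x0 (rho / 4) z by move=> j; case: (hz j) => ->.
have Pd : 0 <= 2 * C * Rpower d al by positivity.
case: (Req_dec (x i) (z i)) => [->|ne].
  by rewrite upd_id Rminus_diag_eq // Rabs_R0.
apply: Rle_trans (flim_holder1 C G z i (x i) HG hzb (hx i) ne) _.
apply: Rmult_le_compat_l; first lra.
apply: Rle_Rpower_l; first lra.
split; first by apply: Rabs_pos_lt; lra.
case: (hz i) => hzi; rewrite hzi in ne *; last by case: ne.
by apply: Rle_trans hxy; apply: dist_coord.
Qed.

(** On the lattice the increment of [G] is a sum of first differences along a segment, each equal to
    the one at the start up to the mesh times the Hoelder oscillation of [G1]. The resulting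
    remainder, of order [|t - x i|^(1 + al)], passes to the limit, so the derivative of the limit is
    obtained without exchanging limit and derivative. *)
Lemma flim_taylor C G G1 x i t : good C G -> good C G1 ->
  (forall n k, G1 n k = df i 1 (G n) k / mesh n) ->
  box x0 (rho / 4) x -> Rabs (t - x0 i) < rho / 4 -> t <> x i ->
  Rabs (flim G (upd x i t) - flim G x - (t - x i) * flim G1 x) <=
    2 * Rabs (t - x i) * (2 * C * Rpower (Rabs (t - x i)) al).
Proof.
move=> HG HG1 EG hx ht ne.
have hx' : box x0 (rho / 4) (upd x i t) by apply: box_upd.
have c1 := flim_cv C G _ (rho / 4) HG ltac:(lra) hx; have c2 := flim_cv C G _ (rho / 4) HG ltac:(lra) hx'.
have c3 := flim_cv C G1 _ (rho / 4) HG1 ltac:(lra) hx.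
set tau := Rabs (t - x i).
have tau0 : 0 < tau by apply: Rabs_pos_lt; lra.
have taur : 2 * tau <= rho by have := hx i; rewrite /tau; move: ht; split_Rabs; lra.
have C0 := good_C C G HG.
apply: (Rle_trans _ (2 * tau * (C * Rpower (2 * tau) al))); last first.
  by apply: Rmult_le_compat_l; [lra|exact: pow2].
pose s n := (floor_pt (mesh n) (upd x i t) i - floor_pt (mesh n) x i)%Z.
have sE n : floor_pt (mesh n) (upd x i t) = sh i (s n) (floor_pt (mesh n) x).
  have [s' [e _]] := floor_upd n x i t; rewrite /s e sh_i.
  by congr sh; lia.
have sN n : Rabs (mesh n * IZR (s n) - (t - x i)) <= mesh n.
  have [s' [e h]] := floor_upd n x i t; rewrite /s e sh_i.
  by have -> : (floor_pt (mesh n) x i + s' - floor_pt (mesh n) x i = s')%Z by lia.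
have c4 : cv F (fun n => mesh n * IZR (s n)) (t - x i).
  move=> e he; apply: (ultra_sub F HF _ _ _ (mesh_small F HF e he)) => n hn.
  exact: Rle_lt_trans (sN n) hn.
apply: (cv_abs_le F HF _ _ _ (cv_sub F HF _ _ _ _ (cv_sub F HF _ _ _ _ c2 c1) (cv_mul F HF _ _ _ _ c4 c3))).
apply: (ultra_and2 F HF _ _ _ _ HG1 (ultra_and F HF _ _ (mesh_small F HF tau tau0)
  (ultra_and F HF _ _ (ev_in x (rho / 4) ltac:(lra) hx) (ev_in _ (rho / 4) ltac:(lra) hx')))) => n h1 [h2 [h3 h4]].
have [m0 m1] := mesh_pos n.
have hs := sN n.
have hst : mesh n * Rabs (IZR (s n)) <= 2 * tau.
  rewrite -{1}(Rabs_pos_eq (mesh n)); last lra.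
  by rewrite -Rabs_mult; rewrite /tau in h2 *; move: hs h2; split_Rabs; lra.
rewrite sE in h4 *; set k := floor_pt (mesh n) x in h3 h4 *; set sn := s n in hs hst h4 *.
set D := df i 1 (G n) k.
have G1D : mesh n * G1 n k = D by rewrite EG /D; field; lra.
have between t' : (0 <= t' <= sn)%Z \/ (sn <= t' <= 0)%Z -> inb n (sh i t' k).
  move=> ht' j; case: (altP (j =P i)) => [->|ji]; last by rewrite pt_sh_j //; exact: h3.
  have a1 := h3 i; have a2 := h4 i; rewrite pt_sh_i in a2; rewrite pt_sh_i.
  case: ht' => [[b1 b2]|[b1 b2]].
    have := Rmult_le_compat_l _ _ _ (Rlt_le _ _ m0) (IZR_le _ _ b1).
    have := Rmult_le_compat_l _ _ _ (Rlt_le _ _ m0) (IZR_le _ _ b2).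
    by move: a1 a2; split_Rabs; lra.
  have := Rmult_le_compat_l _ _ _ (Rlt_le _ _ m0) (IZR_le _ _ b1).
  have := Rmult_le_compat_l _ _ _ (Rlt_le _ _ m0) (IZR_le _ _ b2).
  by move: a1 a2; split_Rabs; lra.
have near t' : (0 <= t' <= sn)%Z \/ (sn <= t' <= 0)%Z ->
    Rabs (df i 1 (G n) (sh i t' k) - D) <= mesh n * (C * Rpower (2 * tau) al).
  move=> ht'; have e1 : df i 1 (G n) (sh i t' k) - D = mesh n * (G1 n (sh i t' k) - G1 n k).
    by rewrite Rmult_minus_distr_l G1D EG; field; lra.
  rewrite e1 Rabs_mult (Rabs_pos_eq (mesh n)); last lra.
  apply: Rmult_le_compat_l; first lra.
  apply: (good_diff C G1 n) => //; first exact: between; first lra.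
  apply: Rle_trans hst; apply: Rmult_le_compat_l; first lra.
  by rewrite -!abs_IZR; apply: IZR_le; lia.
have Cp : 0 <= C * Rpower (2 * tau) al by positivity.
suff K : Rabs (G n (sh i sn k) - G n k - IZR sn * D) <= Rabs (IZR sn) * (mesh n * (C * Rpower (2 * tau) al)).
  have -> : G n (sh i sn k) - G n k - mesh n * IZR sn * G1 n k = G n (sh i sn k) - G n k - IZR sn * D.
    by rewrite -G1D; ring.
  apply: Rle_trans K _.
  have -> : Rabs (IZR sn) * (mesh n * (C * Rpower (2 * tau) al)) = (mesh n * Rabs (IZR sn)) * (C * Rpower (2 * tau) al) by ring.
  exact: Rmult_le_compat_r.
case: (Z_le_gt_dec 0 sn) => hsn.
  rewrite (Rabs_pos_eq (IZR sn)); last exact: IZR_le.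
  by apply: (df_lin i sn (G n) k D) => // t' ht'; apply: near; left; lia.
have e2 : IZR (- sn) = - IZR sn by rewrite opp_IZR.
have sneg : IZR sn < 0 by apply: (IZR_lt sn 0); lia.
(* A backward move is read from its end point, so that [df_lin] applies to a positive number of
   steps. *)
have := df_lin i (- sn) (G n) (sh i sn k) D (mesh n * (C * Rpower (2 * tau) al)) ltac:(lia).
have b t' : (0 <= t' < - sn)%Z -> Rabs (df i 1 (G n) (sh i t' (sh i sn k)) - D) <= mesh n * (C * Rpower (2 * tau) al).
  by move=> ht'; rewrite sh_add; apply: near; right; lia.
move=> /(_ b); rewrite {1}/df sh_add Z.add_opp_diag_l sh_0 e2 (Rabs_left (IZR sn)) //.
have -> : G n k - G n (sh i sn k) - - IZR sn * D = - (G n (sh i sn k) - G n k - IZR sn * D) by ring.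
by rewrite Rabs_Ropp.
Qed.

Lemma flim_deriv C G G1 x i : good C G -> good C G1 ->
  (forall n k, G1 n k = df i 1 (G n) k / mesh n) ->
  box x0 (rho / 4) x -> has_partial i (flim G) x (flim G1 x).
Proof.
move=> HG HG1 EG hx e he; have C0 := good_C C G HG.
set b := e / (4 * C + 1); have hb : 0 < b by apply: Rdiv_lt_0_compat; lra.
set d := Rmin (Rpower b (/ al)) (rho / 4 - Rabs (x i - x0 i)).
have hd : 0 < d by apply: Rmin_glb_lt; [exact: Rpower_pos|have := hx i; lra].
exists (mkposreal d hd) => u u0 hu; simpl in hu.
have hu1 : Rabs u < Rpower b (/ al) by apply: Rlt_le_trans hu _; apply: Rmin_l.
have hu2 : Rabs u < rho / 4 - Rabs (x i - x0 i) by apply: Rlt_le_trans hu _; apply: Rmin_r.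
have h := flim_taylor C G G1 x i (x i + u) HG HG1 EG hx ltac:(move: hu2; split_Rabs; lra) ltac:(lra).
have eu : x i + u - x i = u by ring.
rewrite eu in h; rewrite upd_id.
have au : 0 < Rabs u by apply: Rabs_pos_lt.
have -> : (flim G (upd x i (x i + u)) - flim G x) / u - flim G1 x =
  (flim G (upd x i (x i + u)) - flim G x - u * flim G1 x) * / u by field.
rewrite Rabs_mult Rabs_inv.
have pw : Rpower (Rabs u) al < b.
  have -> : b = Rpower (Rpower b (/ al)) al by rewrite Rpower_mult Rinv_l ?Rpower_1 //; lra.
  by apply: Rlt_Rpower_l; lra.
apply: (Rle_lt_trans _ (4 * C * Rpower (Rabs u) al)).
  apply: (Rmult_le_reg_r (Rabs u)) => //; rewrite Rmult_assoc Rinv_l ?Rmult_1_r; lra.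
apply: (Rle_lt_trans _ (4 * C * b)); first by apply: Rmult_le_compat_l; lra.
have : e = (4 * C + 1) * b by rewrite /b; field; lra.
lra.
Qed.
End Good.

(** * The limit solves the equation *)

Lemma pos_scal h t : 0 <= h -> pos (h * t) = h * pos t.
Proof.
move=> hh; rewrite /pos /Rmax; case: Rle_dec => h1; case: Rle_dec => h2; nra.
Qed.

Lemma Rpower_small C e al : 0 <= C -> 0 < e -> 0 < al -> exists d, 0 < d /\ C * Rpower d al < e.
Proof.
move=> hC he hal; exists (Rpower (e / (C + 1)) (/ al)); split; first exact: Rpower_pos.
have h : 0 < e / (C + 1) by positivity.
rewrite Rpower_mult Rinv_l ?Rpower_1 //; last lra.
have : e = (C + 1) * (e / (C + 1)) by field; lra.
lra.
Qed.

(** The forward second difference is centred one step ahead of its base point, hence the shift by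
    [-1]; [cv_shift] removes it in the limit. *)
Lemma lap_df2 {N} (w : lat N -> R) k : lap w k = \sum_(i < N) df2 i i 1 w (sh i (-1) k).
Proof.
apply: sum_ext => i; rewrite /df2 /df !sh_add /=.
by rewrite sh_0; ring.
Qed.

Section Limit.
Context {N : nat} (Omega : RN N -> Prop) (a c : RN N -> R) (Mx A Cc K al : R).
Context (F : (nat -> Prop) -> Prop) (u : nat -> lat N -> R).
Hypotheses (NN : (0 < N)%nat) (Hal : 0 < al < 1) (HMx : 0 < Mx) (HA : 0 < A) (HCc : 0 < Cc) (HK : 0 <= K).
Hypothesis Hop : is_open Omega.
Hypothesis Ha : forall x, Omega x -> 0 < a x <= A.
Hypothesis Hc : forall x, Omega x -> 0 < c x <= Cc.
Hypothesis Hac : forall x y d, Omega x -> Omega y -> 0 < d -> dist x y <= d ->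
     Rabs (a x - a y) <= K * Rpower d al /\ Rabs (c x - c y) <= K * Rpower d al.
Hypothesis HF : ultra F.
Hypothesis Hu : forall n, scheme Omega a c Mx (mesh n) (u n).

Definition dq1 (i : 'I_N) (n : nat) (k : lat N) : R := df i 1 (u n) k / mesh n.
Definition dq2 (i j : 'I_N) (n : nat) (k : lat N) : R := df j 1 (dq1 i n) k / mesh n.

Lemma dq2E i j n k : dq2 i j n k = df2 j i 1 (u n) k / (mesh n * mesh n).
Proof. by have := mesh_pos n => ?; rewrite /dq2 /df2 /dq1 /df; field; lra. Qed.

Lemma df_dq1 i l s n k : df l s (dq1 i n) k = df l s (df i 1 (u n)) k / mesh n.
Proof. by rewrite /dq1 /df /Rdiv; ring. Qed.

Lemma df_dq2 i j l s n k : df l s (dq2 i j n) k = df l s (df2 j i 1 (u n)) k / (mesh n * mesh n).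
Proof. by rewrite /df !dq2E /Rdiv; ring. Qed.

Lemma scheme_good x0 : Omega x0 -> exists rho C m, [/\ 0 < rho, 0 < m,
  (forall x, (forall i, Rabs (x i - x0 i) <= rho) -> Omega x),
  F (fun n => forall k, inb x0 rho n k -> m <= u n k) &
  [/\ good F al x0 rho C u, forall i, good F al x0 rho C (dq1 i) & forall i j, good F al x0 rho C (dq2 i j)]].
Proof.
move=> O0.
have N1 : 1 <= INR N by apply: (le_INR 1); apply/leP.
have [rO [hrO HrO]] := Hop x0 O0.
have a0 := Ha x0 O0.
have [d [hd Hd]] := Rpower_small K (a x0 / 2) al HK ltac:(lra) ltac:(lra).
set r1 := Rmin rO d; have hr1 : 0 < r1 by apply: Rmin_glb_lt.
have Hin x : dist x0 x < r1 -> Omega x /\ a x0 / 2 <= a x.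
  move=> hx; have Ox : Omega x by apply: HrO; apply: Rlt_le_trans hx _; apply: Rmin_l.
  split=> //; have hxd : dist x0 x <= d by apply: Rlt_le; apply: Rlt_le_trans hx _; apply: Rmin_r.
  by have [h _] := Hac x0 x d O0 Ox hd hxd; move: h; split_Rabs; lra.
have [m [hm low]] := scheme_lower Omega a c Mx Cc (a x0 / 2) r1 x0 NN ltac:(lra) hr1 Hc Hin.
set r := r1 / (2 * INR N) in low.
have hr : 0 < r by apply: Rdiv_lt_0_compat; lra.
have HO x : (forall i, Rabs (x i - x0 i) <= r) -> Omega x.
  move=> hx; apply: (Hin x _).1; rewrite dist_sym; apply: Rle_lt_trans (dist_box _ _ _ hx) _.
  have -> : INR N * r = r1 / 2 by rewrite /r; field; lra.
  lra.
have [rho [C [hrho [hC loc]]]] := scheme_local Omega a c Mx A Cc K al r m x0 Hal HMx ltac:(lra) ltac:(lra) HK hr hm Ha Hc Hac HO low.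
(* At most half the radius, because increments over [s] steps leave the smaller box; at most 1, so
   that a length is bounded by its power [al] and Lipschitz bounds become Hoelder bounds. *)
set rh := Rmin 1 (rho / 2).
have hrh : 0 < rh by apply: Rmin_glb_lt; lra.
have rh1 : rh <= 1 by apply: Rmin_l.
have rh2 : rh <= rho / 2 by apply: Rmin_r.
exists rh, (Mx + C), m; split=> //.
- by move=> x hx; apply: HO => i; apply: Rle_trans (hx i) _; lra.
- apply: (ultra_all F HF) => n k hk; apply: (low _ _ (mesh_pos n) (Hu n)) => i.
  by apply: Rle_trans (hk i) _; lra.
have E n k : mesh n < rho -> (forall i, Rabs (pt (mesh n) k i - x0 i) <= rho) -> forall i j,
    [/\ Rabs (df i 1 (u n) k) <= C * mesh n, Rabs (df2 i j 1 (u n) k) <= C * (mesh n * mesh n) &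
        forall l s, (1 <= s)%Z -> mesh n * IZR s <= rho ->
          Rabs (df l s (df2 i j 1 (u n)) k) <= C * (mesh n * mesh n) * Rpower (mesh n * IZR s) al].
  by move=> hn hk i j; apply: (loc _ _ (mesh_pos n) _ (Hu n)) => //; lra.
have ev := mesh_small F HF rho ltac:(lra).
have wide n k : inb x0 rh n k -> forall i, Rabs (pt (mesh n) k i - x0 i) <= rho.
  by move=> hk i; apply: Rle_trans (hk i) _; lra.
have shift n k l s t : inb x0 rh n k -> (0 <= t < s)%Z -> mesh n * IZR s <= rh ->
    forall i, Rabs (pt (mesh n) (sh l t k) i - x0 i) <= rho.
  move=> hk ht hs i; have [m0 _] := mesh_pos n; have := hk i.
  case: (altP (i =P l)) => [->|il]; last by rewrite pt_sh_j //; lra.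
  rewrite pt_sh_i.
  have t0 := Rmult_le_compat_l _ _ _ (Rlt_le _ _ m0) (IZR_le 0 t ltac:(lia)).
  have t1 := Rmult_le_compat_l _ _ _ (Rlt_le _ _ m0) (IZR_le t s ltac:(lia)).
  by split_Rabs; lra.
have pw n s : (1 <= s)%Z -> mesh n * IZR s <= rh -> C * (mesh n * IZR s) <= (Mx + C) * Rpower (mesh n * IZR s) al.
  move=> hs hsr; have [m0 _] := mesh_pos n.
  have sp : 0 < mesh n * IZR s by apply: Rmult_lt_0_compat => //; apply: (IZR_lt 0); lia.
  have := Rpower_ge_id (mesh n * IZR s) al ltac:(lra) ltac:(lra).
  move/(Rmult_le_compat_l C _ _ (Rlt_le _ _ hC)).
  by have := Rmult_lt_0_compat _ _ HMx (Rpower_pos (mesh n * IZR s) al); lra.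
split.
- apply: (ultra_sub F HF _ _ _ ev) => n hn k hk; have [m0 _] := mesh_pos n; split.
    have [u0 u1 u2] := Hu n k; rewrite Rabs_pos_eq //.
    case: (classic (Omega (pt (mesh n) k))) => [/u2 [h _]|/u1 ->]; lra.
  move=> l s hs hsr; apply: Rle_trans (pw n s hs hsr).
  have -> : C * (mesh n * IZR s) = IZR s * (C * mesh n) by ring.
  apply: df_steps; first lia.
  by move=> t ht; have [h _ _] := E n _ hn (shift n k l s t hk ht hsr) l l.
- move=> i; apply: (ultra_sub F HF _ _ _ ev) => n hn k hk; have [m0 _] := mesh_pos n.
  have im : 0 < / mesh n by positivity.
  split.
    have [h _ _] := E n k hn (wide n k hk) i i.
    rewrite /dq1 /Rdiv Rabs_mult (Rabs_pos_eq (/ _)); last lra.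
    have := Rmult_le_compat_r _ _ _ (Rlt_le _ _ im) h.
    have -> : C * mesh n * / mesh n = C by field; lra.
    lra.
  move=> l s hs hsr; apply: Rle_trans (pw n s hs hsr).
  rewrite df_dq1 /Rdiv Rabs_mult (Rabs_pos_eq (/ _)); last lra.
  have h : Rabs (df l s (df i 1 (u n)) k) <= IZR s * (C * (mesh n * mesh n)).
    apply: df_steps; first lia.
    by move=> t ht; have [_ h _] := E n _ hn (shift n k l s t hk ht hsr) l i.
  have := Rmult_le_compat_r _ _ _ (Rlt_le _ _ im) h.
  by have -> : IZR s * (C * (mesh n * mesh n)) * / mesh n = C * (mesh n * IZR s) by field; lra.
move=> i j; apply: (ultra_sub F HF _ _ _ ev) => n hn k hk; have [m0 _] := mesh_pos n.
have im : 0 < / (mesh n * mesh n) by positivity.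
have [_ h1 h2] := E n k hn (wide n k hk) j i.
split.
  rewrite dq2E /Rdiv Rabs_mult (Rabs_pos_eq (/ _)); last lra.
  have := Rmult_le_compat_r _ _ _ (Rlt_le _ _ im) h1.
  have -> : C * (mesh n * mesh n) * / (mesh n * mesh n) = C by field; lra.
  lra.
move=> l s hs hsr.
rewrite df_dq2 /Rdiv Rabs_mult (Rabs_pos_eq (/ _)); last lra.
have := Rmult_le_compat_r _ _ _ (Rlt_le _ _ im) (h2 l s hs ltac:(lra)).
have -> : C * (mesh n * mesh n) * Rpower (mesh n * IZR s) al * / (mesh n * mesh n) = C * Rpower (mesh n * IZR s) al by field; lra.
by have := Rmult_lt_0_compat _ _ HMx (Rpower_pos (mesh n * IZR s) al); lra.
Qed.

Lemma box_refl (x0 : RN N) r : 0 < r -> box x0 r x0.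
Proof. by move=> hr i; rewrite Rminus_diag_eq // Rabs_R0. Qed.

Lemma cv_shift C (G : nat -> lat N -> R) (x0 : RN N) rho i : 0 < rho -> good F al x0 rho C G ->
  cv F (fun n => G n (sh i (-1) (floor_pt (mesh n) x0))) (flim F G x0).
Proof.
move=> hrho HG.
have c1 := flim_cv F HF al x0 rho hrho C G x0 (rho / 2) HG ltac:(lra) (box_refl x0 (rho / 2) ltac:(lra)).
set l := flim F G x0 in c1 *.
have -> : l = l + 0 by ring.
apply: (cv_ext F HF (fun n => G n (floor_pt (mesh n) x0) +
  (G n (sh i (-1) (floor_pt (mesh n) x0)) - G n (floor_pt (mesh n) x0)))).
  by apply: (ultra_all F HF) => n; ring.
apply: (cv_add F HF) => //.
have c2 : cv F (fun n => C * Rpower (1 * mesh n) al) 0.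
  have -> : 0 = C * 0 by ring.
  by apply: (cv_mul F HF); [exact: cv_const|apply: (cv_mesh_pow F HF); lra].
apply: (cv_squeeze F HF _ _ _ c2).
apply: (ultra_and2 F HF _ _ _ _ HG (mesh_small F HF (rho / 2) ltac:(lra))) => n h1 hn.
have [m0 _] := mesh_pos n.
rewrite Rminus_0_r Rmult_1_l; apply: (good_diff al Hal x0 rho C G n) => //.
- by move=> j; have := floor_near n x0 j; lra.
- move=> j; have := floor_near n x0 j; case: (altP (j =P i)) => [->|ji]; last by rewrite pt_sh_j //; lra.
  by rewrite pt_sh_i; split_Rabs; lra.
- lra.
by rewrite -abs_IZR /=; lra.
Qed.

Lemma limit_pde x0 rho C m : Omega x0 -> 0 < rho -> 0 < m ->
  (forall x, (forall i, Rabs (x i - x0 i) <= rho) -> Omega x) ->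
  F (fun n => forall k, inb x0 rho n k -> m <= u n k) ->
  good F al x0 rho C u -> (forall i, good F al x0 rho C (dq1 i)) -> (forall i j, good F al x0 rho C (dq2 i j)) ->
  0 < flim F u x0 /\
  - \sum_(i < N) flim F (dq2 i i) x0 +
    c x0 / flim F u x0 * \sum_(i < N) (flim F (dq1 i) x0 * flim F (dq1 i) x0) = a x0.
Proof.
move=> O0 hrho hm HO Hlow Gu G1 G2.
have bx : box x0 (rho / 2) x0 by apply: box_refl; lra.
pose k n := floor_pt (mesh n) x0.
have cu : cv F (fun n => u n (k n)) (flim F u x0) by apply: (flim_cv F HF al x0 rho hrho C u x0 (rho / 2)) => //; lra.
have evin := ev_in F HF x0 rho hrho x0 (rho / 2) ltac:(lra) bx.
set U := flim F u x0 in cu *.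
have U0 : m <= U.
  apply: (cv_le F HF (fun=> m) _ _ _ (cv_const F HF m) cu).
  by apply: (ultra_and2 F HF _ _ _ _ Hlow evin) => n h1 h2; apply: h1.
split; first lra.
have N0 : 0 < INR N by apply: (lt_INR 0); apply/ltP.
have dk n : dist (pt (mesh n) (k n)) x0 <= INR N * mesh n.
  by apply: dist_box => i; apply: floor_near.
have cK : cv F (fun n => K * Rpower (INR N * mesh n) al) 0.
  have -> : 0 = K * 0 by ring.
  by apply: (cv_mul F HF); [exact: cv_const|apply: (cv_mesh_pow F HF); lra].
have evO : F (fun n => Omega (pt (mesh n) (k n))).
  by apply: (ultra_sub F HF _ _ _ evin) => n hn; apply: HO.
have Nm n : 0 < INR N * mesh n by apply: Rmult_lt_0_compat => //; have [] := mesh_pos n.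
have ca : cv F (fun n => a (pt (mesh n) (k n))) (a x0).
  apply: (cv_squeeze F HF _ _ _ cK); apply: (ultra_sub F HF _ _ _ evO) => n On.
  by have [h _] := Hac _ _ _ On O0 (Nm n) (dk n).
have cc : cv F (fun n => c (pt (mesh n) (k n))) (c x0).
  apply: (cv_squeeze F HF _ _ _ cK); apply: (ultra_sub F HF _ _ _ evO) => n On.
  by have [_ h] := Hac _ _ _ On O0 (Nm n) (dk n).
have c2 : cv F (fun n => \sum_(i < N) dq2 i i n (sh i (-1) (k n))) (\sum_(i < N) flim F (dq2 i i) x0).
  by apply: (cv_sum F HF) => i; exact: (cv_shift C (dq2 i i) x0 rho i hrho (G2 i i)).
set D2 := \sum_(i < N) flim F (dq2 i i) x0 in c2 *.
have c1 : cv F (fun n => \sum_(i < N) (pos (- dq1 i n (k n)) * pos (- dq1 i n (k n)) +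
     pos (dq1 i n (sh i (-1) (k n))) * pos (dq1 i n (sh i (-1) (k n)))))
     (\sum_(i < N) (flim F (dq1 i) x0 * flim F (dq1 i) x0)).
  apply: (cv_sum F HF) => i; set d := flim F (dq1 i) x0.
  have e1 : cv F (fun n => dq1 i n (k n)) d by apply: (flim_cv F HF al x0 rho hrho C (dq1 i) x0 (rho / 2)) => //; lra.
  have e2 : cv F (fun n => dq1 i n (sh i (-1) (k n))) d by exact: (cv_shift C (dq1 i) x0 rho i hrho (G1 i)).
  have e3 : cv F (fun n => - dq1 i n (k n)) (- d).
    have -> : - d = (-1) * d by ring.
    apply: (cv_ext F HF (fun n => (-1) * dq1 i n (k n))); first by apply: (ultra_all F HF) => n; ring.
    by apply: (cv_mul F HF); [exact: cv_const|].
  have p1 := cv_pos F HF _ _ e3; have p2 := cv_pos F HF _ _ e2.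
  (* The two one-sided squares see the limit slope [d] with opposite signs; only one of them
     survives, and it gives all of [d^2]. *)
  have -> : d * d = pos (- d) * pos (- d) + pos d * pos d.
    by case: (Rle_lt_dec 0 d) => h; [rewrite (pos_0 (- d)) ?(pos_id d); lra|rewrite (pos_id (- d)) ?(pos_0 d); lra].
  by apply: (cv_add F HF); apply: (cv_mul F HF).
set D1 := \sum_(i < N) (flim F (dq1 i) x0 * flim F (dq1 i) x0) in c1 *.
(* Multiplied by [u], so that only sums and products pass to the limit. *)
have lim_eq : U * D2 = c x0 * D1 - a x0 * U.
  apply: (cv_eq F HF _ _ _ _ (cv_mul F HF _ _ _ _ cu c2) (cv_sub F HF _ _ _ _ (cv_mul F HF _ _ _ _ cc c1) (cv_mul F HF _ _ _ _ ca cu))).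
  apply: (ultra_sub F HF _ _ _ evO) => n On.
  have [_ _ /(_ On) [hu eu]] := Hu n (k n).
  have [m0 _] := mesh_pos n.
  set h := mesh n in m0 eu *.
  have El : lap (u n) (k n) = h * h * \sum_(i < N) dq2 i i n (sh i (-1) (k n)).
    by rewrite lap_df2 -sum_scal; apply: sum_ext => i; rewrite dq2E -/h; field; lra.
  have Eg : upg (u n) (k n) = h * h * \sum_(i < N) (pos (- dq1 i n (k n)) * pos (- dq1 i n (k n)) +
     pos (dq1 i n (sh i (-1) (k n))) * pos (dq1 i n (sh i (-1) (k n)))).
    rewrite upgE -sum_scal; apply: sum_ext => i.
    have e1 y : df i 1 (u n) y = h * dq1 i n y by rewrite /dq1 -/h; field; lra.
    rewrite !e1; have -> : - (h * dq1 i n (k n)) = h * - dq1 i n (k n) by ring.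
    by rewrite !(pos_scal h); [ring|lra|lra].
  rewrite El Eg in eu.
  set s2 := \sum_(i < N) dq2 i i n (sh i (-1) (k n)) in eu *.
  set s1 := \sum_(i < N) (pos (- dq1 i n (k n)) * _ + _) in eu *.
  apply: (Rmult_eq_reg_l (h * h)); last nra.
  have -> : h * h * (u n (k n) * s2) = u n (k n) * (h * h * s2) by ring.
  by rewrite eu; field; lra.
have : D2 = (c x0 * D1 - a x0 * U) / U by rewrite -lim_eq; field; lra.
by move=> ->; field; lra.
Qed.

(** Near a boundary point the lattice points inside are controlled by the barrier and the others
    carry the value 0, so the bound holds on a full neighbourhood, the point itself included. *)
Lemma limit_boundary x0 : C2a_boundary Omega al -> boundary Omega x0 -> forall e, 0 < e ->
  exists d, 0 < d /\ forall y, box x0 d y -> Rabs (flim F u y) <= e.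
Proof.
move=> Hbd bx0 e he.
have [d [h0 [hd [hh0 H]]]] := scheme_boundary Omega al a c Mx A x0 NN HMx HA Ha (fun x Ox => (Hc x Ox).1) Hbd bx0 e he.
exists (d / 2); split; first lra.
move=> y hy.
have ev : F (fun n => Rabs (u n (floor_pt (mesh n) y)) <= e).
  apply: (ultra_and2 F HF _ _ _ _ (mesh_small F HF h0 hh0) (mesh_small F HF (d / 2) ltac:(lra))) => n n1 n2.
  have [u0 u1 _] := Hu n (floor_pt (mesh n) y); rewrite Rabs_pos_eq //.
  case: (classic (Omega (pt (mesh n) (floor_pt (mesh n) y)))) => [On|/u1 ->]; last lra.
  apply: (H (mesh n) (u n)) => //; first by have := mesh_pos n; lra.
  by move=> i; have := hy i; have := floor_near n y i; split_Rabs; lra.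
exact: (cv_abs_le F HF _ _ _ (ulim_cv F HF _ _ ev) ev).
Qed.
End Limit.

Theorem theorem1p1 (N : nat) (HN : (1 <= N)%nat) (Omega : RN N -> Prop)
  (alpha : R) (Halpha : 0 < alpha < 1)
  (Hdom : is_domain Omega) (Hbdd : is_bounded Omega)
  (Hbd : C2a_boundary Omega alpha)
  (a c : RN N -> R)
  (Ha : C0a_closure Omega alpha a) (Hc : C0a_closure Omega alpha c)
  (Hapos : forall x, closure Omega x -> 0 < a x)
  (Hcpos : forall x, closure Omega x -> 0 < c x) :
  exists (u : RN N -> R) (Du : 'I_N -> RN N -> R) (D2u : 'I_N -> 'I_N -> RN N -> R),
    cont_on (closure Omega) u /\
    C2a_with Omega alpha u Du D2u /\
    (forall x, Omega x -> 0 < u x) /\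
    (forall x, boundary Omega x -> u x = 0) /\
    (forall x, Omega x ->
       - laplacian D2u x + c x / u x * grad_sq Du x = a x).
Proof.
have [F HF] := ultra_ex.
have hal : 0 < alpha by lra.
have [_ [Hop _]] := Hdom.
have [Ka [HKa Ha1]] := holder_upd _ _ _ hal Ha.
have [Kc [HKc Hc1]] := holder_upd _ _ _ hal Hc.
have [A [HA HaA]] := holder_bounded Omega alpha a hal Hbdd Ha.
have [Cc [HCc HcC]] := holder_bounded Omega alpha c hal Hbdd Hc.
have Ha2 x : Omega x -> 0 < a x <= A.
  by move=> Ox; have := Hapos x (in_closure _ _ Ox); have := HaA x Ox; split_Rabs; lra.
have Hc2 x : Omega x -> 0 < c x <= Cc.
  by move=> Ox; have := Hcpos x (in_closure _ _ Ox); have := HcC x Ox; split_Rabs; lra.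
set K := Ka + Kc.
have HK : 0 <= K by rewrite /K; lra.
have Hac x y d : Omega x -> Omega y -> 0 < d -> dist x y <= d ->
    Rabs (a x - a y) <= K * Rpower d alpha /\ Rabs (c x - c y) <= K * Rpower d alpha.
  move=> Ox Oy hd hxy; have P := Rlt_le _ _ (Rpower_pos d alpha).
  have := Ha1 x y d (in_closure _ _ Ox) (in_closure _ _ Oy) hd hxy.
  have := Hc1 x y d (in_closure _ _ Ox) (in_closure _ _ Oy) hd hxy.
  have := Rmult_le_pos _ _ HKa P; have := Rmult_le_pos _ _ HKc P; rewrite /K; lra.
have [Mx [HMx ex]] := scheme_ex Omega a c A HN Hbdd Ha2 (fun x Ox => (Hc2 x Ox).1).
have [u Hu] : exists u : nat -> lat N -> R, forall n, scheme Omega a c Mx (mesh n) (u n).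
  exists (fun n => proj1_sig (ClassicalEpsilon.constructive_indefinite_description _ (ex (mesh n) (mesh_pos n)))) => n.
  by case: ClassicalEpsilon.constructive_indefinite_description.
have loc := scheme_good Omega a c Mx A Cc K alpha F u HN Halpha HMx HA HCc HK Hop Ha2 Hc2 Hac HF Hu.
(* One radius and one constant serve [u] and its quotients of both orders; continuity in [Omega] and
   the Hoelder condition are read off from it. *)
have holder x0 : Omega x0 -> exists r B, [/\ 0 < r, 0 <= B, forall x, box x0 r x -> Omega x &
   forall G, [\/ G = u, exists i, G = dq1 u i | exists i j, G = dq2 u i j] ->
   forall x y d, box x0 r x -> box x0 r y -> 0 < d -> dist x y <= d ->
     Rabs (flim F G x - flim F G y) <= B * Rpower d alpha].
  move=> O0; have [rho [C [m [hrho hm HO _ [G0 G1 G2]]]]] := loc x0 O0.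
  have C0 := good_C F HF alpha x0 rho hrho C u G0.
  exists (rho / 4), (INR N * (2 * C)); split; first lra.
  - by positivity.
  - by move=> x hx; apply: HO => i; have := hx i; lra.
  by move=> G [->|[i ->]|[i [j ->]]] x y d; apply: flim_holder.
have cont G x0 : [\/ G = u, exists i, G = dq1 u i | exists i j, G = dq2 u i j] -> Omega x0 ->
    forall e, 0 < e -> exists d, 0 < d /\ forall y, dist x0 y < d -> Rabs (flim F G y - flim F G x0) < e.
  move=> HG O0 e he; have [r [B [hr hB _ H]]] := holder x0 O0.
  have [d [hd hde]] := Rpower_small B e alpha hB he hal.
  exists (Rmin r d); split; first exact: Rmin_glb_lt.
  move=> y hy; apply: Rle_lt_trans hde; apply: (H G HG) => //.
  - move=> i; rewrite Rabs_minus_sym; apply: Rle_lt_trans (dist_coord x0 y i) _.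
    by apply: Rlt_le_trans hy _; apply: Rmin_l.
  - exact: box_refl.
  by rewrite dist_sym; apply: Rlt_le; apply: Rlt_le_trans hy _; apply: Rmin_r.
have bdry := limit_boundary Omega a c Mx A Cc K alpha F u HN HMx HA Ha2 Hc2 Hac HF Hu.
(* The boundary value is not prescribed on [flim]: smallness near a boundary point is applied at the
   point itself, for every bound. *)
have zero x : boundary Omega x -> flim F u x = 0.
  move=> bx; apply: NNPP => ne; have h0 := Rabs_pos_lt _ ne.
  have [d [hd H]] := bdry x Hbd bx (Rabs (flim F u x) / 2) ltac:(lra).
  by have := H x (box_refl _ _ hd); lra.
exists (flim F u), (fun i => flim F (dq1 u i)), (fun i j => flim F (dq2 u i j)).
split.
  move=> x cx e he; case: (classic (Omega x)) => Ox.
    have [d [hd H]] := cont u x (Or31 _ _ erefl) Ox e he.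
    by exists d; split=> // y _; apply: H.
  have [d [hd H]] := bdry x Hbd (conj cx Ox) (e / 2) ltac:(lra).
  exists d; split=> // y _ hy; rewrite (zero x (conj cx Ox)) Rminus_0_r.
  apply: Rle_lt_trans (H y _) _; last lra.
  by move=> i; rewrite Rabs_minus_sym; apply: Rle_lt_trans (dist_coord x y i) hy.
split.
  split.
    move=> x Ox i; have [rho [C [m [hrho hm HO _ [G0 G1 G2]]]]] := loc x Ox.
    by apply: (flim_deriv F HF alpha Halpha x rho hrho C u (dq1 u i)) => //; apply: box_refl; lra.
  split.
    move=> x Ox i j; have [rho [C [m [hrho hm HO _ [G0 G1 G2]]]]] := loc x Ox.
    by apply: (flim_deriv F HF alpha Halpha x rho hrho C (dq1 u i) (dq2 u i j)) => //; apply: box_refl; lra.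
  have C0 G : [\/ G = u, exists i, G = dq1 u i | exists i j, G = dq2 u i j] -> cont_on Omega (flim F G).
    move=> HG x Ox e he; have [d [hd H]] := cont G x HG Ox e he.
    by exists d; split=> // y _; apply: H.
  split; first by apply: C0; apply: Or31.
  split; first by move=> i; apply: C0; apply: Or32; exists i.
  split; first by move=> i j; apply: C0; apply: Or33; exists i, j.
  move=> x Ox; have [r [B [hr hB HO H]]] := holder x Ox.
  have inbox y : dist x y < r -> box x r y.
    by move=> hy i; rewrite Rabs_minus_sym; apply: Rle_lt_trans (dist_coord x y i) hy.
  exists r; split=> //; split; first by move=> y /inbox; apply: HO.
  move=> i j; exists B => y z /inbox hy /inbox hz ne.
  apply: (H (dq2 u i j)) => //; first by apply: Or33; exists i, j.
    exact: dist_gt0.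
  exact: Rle_refl.
have fin x : Omega x -> 0 < flim F u x /\
    - \sum_(i < N) flim F (dq2 u i i) x +
    c x / flim F u x * \sum_(i < N) (flim F (dq1 u i) x * flim F (dq1 u i) x) = a x.
  move=> Ox; have [rho [C [m [hrho hm HO low [G0 G1 G2]]]]] := loc x Ox.
  exact: (limit_pde Omega a c Mx K alpha F u HN Halpha Hac HF Hu x rho C m).
by split; [move=> x /fin []|split; [exact: zero|move=> x /fin []]].
Qed.
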